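(* Let $d\ge 2$ and $T>0$. There is a set $D_0\subset\mathcal P_{2,1}(\mathbb R^d\times\mathbb R^d)$ such that, for every $\nu_0\in D_0$, there exists a unique dissipative solution $\eta$ with initial data $\nu_0$, and this $\eta$ is a free flow. Moreover $D_0$ is a dense $G_\delta$ subset of $\mathcal P_{2,1}(\mathbb R^d\times\mathbb R^d)$ with respect to the weak (narrow) topology.
   Context: $\mathcal P(X)$ denotes the Borel probability measures on $X$. Set $$\mathcal P_{2,1}(\mathbb R^d\times\mathbb R^d)=\Big\{\nu_0\in\mathcal P(\mathbb R^d\times\mathbb R^d):\ \int|x|^2\,\nu_0(dx\,dv)\le 1,\ \int|v|^2\,\nu_0(dx\,dv)\le 1\Big\}.$$ Space of curves: $\Gamma=\{\gamma\in L^2((-1,T);\mathbb R^d): \gamma|_{(-1,0)}\text{ affine}\}$ with the $L^2$ distance. The initial velocity is $W_0(\gamma)=\gamma(0)-\gamma(-1)$ (the slope of the affine part). $\mathcal P(\Gamma)$ carries the narrow topology (convergence against bounded continuous functions on $\Gamma$). Let $$\mathcal M(\Gamma)=\Big\{\eta\in\mathcal P(\Gamma):\ \int|\gamma(0)|^2\eta(d\gamma)\le 1,\ \int\|\dot\gamma\|^2_{L^2(-1,T)}\,\eta(d\gamma)\le T+1\Big\},$$ where $\|\dot\gamma\|_{L^2}=+\infty$ if $\gamma\notin W^{1,2}((-1,T);\mathbb R^d)$. Measures in $\mathcal M(\Gamma)$ are concentrated on $W^{1,2}$ curves, whose continuous representatives are used. For $t\in[0,T)$ let $\Gamma_t=L^2((t,T);\mathbb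 R^d)$ and $T_t:\Gamma\to\Gamma_t$, $T_t(\gamma)=\gamma|_{(t,T)}$. For $\eta\in\mathcal M(\Gamma)$ let $\eta=\int\omega^t_{\gamma'}\,(T_t)_\#\eta(d\gamma')$ be the disintegration of $\eta$ with respect to $T_t$ (so $\omega^t_{\gamma'}$ is a probability measure concentrated on $T_t^{-1}(\gamma')$), and let $$V_t(\gamma)=\int W_0(\gamma')\,\omega^t_{T_t(\gamma)}(d\gamma'),$$ i.e. the conditional expectation of $W_0$ given $T_t$ under $\eta$. A measure $\eta\in\mathcal M(\Gamma)$ is a dissipative solution (of the pressureless Euler system) if $\dot\gamma(t)=V_t(\gamma)$ for $\mathcal L^1\times\eta$-a.e. $(t,\gamma)\in[0,T]\times\Gamma$. With $e_0(\gamma)=\gamma(0)$, $\eta$ has initial data $\nu_0$ if $(e_0,W_0)_\#\eta=\nu_0$. A dissipative solution $\eta$ is a free flow if it is concentrated on a set of straight lines $\gamma(t)=x_0+tv_0$ with empty mutual intersection, i.e. two distinct lines of the set never occupy the same position at the same time $t\in[0,T]$. *)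

(* Defs.v *)
From HB Require Import structures.
From mathcomp Require Import all_boot all_order all_algebra.
From mathcomp Require Import all_classical all_reals all_analysis.
From mathcomp Require Import measurable_realfun borel_hierarchy.
From mathcomp Require Import ring lra.

Set Implicit Arguments.
Unset Strict Implicit.
Unset Printing Implicit Defensive.

Import Order.TTheory GRing.Theory Num.Theory.
Import numFieldNormedType.Exports.

Local Open Scope classical_set_scope.
Local Open Scope ring_scope.

Section EuclideanNorm.
Context (R : realType) (d : nat).
Implicit Types x y : 'rV[R]_d.

(* The library norm on 'rV[R]_d is the sup norm. *)
Definition enorm x : R := Num.sqrt (\sum_(i < d) x 0 i ^+ 2).

Lemma sumsq_ge0 x : 0 <= \sum_(i < d) x 0 i ^+ 2.
Proof. by apply: sumr_ge0 => i _; exact: sqr_ge0. Qed.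

Lemma enorm_ge0 x : 0 <= enorm x.
Proof. exact: sqrtr_ge0. Qed.

Lemma enorm_sqr x : enorm x ^+ 2 = \sum_(i < d) x 0 i ^+ 2.
Proof. by rewrite sqr_sqrtr// sumsq_ge0. Qed.

Lemma enorm0 : enorm 0 = 0.
Proof.
by rewrite /enorm big1 ?sqrtr0// => i _; rewrite mxE expr0n.
Qed.

Lemma enorm0_eq0 x : enorm x = 0 -> x = 0.
Proof.
move=> /(congr1 (fun r => r ^+ 2)); rewrite enorm_sqr expr0n/=.
move=> /eqP; rewrite psumr_eq0 => [/allP h|i _]; last exact: sqr_ge0.
apply/rowP => i; rewrite mxE; apply/eqP.
by have := h i (mem_index_enum i); rewrite /= sqrf_eq0.
Qed.

Lemma enormN x : enorm (- x) = enorm x.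
Proof. by congr Num.sqrt; apply: eq_bigr => i _; rewrite mxE sqrrN. Qed.

Lemma enormB x y : enorm (x - y) = enorm (y - x).
Proof. by rewrite -enormN opprB. Qed.

Lemma enormD x y : enorm (x + y) <= enorm x + enorm y.
Proof.
pose s := \sum_(i < d) x 0 i * y 0 i.
pose X := \sum_(i < d) x 0 i ^+ 2; pose Y := \sum_(i < d) y 0 i ^+ 2.
have CS : s ^+ 2 <= X * Y.
  have : 0 <= \sum_(i < d) \sum_(j < d) (x 0 i * y 0 j - x 0 j * y 0 i) ^+ 2.
    by apply: sumr_ge0 => i _; apply: sumr_ge0 => j _; exact: sqr_ge0.
  have -> : \sum_(i < d) \sum_(j < d) (x 0 i * y 0 j - x 0 j * y 0 i) ^+ 2
      = X * Y + X * Y - s ^+ 2 *+ 2.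
    rewrite {2}(mulrC X Y) expr2 /X /Y /s !big_distrlr/= -sumrMnl -sumrN.
    rewrite -!big_split/=; apply: eq_bigr => i _.
    rewrite -sumrMnl -sumrN -!big_split/=; apply: eq_bigr => j _.
    ring.
  by move=> h; lra.
have s_le : s <= enorm x * enorm y.
  rewrite /enorm -sqrtrM ?sumsq_ge0// (le_trans (ler_norm _))//.
  by rewrite -sqrtr_sqr ler_sqrt// mulr_ge0// sumsq_ge0.
have xy0 : 0 <= enorm x + enorm y by rewrite addr_ge0// enorm_ge0.
rewrite -(ler_pXn2r (_ : (0 < 2)%N))// ?nnegrE ?enorm_ge0//.
rewrite sqrrD !enorm_sqr.
have -> : \sum_(i < d) (x + y) 0 i ^+ 2 = X + s *+ 2 + Y.
  rewrite /X /s /Y -sumrMnl -!big_split/=; apply: eq_bigr => i _.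
  by rewrite mxE sqrrD.
by rewrite lerD2r lerD2l lerMn2r s_le orbT.
Qed.

End EuclideanNorm.

HB.instance Definition _ (X Y : ptopologicalType) := Pointed.on (X * Y)%type.

Definition borel (X : topologicalType) : Type :=
  g_sigma_algebraType (@open X).
HB.instance Definition _ (X : ptopologicalType) := Measurable.on (borel X).

Section NarrowTopology.
Context (R : realType) (X : ptopologicalType).

(* The topology of Prob is the coarsest one for which all the maps
   mu |-> \int f dmu, f bounded continuous, are continuous. *)
Definition Cb := {f : X -> R | continuous f /\ bounded_fun f}.

Definition integrate_Cb (mu : probability (borel X) R) : {ptws Cb -> R} :=
  fun f => \int[mu]_x sval f x.

Definition Prob : Type := initial_topology integrate_Cb.
HB.instance Definition _ := PointedTopological.on Prob.

(* Equality on Borel sets: a [probability] also has (meaningless) values on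
   non-measurable sets, on which Leibniz equality would depend. *)
Definition prob_eq (mu nu : Prob) : Prop :=
  forall A : set (borel X), measurable A -> mu A = nu A.

End NarrowTopology.
Arguments Prob R X : clear implicits.

Section L2.
Context (R : realType) (a b : R) (d : nat).

Definition leb_on : {measure set (measurableTypeR R) -> \bar R} :=
  mrestr (@lebesgue_measure R) (measurable_itv `]a, b[).

Definition L2_norm (f : R -> 'rV[R]_d) : \bar R :=
  Lnorm leb_on 2%:E (fun t => (enorm (f t))%:E).

(* Classes of functions defined on all of R, modulo equality a.e. on ]a, b[. *)
Definition L2 : Type := set_type
  [set f : {mfun_ leb_on, measurableTypeR R >-> borel 'rV[R]_d} |
    (L2_norm f < +oo)%E].
HB.instance Definition _ := Choice.on L2.

Definition L2_fun (f : L2) : R -> 'rV[R]_d := set_val f.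

Definition L2_dist (f g : L2) : R :=
  fine (L2_norm (fun t => L2_fun f t - L2_fun g t)).

Lemma leb_on_negligible (N : set R) :
  leb_on.-negligible N <-> lebesgue_measure.-negligible (N `&` `]a, b[).
Proof.
split=> -[A [mA A0 NA]].
  exists (A `&` `]a, b[); split.
  - exact: measurableI.
  - exact: A0.
  - exact: setSI.
exists (A `|` ~` `]a, b[%classic); split.
- by apply: measurableU => //; exact: measurableC.
- rewrite /leb_on /= /mrestr setIUl setICl setU0.
  by apply: subset_measure0 A0 => //; exact: measurableI.
- move=> x Nx; have [xab|xab] := pselect (`]a, b[%classic x); last by right.
  by left; apply: NA.
Qed.

Lemma measurable_coord (i : 'I_d) :
  measurable_fun setT (fun x : borel 'rV[R]_d => x 0 i : R).
Proof.
apply: (@measurability _ _ (borel 'rV[R]_d) R setT _ _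
  (RGenOpens.measurableE R)).
move=> _ [_ [x [y ->]] <-]; rewrite setTI.
apply: sub_sigma_algebra.
have /continuousP := @coord_continuous R 1 d 0 i.
by apply; exact: interval_open.
Qed.

Lemma measurable_enorm (f : measurableTypeR R -> 'rV[R]_d) :
  (forall i, measurable_fun setT (fun t => f t 0 i)) ->
  measurable_fun setT (fun t => enorm (f t)).
Proof.
move=> mf; have ms : measurable_fun [set: R] (@Num.sqrt R).
  by apply: continuous_measurable_fun; exact: sqrt_continuous.
apply: (measurableT_comp ms); apply: measurable_sum => i.
exact: measurable_funX.
Qed.

Lemma measurable_L2_coord (f : L2) i :
  measurable_fun setT (fun t : measurableTypeR R => L2_fun f t 0 i).
Proof.
by apply: (measurableT_comp (measurable_coord i)); exact: measurable_funPT.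
Qed.

Lemma measurable_L2_dist (f g : L2) : measurable_fun setT
  (fun t : measurableTypeR R => enorm (L2_fun f t - L2_fun g t)).
Proof.
apply: measurable_enorm => i.
rewrite (_ : (fun t => _) = (fun t => L2_fun f t 0 i - L2_fun g t 0 i)).
  by apply: measurable_funB; exact: measurable_L2_coord.
by apply/funext => t; rewrite !mxE.
Qed.

Lemma L2_norm_ge0 (f : R -> 'rV[R]_d) : (0 <= L2_norm f)%E.
Proof. exact: Lnorm_ge0. Qed.

Lemma L2_normD (u v w : R -> 'rV[R]_d) :
  (forall t, enorm (u t) <= enorm (v t) + enorm (w t)) ->
  measurable_fun setT (fun t : measurableTypeR R => enorm (u t)) ->
  measurable_fun setT (fun t : measurableTypeR R => enorm (v t)) ->
  measurable_fun setT (fun t : measurableTypeR R => enorm (w t)) ->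
  (L2_norm u <= L2_norm v + L2_norm w)%E.
Proof.
move=> uvw mu mv mw.
apply: (le_trans _ (@minkowski_EFin _ _ _ leb_on _ _ 2 mv mw _)); last first.
  by rewrite ler1n.
rewrite /L2_norm unlock.
have abs2 (h : measurableTypeR R -> R) x :
    (`|(h x)%:E| `^ 2 = (`|h x| `^ 2)%:E)%E.
  by rewrite abse_EFin poweR_EFin.
under eq_integral do rewrite abs2.
under [in leRHS]eq_integral
  do rewrite (abs2 (fun x => enorm (v x) + enorm (w x))%R).
have mabs (h : measurableTypeR R -> R) : measurable_fun setT h ->
    measurable_fun setT (fun x => (`|h x| `^ 2)%:E).
  move=> mh; apply/measurable_EFinP.
  apply: (@measurableT_comp _ _ _ _ _ _ (@powR R ^~ 2)) => //.
  exact: measurableT_comp.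
have int_ge0 (h : measurableTypeR R -> R) :
    (0 <= \int[mrestr lebesgue_measure (measurable_itv `]a, b[)]_x
      (`|h x| `^ 2)%:E)%E.
  by apply: integral_ge0 => x _; rewrite lee_fin powR_ge0.
apply: gt0_ler_poweR; rewrite ?in_itv/= ?andbT ?leey ?int_ge0//.
apply: ge0_le_integral => //.
- exact: mabs.
- by apply: mabs; exact: measurable_funD.
move=> x _; rewrite -/(enorm (u x)) lee_fin.
apply: ge0_ler_powR; rewrite ?nnegrE ?normr_ge0 ?ler0n//.
by rewrite !ger0_norm ?addr_ge0 ?enorm_ge0.
Qed.

Lemma L2_dist_fin (f g : L2) :
  L2_norm (fun t => L2_fun f t - L2_fun g t) \is a fin_num.
Proof.
rewrite ge0_fin_numE ?L2_norm_ge0//.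
apply: (le_lt_trans (@L2_normD _ (L2_fun f) (L2_fun g) _ _ _ _)).
- by move=> t; rewrite -(enormN (L2_fun g t)) enormD.
- exact: measurable_L2_dist.
- by apply: measurable_enorm => i; exact: measurable_L2_coord.
- by apply: measurable_enorm => i; exact: measurable_L2_coord.
by apply: lte_add_pinfty; [exact: set_valP f|exact: set_valP g].
Qed.

Lemma L2_distxx f : L2_dist f f = 0.
Proof.
rewrite /L2_dist /L2_norm (_ : (fun t => _) = cst 0%E); last first.
  by apply/funext => t; rewrite subrr enorm0.
by rewrite Lnorm0// gt_eqF// lte_fin.
Qed.

Lemma L2_eq (f g : L2) :
  {ae leb_on, forall t : measurableTypeR R, L2_fun f t = L2_fun g t} -> f = g.
Proof.
move=> fg; apply: val_inj => /=.
rewrite -[LHS]reprK -[RHS]reprK; apply/eqP; rewrite eqmodE.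
by apply/asboolP; apply: filterS fg => t /= ft _.
Qed.

Lemma L2_dist_eq0 f g : L2_dist f g = 0 -> f = g.
Proof.
move=> /eqP; rewrite fine_eq0 ?L2_dist_fin// => /eqP.
move=> N0; have /measurable_EFinP mfg := measurable_L2_dist f g.
have h := @Lnorm_eq0_eq0 _ _ _ leb_on _ 2%:E mfg _ N0.
have : (0 < 2%:E :> \bar R)%E by rewrite lte_fin.
move=> /h fg; apply: L2_eq; apply: filterS fg => t /= /(_ I) [].
by move=> /enorm0_eq0/eqP; rewrite subr_eq0 => /eqP.
Qed.

Lemma L2_dist_sym f g : L2_dist f g = L2_dist g f.
Proof.
congr (fine (Lnorm _ _ _)); apply/funext => t; by rewrite enormB.
Qed.

Lemma L2_dist_triangle g f h : L2_dist f h <= L2_dist f g + L2_dist g h.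
Proof.
rewrite -lee_fin EFinD !fineK ?L2_dist_fin//.
apply: L2_normD; try exact: measurable_L2_dist.
by move=> t; rewrite (le_trans _ (enormD _ _))// addrA subrK.
Qed.

HB.instance Definition _ := isMetric.Build R L2
  L2_distxx L2_dist_eq0 L2_dist_sym L2_dist_triangle.

End L2.

Section L2_class.
Context (R : realType) (a b : R) (d : nat).

Lemma L2_normE (f : R -> 'rV[R]_d) : L2_norm a b f =
  ((\int[leb_on a b]_t (enorm (f t) ^+ 2)%:E) `^ 2^-1)%E.
Proof.
rewrite /L2_norm unlock; congr (_ `^ _)%E; apply: eq_integral => t _.
rewrite abse_EFin poweR_EFin powR_mulrn//.
by rewrite ger0_norm ?enorm_ge0.
Qed.

Lemma eq_ae_L2_norm (f g : {mfun measurableTypeR R >-> borel 'rV[R]_d}) :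
  f = g %[ae leb_on a b] -> L2_norm a b f = L2_norm a b g.
Proof.
have mn (h : {mfun measurableTypeR R >-> borel 'rV[R]_d}) :
    measurable_fun setT (fun t => ((enorm (h t)) ^+ 2)%:E).
  apply/measurable_EFinP; apply: measurable_funX; apply: measurable_enorm => i.
  by apply: (measurableT_comp (measurable_coord i)); exact: measurable_funPT.
move=> fg; rewrite !L2_normE; congr (_ `^ _)%E.
apply: ae_eq_integral => //.
apply: filterS fg => t /= /[apply] ft.
by rewrite ft.
Qed.

Local Notation class := (\pi_(@aeEqMfun _ _ R (measurableTypeR R)
  (borel 'rV[R]_d) (leb_on a b)))%qT.

Lemma repr_class (f : {mfun measurableTypeR R >-> borel 'rV[R]_d}) :
  repr (class f) = f %[ae leb_on a b].
Proof.
have : ae_eq_op (leb_on a b) (repr (class f)) f by rewrite -eqmodE reprK.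
by move/asboolP.
Qed.

Definition L2_class (f : {mfun measurableTypeR R >-> borel 'rV[R]_d})
    (f2 : (L2_norm a b f < +oo)%E) : L2 a b d.
Proof.
exists (class f); apply: mem_set => /=.
by rewrite (eq_ae_L2_norm (repr_class f)).
Defined.

Lemma L2_classE (f : {mfun measurableTypeR R >-> borel 'rV[R]_d})
    (f2 : (L2_norm a b f < +oo)%E) :
  {ae leb_on a b, forall t : measurableTypeR R, L2_fun (L2_class f2) t = f t}.
Proof. by apply: filterS (repr_class f) => t /= /(_ I). Qed.

Lemma L2_norm0 : (L2_norm a b (@cst R 'rV[R]_d 0%R) < +oo)%E.
Proof.
rewrite L2_normE (_ : (\int[_]__ _)%E = 0%E) ?poweR0r ?invr_eq0//.
by apply: integral0_eq => t _; rewrite enorm0 expr0n.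
Qed.

Definition L2_0 : L2 a b d :=
  L2_class (L2_norm0 :
    (L2_norm a b (@cst (measurableTypeR R) (borel 'rV[R]_d) 0%R) < +oo)%E).
HB.instance Definition _ := isPointed.Build (L2 a b d) L2_0.

End L2_class.

Section Restriction.
Context (R : realType) (a b a' b' : R) (d : nat).

(* The truncation to ]a, b[ matters only if ]a', b'[ is not contained in
   ]a, b[. *)
Definition cut (f : L2 a b d) (t : measurableTypeR R) : borel 'rV[R]_d :=
  if t \in `]a, b[%classic `&` `]a', b'[%classic then L2_fun f t else 0.

Lemma measurable_cut f : measurable_fun setT (cut f).
Proof.
apply: measurable_fun_ifT => //.
by apply: (measurable_fun_bool true); rewrite setTI preimage_mem_true;
  exact: measurableI.
Qed.

HB.instance Definition _ f := isMeasurableFun.Build _ _ _ _ (cut f)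
  (measurable_cut f).

Lemma L2_norm_cut f : (L2_norm a' b' (cut f) < +oo)%E.
Proof.
rewrite L2_normE poweR_lty//.
set D := `]a, b[%classic `&` `]a', b'[%classic.
pose F t := (enorm (L2_fun f t) ^+ 2)%:E.
have mF : measurable_fun setT (F : measurableTypeR R -> \bar R).
  apply/measurable_EFinP; apply: measurable_funX; apply: measurable_enorm => i.
  exact: measurable_L2_coord.
have -> : (\int[leb_on a' b']_t (enorm (cut f t) ^+ 2)%:E =
           \int[leb_on a' b']_(t in D) F t)%E.
  rewrite [RHS]integral_mkcond; apply: eq_integral => t _.
  rewrite /patch /cut; case: ifPn => // _.
  by rewrite enorm0 expr0n.
have -> : (\int[leb_on a' b']_(t in D) F t = \int[leb_on a b]_(t in D) F t)%E.
  apply: eq_measure_integral => A mA AD; rewrite /leb_on/= /mrestr.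
  by congr lebesgue_measure; rewrite !setIidl// => x /AD [].
apply: (@le_lt_trans _ _ (\int[leb_on a b]_t F t)%E).
  apply: ge0_subset_integral => //; first exact: measurableI.
  by move=> x _; rewrite lee_fin sqr_ge0.
have := set_valP f; rewrite /= L2_normE => /lty_poweRy; apply.
by rewrite invr_eq0.
Qed.

Definition restr (f : L2 a b d) : L2 a' b' d := L2_class (L2_norm_cut f).

Lemma restrE f : a <= a' -> b' <= b ->
  {ae leb_on a' b', forall t : measurableTypeR R,
    L2_fun (restr f) t = L2_fun f t}.
Proof.
move=> aa bb.
have ae_itv : {ae leb_on a' b', forall t : measurableTypeR R, t \in `]a', b'[}.
  apply/leb_on_negligible; rewrite (_ : _ `&` _ = set0).
    exact: negligible_set0.
  by apply/seteqP; split=> // t [] /=.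
have := L2_classE (L2_norm_cut f).
apply: filterS2 ae_itv => t /= tab ->; rewrite /cut ifT// inE; split=> //.
by move: tab; apply: subset_itv; rewrite bnd_simp.
Qed.

End Restriction.

Section Sobolev.
Context (R : realType) (a b : R) (d : nat).

Definition test_function (phi : R -> R) : Prop :=
  (forall n x, derivable (derive1n n phi) x 1) /\
  exists K : set R, [/\ compact K, K `<=` `]a, b[ &
    forall x, ~ K x -> phi x = 0].

Definition weak_derivative (f g : L2 a b d) : Prop :=
  forall phi, test_function phi -> forall i,
    \int[leb_on a b]_t (L2_fun f t 0 i * derive1 phi t) =
    - \int[leb_on a b]_t (L2_fun g t 0 i * phi t).

Definition W12 (f : L2 a b d) : Prop := exists g, weak_derivative f g.

Definition wderiv (f : L2 a b d) : L2 a b d := get (weak_derivative f).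

Definition energy (f : L2 a b d) : \bar R :=
  if `[< W12 f >] then (L2_norm a b (L2_fun (wderiv f)) ^+ 2)%E else +oo%E.

(* The continuous representative, meaningful on [a, b] only; 0 off W^{1,2}. *)
Definition crep (f : L2 a b d) : R -> 'rV[R]_d :=
  xget (cst 0) [set c | [/\ W12 f, {within `[a, b], continuous c} &
    {ae leb_on a b, forall t : measurableTypeR R, c t = L2_fun f t}]].

End Sobolev.

Section Curves.
Context (R : realType) (d : nat) (T : R).

(* leb_on (-1) T does not charge the complement of ]-1, T[, so that t < 0 means
   t \in ]-1, 0[. *)
Definition Gamma : Type := set_type [set f : L2 (-1) T d |
  exists x v : 'rV[R]_d,
    {ae leb_on (-1) T, forall t : measurableTypeR R,
      t < 0 -> L2_fun f t = x + t *: v}].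
HB.instance Definition _ := Topological.on Gamma.

Definition Gamma_0 : Gamma.
Proof.
exists (L2_0 (-1) T d); apply: mem_set; exists 0, 0.
apply: filterS (L2_classE (L2_norm0 (-1) T d)) => t /= -> _.
by rewrite scaler0 addr0.
Defined.
HB.instance Definition _ := isPointed.Build Gamma Gamma_0.

Definition position (gamma : Gamma) : R -> 'rV[R]_d := crep (set_val gamma).

Definition e0 (gamma : Gamma) : 'rV[R]_d := position gamma 0.

Definition W0 (gamma : Gamma) : 'rV[R]_d :=
  position gamma 0 - position gamma (-1).

Definition Trestr (t : R) (gamma : Gamma) : L2 t T d :=
  restr t T (set_val gamma).

End Curves.

Section Euler.
Context (R : realType) (d : nat) (T : R).
Local Notation Gamma := (Gamma d T).
Local Notation PGamma := (Prob R Gamma).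
Local Notation phase := ('rV[R]_d * 'rV[R]_d)%type.

Definition moment2 (X : ptopologicalType) (mu : Prob R X)
    (f : borel X -> 'rV[R]_d) : \bar R :=
  (\int[mu]_x (enorm (f x) ^+ 2)%:E)%E.

Definition P21 : set (Prob R phase) :=
  [set nu | (moment2 nu fst <= 1)%E /\ (moment2 nu snd <= 1)%E].

Definition MGamma : set PGamma :=
  [set eta | (moment2 eta (@e0 R d T) <= 1)%E /\
             (\int[eta]_gamma energy (set_val gamma) <= (T + 1)%:E)%E].

Definition kernel_at (t : R) :=
  R.-pker (borel (L2 t T d)) ~> (borel Gamma).

Definition disintegration (eta : PGamma) (t : R) (omega : kernel_at t) : Prop :=
  let law := pushforward eta (Trestr t : borel Gamma -> borel (L2 t T d)) in
  (forall A, measurable A -> eta A = (\int[law]_g omega g A)%E) /\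
  {ae law, forall g, omega g (~` (Trestr t @^-1` [set g])) = 0}.

Definition velocity (t : R) (omega : kernel_at t) (gamma : Gamma) : 'rV[R]_d :=
  \row_i \int[omega (Trestr t gamma)]_gamma' (W0 gamma' 0 i).

(* The disintegrations are determined for each t only up to a null set of
   curves, hence the existential choice of a family of versions. *)
Definition dissipative (eta : PGamma) : Prop :=
  MGamma eta /\
  exists omega : forall t, kernel_at t,
    (forall t, t \in `[0, T[ -> disintegration eta (omega t)) /\
    {ae (@lebesgue_measure R \x eta)%E,
      forall z : measurableTypeR R * borel Gamma, (z.1 : R) \in `[0, T[ ->
      is_derive (z.1 : R) 1 (position z.2) (velocity (omega z.1) z.2)}.

Definition initial_data (eta : PGamma) (nu0 : Prob R phase) : Prop :=
  forall A : set (borel phase), measurable A ->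
    pushforward eta
      (fun gamma : borel Gamma => (e0 gamma, W0 gamma) : borel phase) A = nu0 A.

Definition straight_line (gamma : Gamma) : Prop :=
  exists x v : 'rV[R]_d,
    {ae leb_on (-1) T, forall t : measurableTypeR R,
      L2_fun (set_val gamma) t = x + t *: v}.

Definition free_flow (eta : PGamma) : Prop :=
  exists S : set Gamma, [/\ {ae eta, forall gamma : borel Gamma, S gamma},
    (forall gamma, S gamma -> straight_line gamma) &
    forall gamma1 gamma2, S gamma1 -> S gamma2 -> gamma1 <> gamma2 ->
      forall t, t \in `[0, T] -> position gamma1 t <> position gamma2 t].

End Euler.

(* Main.v *)
(* For data carried by finitely many phase points whose lines never meet, the
   future of a curve determines its line, so a dissipative solution must follow
   free lines. Quantitatively, E[pos(t) - x - t v | pos(t)] = 0 for every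
   dissipative solution, so the L^1 distance of pos(t) to the free motion is at
   most twice the error made when guessing the free position from pos(t); short
   time steps then propagate smallness from s to t, uniformly over all data close
   to the given finite ones. Hence "the drift is at most 1/n and the lines are
   disjoint up to mass 2^-n" holds on a weakly open set U_n containing all such
   finite data. These data are dense (discretize, then shift the points by distinct
   multiples of two different basis vectors), and for data in the intersection of
   the U_n the drift vanishes, so the only solution is the image of the data under
   (x, v) |-> (t |-> x + t v), which is always dissipative. *)
From HB Require Import structures.
From mathcomp Require Import all_boot all_order all_algebra.
From mathcomp Require Import all_classical all_reals all_analysis.
From mathcomp Require Import measurable_realfun borel_hierarchy.
From mathcomp Require Import ring lra.
Require Import Defs.

Set Implicit Arguments.
Unset Strict Implicit.
Unset Printing Implicit Defensive.

Import Order.TTheory GRing.Theory Num.Theory.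
Import numFieldNormedType.Exports.

Local Open Scope classical_set_scope.
Local Open Scope ring_scope.


(** Why E[pos(t) - x - t v | pos(t)] = 0: for s < t the position at time t is a function of the
    curve restricted to ]s, T[, so under a bounded test function of pos(t) the velocity at time s,
    being E[v | future of s], may be exchanged for v; integrating over s in ]0, t[ gives the claim.
    The factor two comes from testing with the sign of pos(t) minus the guess, which trades pos(t)
    for the free position. No compactness of the set of solutions is used: all constants depend only
    on the finite configuration, so one radius serves all nearby data. Short time steps need a
    modulus of continuity valid up to small mass; it comes from Jensen's inequality, since the mean
    excess of the speed above a level M is at most that of the initial velocity. The technical
    obstacle is that a curve is an L^2 class, with position and disintegration given by choice:
    positions and velocities are rewritten as upper limits of averages and of difference quotients,
    which are measurable and see only the future. The condition d >= 2 enters in the shifts, where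
    the meeting time is eliminated between two coordinates. *)

Section smooth.

(** * Smooth bump functions *)

Context {R : realType}.
Implicit Types (f g : R -> R) (p : {poly R}).

(** The recursion passes to [derive1 f] instead of counting iterates, so that induction on n with f
    general yields closure under sums, products and affine substitutions. [smoothnP] converts to the
    iterated derivatives required by [test_function]. *)
Fixpoint smoothn n f : Prop :=
  (forall x, derivable f x 1) /\
  if n is m.+1 then smoothn m (derive1 f) else True.

Lemma smoothnW n f : smoothn n.+1 f -> smoothn n f.
Proof.
elim: n f => [|n IH] f [df h]; first by split.
by split; [exact: df|exact: IH].
Qed.

Lemma smoothnP f : (forall n, smoothn n f) ->
  forall n x, derivable (derive1n n f) x 1.
Proof.
move=> sf n; move: (sf n) => {sf}; elim: n f => [|n IH] f [df]; first by move=> _.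
by move=> /IH; rewrite /derive1n -iterSr.
Qed.

Lemma smoothnD n f g : smoothn n f -> smoothn n g -> smoothn n (f + g).
Proof.
have D (u v : R -> R) : (forall x, derivable u x 1) ->
    (forall x, derivable v x 1) -> forall x, derivable (u + v) x 1.
  by move=> du dv x; apply: derivableD; [exact: du|exact: dv].
elim: n f g => [|n IH] f g [df Df] [dg Dg]; split; try exact: D.
  by [].
rewrite (_ : derive1 _ = derive1 f + derive1 g); first exact: IH.
by apply/funext => x; rewrite derive1E (deriveD (df x) (dg x)) -!derive1E.
Qed.

Lemma smoothnM n f g : smoothn n f -> smoothn n g -> smoothn n (f * g).
Proof.
have D (u v : R -> R) : (forall x, derivable u x 1) ->
    (forall x, derivable v x 1) -> forall x, derivable (u * v) x 1.
  by move=> du dv x; apply: derivableM; [exact: du|exact: dv].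
elim: n f g => [|n IH] f g [df sf] [dg sg]; split; try exact: D.
  by [].
rewrite (_ : derive1 _ = (derive1 f * g) + (f * derive1 g)).
  apply: smoothnD; apply: IH.
  - exact: sf.
  - exact: (@smoothnW n g (conj dg sg)).
  - exact: (@smoothnW n f (conj df sf)).
  - exact: sg.
apply/funext => x; rewrite derive1E (deriveM (df x) (dg x)) -!derive1E.
by rewrite addrC /GRing.scale/= (mulrC (g x)).
Qed.

Lemma smoothnZ n f c : smoothn n f -> smoothn n (c *: f).
Proof.
have D (u : R -> R) : (forall x, derivable u x 1) ->
    forall x, derivable (c *: u) x 1.
  by move=> du x; apply: derivableZ; exact: du.
elim: n f => [|n IH] f [df Df]; split; try exact: D.
  by [].
rewrite (_ : derive1 _ = c *: derive1 f); first exact: IH.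
by apply/funext => x; rewrite derive1E (deriveZ _ (df x)) -derive1E.
Qed.

Lemma smoothn_affine n f c d :
  smoothn n f -> smoothn n (fun x => f (c * x + d)).
Proof.
have aff (x : R) : is_derive x 1 (fun x : R => c * x + d) c.
  rewrite (_ : (fun _ => _) = (c *: @id R) + cst d); last exact/funext.
  by apply: is_derive_eq; rewrite /GRing.scale/= mulr1 addr0.
have D g x : (forall x, derivable g x 1) ->
    is_derive (x : R) 1 (fun x : R => g (c * x + d)) (c * derive1 g (c * x + d)).
  move=> dg; rewrite mulrC derive1E.
  exact: (@is_derive1_comp R g (fun x => c * x + d) x _ _ (derivableP (dg _)) (aff x)).
elim: n f => [|n IH] f [df Df].
  by split; [move=> x; have [] := D f x df|].
split; first by move=> x; have [] := D f x df.
rewrite (_ : derive1 _ = c *: (fun x => (derive1 f) (c * x + d))).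
  by apply: smoothnZ; exact: IH.
by apply/funext => x; rewrite derive1E; have [_] := D f x df.
Qed.

(** The classical function exp(-1/x), flat at 0, times a polynomial in 1/x: with this factor the
    family is stable under differentiation, and smoothness to all orders is one induction over all
    p. *)
Definition flat p x : R := if 0 < x then p.[x^-1] * expR (- x^-1) else 0.

(** With u = y / (n+1), exp(-y) splits into n+1 factors exp(-u), and u exp(-u) <= 1 follows from 1 +
    u <= exp(u). This bounds y^n exp(-y) by (n+1)^n, monomial by monomial. *)
Lemma poly_expRN_bound p : exists C, forall y : R, 0 <= y ->
  `|p.[y]| * expR (- y) <= C.
Proof.
have xn n (y : R) : 0 <= y -> y ^+ n * expR (- y) <= n.+1%:R ^+ n.
  move=> y0.
  have -> : expR (- y) = expR (- (y / n.+1%:R)) ^+ n * expR (- (y / n.+1%:R)).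
    rewrite -exprSr -expRM_natl; congr expR.
    by rewrite mulrN mulrCA divff ?mulr1.
  have k0 : 0 < n.+1%:R :> R by [].
  have h : (y / n.+1%:R) * expR (- (y / n.+1%:R)) <= 1.
    have := expR_ge1Dx (y / n.+1%:R); rewrite expRN ler_pdivrMr ?expR_gt0// mul1r.
    by apply: le_trans; rewrite lerDr.
  rewrite mulrA -exprMn.
  have -> : y * expR (- (y / n.+1%:R)) =
      n.+1%:R * ((y / n.+1%:R) * expR (- (y / n.+1%:R))).
    by rewrite mulrA mulrCA divff ?mulr1.
  have e1 : expR (- (y / n.+1%:R)) <= 1 by rewrite expR_le1 oppr_le0 divr_ge0.
  have u0 : 0 <= y / n.+1%:R * expR (- (y / n.+1%:R)).
    by rewrite mulr_ge0 ?divr_ge0 ?expR_ge0.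
  rewrite exprMn; set u := (_ / _ * _) in h u0 *.
  rewrite -mulrA ler_piMr ?exprn_ge0//.
  by rewrite -[leRHS]mulr1 ler_pM ?exprn_ge0 ?expR_ge0// exprn_ile1.
exists (\sum_(i < size p) `|p`_i| * i.+1%:R ^+ i) => y y0.
rewrite horner_coef (le_trans (ler_wpM2r (expR_ge0 _) (ler_norm_sum _ _ _)))//.
rewrite mulr_suml ler_sum// => i _; rewrite normrM -mulrA ler_wpM2l//.
by rewrite normrX (ger0_norm y0) xn.
Qed.

(** Applying the previous bound to X^2 p gains the factor x^2, which is what kills the difference
    quotient at 0. *)
Lemma flat_bound p : exists C, forall x : R, `|flat p x| <= C * x ^+ 2.
Proof.
have [C hC] := poly_expRN_bound ('X^2 * p); exists C => x.
have C0 : 0 <= C.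
  by have := hC 0 (lexx _); apply: le_trans; rewrite mulr_ge0 ?expR_ge0.
rewrite /flat; case: ifPn => [x0|_]; last by rewrite normr0 mulr_ge0// sqr_ge0.
have xi : 0 <= x^-1 by rewrite invr_ge0 ltW.
have := hC _ xi; rewrite hornerM hornerXn normrM (ger0_norm (_ : 0 <= x^-1 ^+ 2)) ?exprn_ge0//.
rewrite normrM (ger0_norm (expR_ge0 _)) -mulrA exprVn ler_pdivrMl ?exprn_gt0//.
by rewrite [leRHS]mulrC.
Qed.

Lemma is_derive_flat p (x : R) :
  is_derive x 1 (flat p) (flat ('X^2 * (p - p^`()%R)) x).
Proof.
have [x0|x0|->] := ltgtP x 0.
- rewrite [X in is_derive _ _ _ X]/flat ltNge (ltW x0)/=.
  apply: (@near_eq_is_derive _ _ _ (cst 0)).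
  near=> y; rewrite /flat ifN// -leNgt.
  by apply: ltW; near: y; exact: lt_nbhsl.
- rewrite [X in is_derive _ _ _ X]/flat x0.
  have x_neq0 : x != 0 by rewrite gt_eqF.
  have h1 : is_derive x 1 (fun y : R => y^-1) (- x^-2).
    have := @is_deriveV R id x 1 1 x_neq0 (is_derive_id _ _).
    by rewrite /GRing.scale/= mulr1.
  have h2 := @is_derive1_comp R (horner p) (fun y => y^-1) x _ _ (is_derive_poly p _) h1.
  have h3 := @is_derive1_comp R expR (fun y => - y^-1) x _ _ (is_derive_expR _) (is_deriveN h1).
  have h4 := is_deriveM h2 h3.
  apply: (near_eq_is_derive _ (is_derive_eq h4 _)).
    near=> y; rewrite /flat ifT//; near: y; exact: lt_nbhsr.
  rewrite /= /GRing.scale/= hornerM hornerXn hornerD hornerN exprVn.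
  set e := expR _; set u := x ^- 2; set P := p.[_]; set P1 := _.[_]; ring.
rewrite [X in is_derive _ _ _ X]/flat ltxx.
have [C hC] := flat_bound p.
have C0 : 0 <= C by have := hC 1; rewrite expr1n mulr1; apply: le_trans.
have cv : h^-1 *: ((flat p \o shift (0 : R)) (h *: (1 : R)) - flat p 0) @[h --> (0:R)^'] --> (0:R).
  apply/cvgrPdist_le => e e0.
  near=> h; rewrite /= sub0r normrN addr0 [h *: 1]mulr1 {2}/flat ltxx subr0.
  rewrite normrM normfV.
  have h0 : h != 0 by near: h; exact: nbhs_dnbhs_neq.
  rewrite mulrC ler_pdivrMr ?normr_gt0// (le_trans (hC _))//.
  rewrite -real_normK ?num_real// expr2 mulrA ler_wpM2r//.
  have : `|h| < e / (C + 1).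
    near: h; apply: dnbhs0_lt; rewrite divr_gt0// ltr_wpDl//.
  rewrite ltr_pdivlMr ?ltr_wpDl// => /ltW; apply: le_trans.
  by rewrite mulrDr mulrC mulr1 lerDl.
split; first by apply/cvg_ex; exists 0.
by apply/cvg_lim.
Unshelve. all: by end_near. Qed.

Lemma smooth_flat n p : smoothn n (flat p).
Proof.
have D q : (forall x, derivable (flat q) x 1).
  by move=> x; have [] := is_derive_flat q x.
elim: n p => [|n IH] p; split => //=.
rewrite (_ : derive1 _ = flat ('X^2 * (p - p^`()%R)))//.
by apply/funext => x; rewrite derive1E; have [_] := is_derive_flat p x.
Qed.

Definition bump x : R := flat 1 (1 + x) * flat 1 (1 - x).

Lemma smooth_bump n : smoothn n bump.
Proof.
apply: (@smoothnM n (fun x => flat 1 (1 + x)) (fun x => flat 1 (1 - x))).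
  have := @smoothn_affine n _ 1 1 (smooth_flat n 1).
  by under eq_fun do rewrite mul1r addrC.
have := @smoothn_affine n _ (-1) 1 (smooth_flat n 1).
by under eq_fun do rewrite mulN1r addrC.
Qed.

Lemma flat1_ge0 x : 0 <= flat 1 x.
Proof. by rewrite /flat; case: ifPn => // _; rewrite hornerC mul1r expR_ge0. Qed.

Lemma flat1_le1 x : flat 1 x <= 1.
Proof.
rewrite /flat; case: ifPn => // x0.
by rewrite hornerC mul1r expR_le1 oppr_le0 invr_ge0 ltW.
Qed.

Lemma bump_ge0 x : 0 <= bump x.
Proof. by rewrite mulr_ge0 ?flat1_ge0. Qed.

Lemma bump_le1 x : bump x <= 1.
Proof. by rewrite -[leRHS]mulr1 ler_pM ?flat1_ge0 ?flat1_le1. Qed.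

Lemma bump_out x : 1 <= `|x| -> bump x = 0.
Proof.
rewrite ler_normr => /orP[x1|x1]; rewrite /bump /flat.
  by rewrite [X in _ * X]ifN ?mulr0// -leNgt subr_le0.
by rewrite ifN ?mul0r// -leNgt -lerBrDl sub0r lerNr.
Qed.

Lemma bump0_gt0 : 0 < bump 0.
Proof. by rewrite /bump addr0 subr0 /flat ltr01 hornerC mul1r mulr_gt0// expR_gt0. Qed.

Lemma continuous_bump : continuous bump.
Proof.
move=> x; apply: differentiable_continuous; apply/derivable1_diffP.
exact: (smooth_bump 0).1.
Qed.

End smooth.


(** * Lebesgue measure restricted to an interval *)

Section leb_on_integral.
Context {R : realType} (a b : R).
Local Notation mu := (@lebesgue_measure R).

Lemma ge0_integral_leb_on (f : R -> \bar R) : measurable_fun setT f ->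
  (forall x, 0 <= f x)%E ->
  (\int[leb_on a b]_x f x = \int[mu]_(x in `]a, b[) f x)%E.
Proof.
move=> mf f0.
rewrite (@ge0_negligible_integral _ _ _ (leb_on a b) setT (~` `]a, b[%classic))//.
- rewrite setDE setTI setCK; apply: eq_measure_integral => A mA AD.
  by rewrite /leb_on/= /mrestr setIidl.
- by apply: measurableC.
- by rewrite /leb_on/= /mrestr setICl measure0.
Qed.

Lemma integral_leb_on (f : R -> \bar R) : measurable_fun setT f ->
  (\int[leb_on a b]_x f x = \int[mu]_(x in `]a, b[) f x)%E.
Proof.
move=> mf; rewrite [LHS]integralE [RHS]integralE !ge0_integral_leb_on//.
- exact: measurable_funeneg.
- exact: measurable_funepos.
Qed.

Lemma Rintegral_leb_on (f : R -> R) : measurable_fun setT f ->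
  \int[leb_on a b]_x f x = \int[mu]_(x in `]a, b[) f x.
Proof. by move=> mf; rewrite /Rintegral integral_leb_on//; exact/measurable_EFinP. Qed.

Lemma integrable_leb_on (f : R -> \bar R) : measurable_fun setT f ->
  (leb_on a b).-integrable setT f <-> mu.-integrable `]a, b[ f.
Proof.
move=> mf; split=> /integrableP[mf' foo]; apply/integrableP; split => //.
- exact: measurable_funTS.
- rewrite -ge0_integral_leb_on//; exact: measurableT_comp.
- rewrite ge0_integral_leb_on//; exact: measurableT_comp.
Qed.

Lemma leb_on_lty : (leb_on a b setT < +oo)%E.
Proof.
rewrite /leb_on/= /mrestr setTI lebesgue_measure_itv/=; case: ifPn => // _.
by rewrite -EFinB ltry.
Qed.

End leb_on_integral.

(** * The primitive of the bump *)

Section bump_integral.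
Context {R : realType}.
Local Notation mu := (@lebesgue_measure R).
Implicit Types (f : R -> R) (x : R).

Lemma leb_itv_lty (x y : R) : (mu (`[x, y]%classic : set R) < +oo)%E.
Proof.
by rewrite lebesgue_measure_itv/=; case: ifPn => //; rewrite -EFinB ltry.
Qed.

(** A smooth transition, 0 left of -1 and constant right of 1. It is not normalised: [step 1] is the
    mass of the bump and is carried along as a positive factor. *)
Definition step x : R := \int[mu]_(t in `]-oo, x]) bump t.

Lemma integrable_bump (A : set R) : measurable A ->
  mu.-integrable A (EFin \o @bump R).
Proof.
move=> mA; apply: (@integrableS _ _ _ mu setT) => //.
have -> : EFin \o @bump R = (EFin \o @bump R) \_ (`[-1, 1]%classic : set R).
  apply/funext => t; rewrite patchE; case: ifPn => // /negP t1 /=.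
  rewrite bump_out// leNgt; apply/negP => /ltW; rewrite ler_norml => t1'.
  by apply: t1; rewrite inE /= in_itv.
apply/(@integrable_mkcond _ _ _ mu `[-1, 1]%classic) => //.
apply: measurable_bounded_integrable => //.
- exact: leb_itv_lty.
- by apply: measurable_funTS; apply: continuous_measurable_fun; exact: continuous_bump.
exists 1; split => // M M1 t /= _.
by rewrite ger0_norm ?bump_ge0// (le_trans (bump_le1 _))// ltW.
Qed.

Lemma is_derive_step x : is_derive x 1 step (bump x).
Proof.
have [] := @continuous_FTC1 R bump -oo%O x (x + 1) _ _ _ _.
- by rewrite ltrDl.
- by apply: integrable_bump.
- by rewrite ltNyr.
- exact: continuous_bump.
by move=> d e; rewrite -e derive1E; exact: derivableP.
Qed.

Lemma step_le x : x <= -1 -> step x = 0.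
Proof.
move=> x1; rewrite /step (@eq_Rintegral _ _ _ mu _ (cst 0)) ?Rintegral_cst ?mul0r//.
move=> t; rewrite inE/= in_itv/= => tx; apply: bump_out.
by rewrite ler_normr; apply/orP; right; rewrite lerNr (le_trans tx).
Qed.

Lemma step_ge x : 1 <= x -> step x = step 1.
Proof.
move=> x1; rewrite /step Rintegral_mkcond [RHS]Rintegral_mkcond.
apply: eq_Rintegral => t _; rewrite !patchE !mem_setE !in_itv/=.
case: ifPn => tx; case: ifPn => t1 //.
  by rewrite bump_out// ler_normr ltW// ltNge.
by rewrite (le_trans t1 x1) in tx.
Qed.

Lemma step_ge0 x : 0 <= step x.
Proof. by apply: Rintegral_ge0 => t _; exact: bump_ge0. Qed.

Lemma step_homo : {homo step : x y / x <= y}.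
Proof.
move=> x y xy; rewrite /step; apply: fine_le.
- by apply: integrable_fin_num; [exact: measurable_itv|exact: integrable_bump].
- by apply: integrable_fin_num; [exact: measurable_itv|exact: integrable_bump].
apply: ge0_subset_integral => //.
- by apply/measurable_EFinP; apply: measurable_funTS; apply: continuous_measurable_fun; exact: continuous_bump.
- by move=> t _; rewrite lee_fin bump_ge0.
- by apply: subset_itvl; rewrite bnd_simp.
Qed.

Lemma step_le1 x : step x <= step 1.
Proof.
have [x1|/ltW x1] := leP x 1; first exact: step_homo.
by rewrite (step_ge x1).
Qed.

(** If it vanished, monotonicity would make [step] identically zero, and so would its derivative at
    0, which is [bump 0] > 0. *)
Lemma step1_gt0 : 0 < step 1.
Proof.
rewrite lt_neqAle step_ge0 andbT eq_sym; apply/negP => /eqP s1.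
have s0 : step = cst 0.
  by apply/funext => x; apply/le_anti; rewrite step_ge0 andbT -s1 step_le1.
have := is_derive_step 0; rewrite s0 => -[_].
by rewrite derive_cst => b0; have := @bump0_gt0 R; rewrite -b0 ltxx.
Qed.

Lemma continuous_step : continuous step.
Proof.
move=> x; apply: differentiable_continuous; apply/derivable1_diffP.
by have [] := is_derive_step x.
Qed.

Lemma smooth_step n : smoothn n step.
Proof.
have h x : derivable step x 1 by have [] := is_derive_step x.
case: n => [|n]; split; try exact: h.
  by [].
rewrite (_ : derive1 _ = bump); first exact: smooth_bump.
by apply/funext => x; rewrite derive1E; have [] := is_derive_step x.
Qed.

Lemma is_derive_comp_scale f (df : R -> R) (p c : R) x :
  (forall y : R, is_derive y 1 f (df y)) ->
  is_derive (x : R) 1 (fun t => f ((t - p) / c)) (df ((x - p) / c) / c).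
Proof.
move=> hf.
apply: (@is_derive1_comp R f (fun t => (t - p) / c) x _ c^-1 (hf _)).
rewrite (_ : (fun t => _) = c^-1 *: ((@id R) + cst (- p))); last first.
  by apply/funext => t; rewrite /= mulrC.
have := is_deriveZ c^-1 (is_deriveD (is_derive_id x (1 : R)) (is_derive_cst (- p) x 1)).
by rewrite addr0 /GRing.scale/= mulr1.
Qed.

Lemma bump_scale_out (p c t : R) : 0 < c -> c <= `|t - p| -> bump ((t - p) / c) = 0.
Proof.
move=> c0 ct; rewrite bump_out// normrM normfV (gtr0_norm c0).
by rewrite ler_pdivlMr// mul1r.
Qed.

Lemma continuous_bump_scale (p c : R) : continuous (fun t : R => bump ((t - p) / c)).
Proof.
move=> t; apply: (@continuous_comp _ _ _ (fun t : R => (t - p) / c) bump).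
  by apply: cvgMl; apply: cvgB => //; exact: cvg_cst.
exact: continuous_bump.
Qed.

Lemma integral_bump_scale (p c : R) : 0 < c ->
  \int[mu]_(t in ball p c) bump ((t - p) / c) = c * step 1.
Proof.
move=> c0; rewrite ball_itv.
have int A : measurable A -> A `<=` `[p - c, p + c]%classic ->
    mu.-integrable A (EFin \o (fun t => bump ((t - p) / c))).
  move=> mA Apc; apply: measurable_bounded_integrable => //.
  - apply: (@le_lt_trans _ _ (mu `[p - c, p + c]%classic)).
      by apply: le_measure => //; rewrite inE//; exact: measurable_itv.
    exact: leb_itv_lty.
  - apply: measurable_funTS; apply: continuous_measurable_fun.
    exact: continuous_bump_scale.
  exists 1; split => // M M1 t /= _.
  by rewrite ger0_norm ?bump_ge0// (le_trans (bump_le1 _))// ltW.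
rewrite Rintegral_itv_bndo_bndc; last first.
  apply: int => //; exact: subset_itv_oo_cc.
rewrite Rintegral_itv_obnd_cbnd; last first.
  by apply: int => //; exact: subset_itv_oc_cc.
have D (x : R) : is_derive x 1 (fun t => c * step ((t - p) / c)) (bump ((x - p) / c)).
  have := is_deriveZ c (@is_derive_comp_scale _ _ p c x is_derive_step).
  by rewrite /GRing.scale/= mulrCA divff ?gt_eqF// mulr1.
have cF : continuous (fun t => c * step ((t - p) / c)).
  by move=> x; apply: differentiable_continuous; apply/derivable1_diffP; have [] := D x.
rewrite /Rintegral (@continuous_FTC2 _ _ (fun t => c * step ((t - p) / c)))/=.
- have c_neq0 : c != 0 by rewrite gt_eqF.
  rewrite (_ : (p + c - p) / c = 1); last by field.
  rewrite (_ : (p - c - p) / c = -1); last by field.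
  by rewrite (@step_le (-1))// mulr0 subr0.
- by rewrite ltrD2l gtrN.
- by apply: continuous_subspaceT; exact: continuous_bump_scale.
- split.
  + by move=> x _; have [] := D x.
  + by apply: cvg_at_right_filter; exact: cF.
  + by apply: cvg_at_left_filter; exact: cF.
- by move=> x _; rewrite derive1E; have [] := D x.
Qed.

End bump_integral.


Lemma integrable_cst_lty d (U : measurableType d) (R : realType)
    (nu : {measure set U -> \bar R}) (D : set U) (k : R) :
  measurable D -> (nu D < +oo)%E -> nu.-integrable D (EFin \o cst k).
Proof.
move=> mD Dfin; apply: measurable_bounded_integrable => //.
by exists `|k|; split => // M /ltW kM t _ /=.
Qed.

(** * Mollification at Lebesgue points *)

Section mollifier.
Context {R : realType}.
Local Notation mu := (@lebesgue_measure R).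
Implicit Types (f : R -> R) (x : R).

Lemma measurable_bump_scale (p c : R) :
  measurable_fun [set: R] (fun t : R => bump ((t - p) / c)).
Proof. by apply: continuous_measurable_fun; exact: continuous_bump_scale. Qed.

Lemma bounded_bump_scale (A : set R) (p c : R) :
  [bounded (bump ((t - p) / c) : R^o) | t in A].
Proof.
exists 1; split => // M M1 t /= _.
by rewrite ger0_norm ?bump_ge0// (le_trans (bump_le1 _))// ltW.
Qed.

Lemma integrableM_bump f (A : set (measurableTypeR R)) (p c : R) : measurable A ->
  mu.-integrable A (EFin \o f) ->
  mu.-integrable A (EFin \o (fun t => f t * bump ((t - p) / c))).
Proof.
move=> mA intf.
apply: (integrableMl mA intf _ (bounded_bump_scale A p c)).
by apply: measurable_funTS; exact: measurable_bump_scale.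
Qed.

(** The rescaled bump is at most 1 and lives on the ball of radius c, of measure 2c, so the error is
    at most twice the mean of |f - f x| on this ball; at a Lebesgue point this tends to 0 without
    any continuity of f. *)
Lemma mollify_lebesgue_pt f x : mu.-integrable setT (EFin \o f) ->
  lebesgue_pt f x ->
  c^-1 * \int[mu]_t (f t * bump ((t - x) / c)) @[c --> (0:R)^'+] --> f x * step 1.
Proof.
move=> intf fx; apply/cvgrPdist_le => /= e e0.
have /fine_cvgP[finavg /cvgrPdist_le fx0] := fx.
have e2 : 0 < e / 2 by rewrite divr_gt0.
near=> c.
have c0 : 0 < c by [].
have c_neq0 : c != 0 by rewrite gt_eqF.
have mB : measurable (ball x c : set (measurableTypeR R)) by exact: measurable_ball.
have intB : mu.-integrable (ball x c) (EFin \o f) by exact: (integrableS _ _ _ intf).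
have Bfin : (mu (ball x c) < +oo)%E by rewrite lebesgue_measure_ball ?ltry// ltW.
have intc : mu.-integrable (ball x c) (EFin \o cst (f x)).
  exact: integrable_cst_lty.
have intBx : mu.-integrable (ball x c) (EFin \o (fun t => f t - f x)).
  by apply: (integrableB _ intB intc).
have -> : \int[mu]_t (f t * bump ((t - x) / c)) =
    \int[mu]_(t in ball x c) (f t * bump ((t - x) / c)).
  rewrite [RHS]Rintegral_mkcond; apply: eq_Rintegral => t _.
  rewrite patchE; case: ifPn => // /negP tB.
  rewrite bump_scale_out ?mulr0// leNgt; apply/negP => txc; apply: tB.
  by rewrite inE /ball/= distrC.
have -> : \int[mu]_(t in ball x c) (f t * bump ((t - x) / c)) =
    \int[mu]_(t in ball x c) ((f t - f x) * bump ((t - x) / c)) +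
    f x * (c * step 1).
  have intb : mu.-integrable (ball x c) (EFin \o (fun t => bump ((t - x) / c))).
    have := @integrableM_bump (cst 1) (ball x c) x c mB (integrable_cst_lty _ mB Bfin).
    by apply: eq_integrable => // t _; rewrite /= mul1r.
  rewrite -(integral_bump_scale x c0) -RintegralZl// -RintegralD//.
  - by apply: eq_Rintegral => t _; rewrite -mulrDl subrK.
  - exact: integrableM_bump.
  - exact: (@integrableM_bump (cst (f x)) _ _ _ mB intc).
rewrite mulrDr [f x * (c * _)]mulrCA mulKf// opprD addrCA subrr addr0 normrN.
rewrite normrM normfV (gtr0_norm c0).
have le1 : `|\int[mu]_(t in ball x c) ((f t - f x) * bump ((t - x) / c))| <=
    \int[mu]_(t in ball x c) `|f t - f x|.
  apply: (le_trans (le_normr_Rintegral mB (integrableM_bump _ _ mB intBx))).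
  apply: le_Rintegral => //.
  - by have := integrable_abse (integrableM_bump x c mB intBx).
  - by have := integrable_abse intBx.
  move=> t _; rewrite normrM ler_piMr//.
  by rewrite ger0_norm ?bump_ge0 ?bump_le1.
have le2 : \int[mu]_(t in ball x c) `|f t - f x| = c *+ 2 * fine (davg f x c).
  rewrite /davg /iavg lebesgue_measure_ball ?ltW//.
  rewrite inver mulrn_eq0/= (negbTE c_neq0) fineM//=.
    by rewrite mulVKf ?mulrn_eq0.
  by have := integrable_fin_num mB (integrable_abse intBx).
have : `|0 - fine (davg f x c)| <= e / 2.
  by near: c; exact: fx0.
rewrite sub0r normrN => le3.
rewrite ler_pdivrMl// (le_trans le1)// le2 -mulr_natr -mulrA ler_pM2l//.
rewrite mulrC -ler_pdivlMr//; apply: le_trans le3; exact: ler_norm.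
Unshelve. all: by end_near. Qed.

End mollifier.


(** * Test functions approximating indicators *)

Section test_functions.
Context {R : realType}.
Local Notation mu := (@lebesgue_measure R).

(** As c tends to 0 this approaches [step 1] times the indicator of ]p, q[, while its derivative is
    a bump concentrating at p minus one concentrating at q. It turns a weak derivative into a
    formula for increments. *)
Definition plateau (p q c t : R) : R := step ((t - p) / c) - step ((t - q) / c).

Lemma smooth_plateau n p q c : smoothn n (plateau p q c).
Proof.
have aff r : smoothn n (fun t => step ((t - r) / c)).
  have := smoothn_affine c^-1 (- r / c) (smooth_step n).
  rewrite (_ : (fun x => _) = (fun t => step ((t - r) / c))) //.
  by apply/funext => t; congr step; rewrite mulrBl mulNr (mulrC c^-1).
rewrite (_ : plateau p q c = (fun t => step ((t - p) / c)) + (-1) *: (fun t => step ((t - q) / c))).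
  by apply: smoothnD => //; exact: smoothnZ.
by apply/funext => t; rewrite /plateau scaleN1r.
Qed.

Lemma derive1_plateau p q c t : derive1 (plateau p q c) t =
  c^-1 * (bump ((t - p) / c) - bump ((t - q) / c)).
Proof.
rewrite derive1E.
have [_] := is_deriveB (is_derive_comp_scale p c t is_derive_step)
                    (is_derive_comp_scale q c t is_derive_step).
by rewrite mulrBr !(mulrC c^-1) => <-.
Qed.

Lemma test_plateau a b p q c : 0 < c -> p <= q -> a < p - c -> q + c < b ->
  test_function a b (plateau p q c).
Proof.
move=> c0 pq ap qb; split.
  by apply: smoothnP => n; exact: smooth_plateau.
exists `[p - c, q + c]%classic; split.
- exact: segment_compact.
- by move=> t /=; rewrite !in_itv/= => /andP[t1 t2]; rewrite (lt_le_trans ap)//= (le_lt_trans t2).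
move=> t /=; rewrite in_itv/= => /negP; rewrite negb_and -!ltNge => /orP[tp|qt].
  rewrite /plateau !step_le ?subrr//.
    by rewrite ler_pdivrMr// mulN1r; lra.
  by rewrite ler_pdivrMr// mulN1r; lra.
rewrite /plateau (@step_ge _ ((t - p) / c)) ?(@step_ge _ ((t - q) / c)) ?subrr//.
  by rewrite ler_pdivlMr// mul1r; lra.
by rewrite ler_pdivlMr// mul1r; lra.
Qed.

Lemma test_bump (a b p c : R) : 0 < c -> a < p - c -> p + c < b ->
  test_function a b (fun t => bump ((t - p) / c)).
Proof.
move=> c0 ap pb; split.
  apply: smoothnP => n.
  have := smoothn_affine c^-1 (- p / c) (@smooth_bump R n).
  rewrite (_ : (fun x => _) = (fun t => bump ((t - p) / c))) //.
  by apply/funext => t; congr bump; rewrite mulrBl mulNr (mulrC c^-1).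
exists `[p - c, p + c]%classic; split.
- exact: segment_compact.
- by move=> t /=; rewrite !in_itv/= => /andP[t1 t2]; rewrite (lt_le_trans ap)//= (le_lt_trans t2).
move=> t /=; rewrite in_itv/= => /negP; rewrite negb_and -!ltNge => tp.
rewrite bump_scale_out// ler_normr; case/orP: tp => tp.
  by apply/orP; right; lra.
by apply/orP; left; lra.
Qed.

Lemma plateau_ge0 p q c t : 0 < c -> p <= q -> 0 <= plateau p q c t.
Proof.
move=> c0 pq; rewrite /plateau subr_ge0; apply: step_homo.
by rewrite ler_pM2r ?invr_gt0//; lra.
Qed.

Lemma plateau_le p q c t : plateau p q c t <= step 1.
Proof. by rewrite /plateau lerBlDr (le_trans (step_le1 _))// lerDl step_ge0. Qed.

Lemma continuous_plateau p q c : continuous (plateau p q c).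
Proof.
move=> t; apply: differentiable_continuous; apply/derivable1_diffP.
exact: (smooth_plateau 0 p q c).1.
Qed.

Lemma plateau_cvg (p q t : R) : p < q -> t != p -> t != q ->
  plateau p q n.+1%:R^-1 t @[n --> \oo] -->
    if t \in `]p, q[ then step 1 else (0 : R).
Proof.
move=> pq tp tq.
have S r : t != r -> \forall n \near \oo,
    step ((t - r) / n.+1%:R^-1) = if r < t then step 1 else (0 : R).
  move=> tr; have tr0 : 0 < `|t - r| by rewrite normr_gt0 subr_eq0.
  have := near_infty_natSinv_lt (PosNum tr0).
  apply: filterS => n /= /ltW nr; have n0 : 0 < n.+1%:R^-1 :> R by [].
  case: ltgtP tr nr => [tr|rt|->//] _ nr.
    rewrite step_ge// ler_pdivlMr// mul1r.
    by move: nr; rewrite gtr0_norm ?subr_gt0.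
  rewrite step_le// ler_pdivrMr// mulN1r.
  by move: nr; rewrite ltr0_norm ?subr_lt0// opprB lerNr opprB.
apply: cvg_near_cst; near=> n.
rewrite /plateau (near (S p tp))// (near (S q tq))// in_itv/=.
have [pt|tp'] := ltP p t; have [qt|tq'] := ltP q t; rewrite ?subrr ?subr0//=.
- by rewrite ltNge (ltW qt).
- by rewrite lt_neqAle tq tq'.
- by have := lt_le_trans (lt_trans pq qt) tp'; rewrite ltxx.
Unshelve. all: by end_near. Qed.

End test_functions.

(** * Increments of a function with a weak derivative *)

Section L2_basics.
Context {R : realType} (a b : R) (d : nat).
Local Notation mu := (@lebesgue_measure R).
Local Notation RT := (measurableTypeR R).
Implicit Types (f g : L2 a b d).

Definition coord f (i : 'I_d) (t : RT) : R := L2_fun f t 0 i.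

Lemma measurable_coord_L2 f i : measurable_fun [set: RT] (coord f i).
Proof. exact: measurable_L2_coord. Qed.

Lemma enorm_coord (x : 'rV[R]_d) i : `|x 0 i| <= enorm x.
Proof.
rewrite -sqrtr_sqr; apply: ler_wsqrtr.
by rewrite (bigD1 i)//= lerDl sumr_ge0// => j _; exact: sqr_ge0.
Qed.

Lemma enorm_le_sum (x : 'rV[R]_d) : enorm x <= \sum_(i < d) `|x 0 i|.
Proof.
have s0 : 0 <= \sum_(i < d) `|x 0 i| by exact: sumr_ge0.
rewrite -(ler_pXn2r (_ : (0 < 2)%N))// ?nnegrE ?enorm_ge0// enorm_sqr.
rewrite [leRHS]expr2 mulr_suml; apply: ler_sum => i _.
rewrite -real_normK ?num_real// expr2 ler_wpM2l//.
by rewrite (bigD1 i)//= lerDl sumr_ge0.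
Qed.

Lemma measurable_enorm_sqr (h : RT -> 'rV[R]_d) :
  (forall i, measurable_fun [set: RT] (fun t => h t 0 i)) ->
  measurable_fun [set: RT] (fun t => (enorm (h t) ^+ 2)%:E).
Proof.
move=> mh; apply/measurable_EFinP; apply: measurable_funX.
exact: measurable_enorm.
Qed.

Lemma L2_sqr_lty f : (\int[leb_on a b]_t (enorm (L2_fun f t) ^+ 2)%:E < +oo)%E.
Proof.
have := set_valP f; rewrite /= L2_normE => /lty_poweRy; apply.
by rewrite invr_eq0.
Qed.

Lemma integrable_L2_coord f i : (leb_on a b).-integrable setT (EFin \o coord f i).
Proof.
have mi := measurable_coord_L2 f i.
apply/integrableP; split; first exact/measurable_EFinP.
apply: (@le_lt_trans _ _ (\int[leb_on a b]_t (1 + (enorm (L2_fun f t) ^+ 2)%:E))%E).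
  apply: ge0_le_integral => //.
  - by apply: measurableT_comp => //; exact/measurable_EFinP.
  - apply: emeasurable_funD => //; apply: measurable_enorm_sqr => j.
    exact: measurable_L2_coord.
  move=> t _; rewrite abse_EFin -EFinD lee_fin (le_trans (enorm_coord _ _))//.
  have := enorm_ge0 (L2_fun f t); nra.
rewrite ge0_integralD//; last 2 first.
  by move=> t _; rewrite lee_fin sqr_ge0.
  by apply: measurable_enorm_sqr => j; exact: measurable_L2_coord.
by rewrite lte_add_pinfty// ?L2_sqr_lty// integral_cst// mul1e leb_on_lty.
Qed.

Lemma integrable_coord_itv f i : mu.-integrable `]a, b[ (EFin \o coord f i).
Proof.
apply/integrable_leb_on; last exact: integrable_L2_coord.
by apply/measurable_EFinP; exact: measurable_coord_L2.
Qed.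

(** Extension by zero, so that Lebesgue differentiation and mollification can be used on the whole
    line; values of f off ]a, b[ are meaningless. *)
Definition ext f i : R -> R := (coord f i) \_ `]a, b[.

Lemma integrable_ext f i : mu.-integrable setT (EFin \o ext f i).
Proof.
rewrite /ext -restrict_EFin; apply/(integrable_mkcond _ _).1 => //.
exact: integrable_coord_itv.
Qed.

Lemma ae_lebesgue_pt_ext f i : {ae mu, forall x, lebesgue_pt (ext f i) x}.
Proof.
by apply: lebesgue_differentiation; apply: (open_integrable_locally openT); exact: integrable_ext.
Qed.

Lemma cvg_natSinv_right : n.+1%:R^-1 @[n --> \oo] --> (0 : R)^'+.
Proof.
move=> A /= [e /= e0 eA]; have := near_infty_natSinv_lt (PosNum e0).
apply: filterS => n /= ne; apply: eA => //=.
by rewrite sub0r normrN ger0_norm.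
Qed.

Lemma Rintegral_leb_on_ext f i (h : R -> R) : measurable_fun [set: R] h ->
  \int[leb_on a b]_t (coord f i t * h t) = \int[mu]_t (ext f i t * h t).
Proof.
move=> mh; rewrite Rintegral_leb_on; last first.
  by apply: measurable_funM => //; exact: measurable_coord_L2.
rewrite Rintegral_mkcond; apply: eq_Rintegral => t _.
by rewrite /ext !patchE; case: ifPn => //; rewrite mul0r.
Qed.

Lemma ext_in f i t : t \in `]a, b[ -> ext f i t = coord f i t.
Proof. by move=> tab; rewrite /ext patchE mem_setE tab. Qed.

Lemma near_natSinv_lt (e : R) : 0 < e -> \forall n \near \oo, n.+1%:R^-1 < e.
Proof. by move=> e0; exact: (near_infty_natSinv_lt (PosNum e0)). Qed.

Lemma lebesgue_measure_set2 (p q : R) : mu ([set p; q] : set R) = 0.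
Proof.
apply/eqP; rewrite eq_le measure_ge0 andbT.
apply: (le_trans (measureU2 _ _ _)) => //=.
have h (r : R) : mu ([set r] : set R) = 0 by rewrite lebesgue_measure_set1.
by rewrite [X in (X + _)%E]h [X in (_ + X)%E]h adde0.
Qed.

(** Test with plateaus of width c -> 0. Against their derivatives, f gives (f p - f q) [step 1] by
    mollification at the two Lebesgue points; against the plateaus, g gives its integral over ]p, q[
    times [step 1] by dominated convergence. The positive factor cancels. *)
Lemma weak_derivative_increment f g i p q : weak_derivative f g ->
  a < p -> p < q -> q < b ->
  lebesgue_pt (ext f i) p -> lebesgue_pt (ext f i) q ->
  coord f i q - coord f i p = \int[mu]_(t in `]p, q[) coord g i t.
Proof.
move=> fg ap pq qb lp lq.
have inE' t : p <= t -> t <= q -> t \in `]a, b[.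
  by move=> pt tq; rewrite in_itv/= (lt_le_trans ap)//= (le_lt_trans tq).
rewrite -!ext_in ?inE' ?lexx// 1?ltW//.
pose c n : R := n.+1%:R^-1.
have c_gt0 n : 0 < c n by rewrite invr_gt0.
have moll r : lebesgue_pt (ext f i) r ->
    (c n)^-1 * \int[mu]_t (ext f i t * bump ((t - r) / c n)) @[n --> \oo]
      --> ext f i r * step 1.
  move=> lr.
  exact: (cvg_comp _ _ cvg_natSinv_right (mollify_lebesgue_pt (integrable_ext f i) lr)).
have L := cvgB (moll p lp) (moll q lq).
have intb r n : mu.-integrable setT
    (EFin \o (fun t => ext f i t * bump ((t - r) / c n))).
  by apply: integrableM_bump => //; exact: integrable_ext.
have D : \int[mu]_t (ext g i t * plateau p q (c n) t) @[n --> \oo] -->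
    \int[mu]_t (ext g i t * (if t \in `]p, q[ then step 1 else 0)).
  have mg : measurable_fun setT (ext g i : RT -> R).
    by apply/measurable_EFinP; exact: measurable_int (integrable_ext g i).
  have [|||||int0 _ h] := @dominated_convergence _ _ _ mu setT measurableT
    (fun n t => (ext g i t * plateau p q (c n) t)%:E)
    (fun t => (ext g i t * (if t \in `]p, q[ then step 1 else 0))%:E)
    (fun t => (`|ext g i t| * step 1)%:E).
  - move=> n; apply/measurable_EFinP; apply: measurable_funM => //.
    by apply: continuous_measurable_fun; exact: continuous_plateau.
  - apply/measurable_EFinP; apply: measurable_funM => //.
    apply: measurable_fun_ifT => //; apply: (measurable_fun_bool true).
    rewrite setTI (_ : _ @^-1` _ = `]p, q[%classic)//.
  - exists [set p; q]; split.
    + exact: measurableU.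
    + exact: lebesgue_measure_set2.
    + move=> t /= /not_implyP [_ nt]; apply: contrapT => /not_orP[/eqP tp /eqP tq].
      apply: nt; apply: cvg_EFin; first by near=> n.
      by apply: cvgMr; exact: plateau_cvg.
  - have := integrableZl measurableT (step 1) (integrable_abse (integrable_ext g i)).
    by apply: eq_integrable => // t _ /=; rewrite EFinM muleC.
  - apply: aeW => t n _; rewrite abse_EFin lee_fin normrM ler_wpM2l//.
    rewrite ger0_norm; first exact: plateau_le.
    by apply: plateau_ge0; [exact: c_gt0|exact: ltW].
  apply: fine_cvg; rewrite fineK//.
  exact: integrable_fin_num int0.
have RHS : \int[mu]_t (ext g i t * (if t \in `]p, q[ then step 1 else 0)) =
    (\int[mu]_(t in `]p, q[) coord g i t) * step 1.
  rewrite -RintegralZr//; last first.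
    apply: integrableS (integrable_coord_itv g i) => //.
    by apply: subset_itv; rewrite bnd_simp ltW.
  rewrite [RHS]Rintegral_mkcond; apply: eq_Rintegral => t _.
  rewrite patchE mem_setE; case: ifPn => [|_]; last by rewrite mulr0.
  by rewrite in_itv/= => /andP[pt tq]; rewrite ext_in// inE' ?ltW.
rewrite {}RHS in D.
apply: (mulIf (lt0r_neq0 (@step1_gt0 R))).
apply: oppr_inj; rewrite -mulNr opprB mulrBl.
rewrite -(cvg_lim (@Rhausdorff R) (L _)); apply/(cvg_lim (@Rhausdorff R)).
apply: cvg_trans (cvgN D); apply: near_eq_cvg.
near=> n.
have c0 := c_gt0 n.
rewrite !fctE -mulrBr -RintegralB//.
(* Only for large n does the support [p - c, q + c] of the plateau fit into ]a, b[. *)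
have tst : test_function a b (plateau p q (c n)).
  apply: test_plateau => //; first exact: ltW.
    by rewrite ltrBrDr -ltrBrDl; near: n; apply: near_natSinv_lt; rewrite subr_gt0.
  by rewrite -ltrBrDl; near: n; apply: near_natSinv_lt; rewrite subr_gt0.
have mp : measurable_fun [set: R] (plateau p q (c n)).
  by apply: continuous_measurable_fun; exact: continuous_plateau.
have mdp : measurable_fun [set: R] (derive1 (plateau p q (c n))).
  apply: continuous_measurable_fun => t; apply: differentiable_continuous.
  by apply/derivable1_diffP; exact: (smooth_plateau 1 p q (c n)).2.1.
have := fg _ tst i; rewrite -/(coord _ _ _).
rewrite Rintegral_leb_on_ext// Rintegral_leb_on_ext// => <-.
rewrite -RintegralZl//; last first.
  by have := integrableB measurableT (intb p n) (intb q n).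
apply: eq_Rintegral => t _; rewrite derive1_plateau.
by rewrite -mulrBr mulrCA.
Unshelve. all: by end_near. Qed.

End L2_basics.


Lemma cvg_natSinv_dnbhs {R : realType} : n.+1%:R^-1 @[n --> \oo] --> (0 : R)^'.
Proof.
move=> A /= [e /= e0 eA]; have := near_natSinv_lt e0.
apply: filterS => n /= ne; apply: eA; last by rewrite gt_eqF.
by rewrite /= sub0r normrN ger0_norm.
Qed.

(** * The continuous representative *)

Section representative.
Context {R : realType} (a b : R) (d : nat) (ab : a < b).
Local Notation mu := (@lebesgue_measure R).
Local Notation RT := (measurableTypeR R).
Implicit Types (f g : L2 a b d).

Lemma ae_leb_onP (P : R -> Prop) : (forall t, t \in `]a, b[ -> P t) ->
  {ae leb_on a b, forall t : RT, P t}.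
Proof.
move=> h; apply/leb_on_negligible; rewrite (_ : _ `&` _ = set0).
  exact: negligible_set0.
by apply/seteqP; split=> // t [] /= nP tab; apply: nP; apply: h.
Qed.

Lemma ae_leb_on_sub (P : R -> Prop) : {ae mu, forall t : RT, P t} ->
  {ae leb_on a b, forall t : RT, P t}.
Proof.
move=> h; apply/leb_on_negligible; apply: negligibleS h => t; exact: subIsetl.
Qed.

Lemma ae_leb_on_ex (P : R -> Prop) (u v : R) : a <= u -> u < v -> v <= b ->
  {ae leb_on a b, forall t : RT, P t} -> exists2 t, t \in `]u, v[ & P t.
Proof.
move=> au uv vb /leb_on_negligible h; apply: contrapT => nex.
have : mu.-negligible (`]u, v[%classic : set RT).
  apply: negligibleS h => t tuv; split => /=.
    by move=> Pt; apply: nex; exists t.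
  by move: tuv; apply: subset_itv; rewrite bnd_simp.
have muv : measurable (`]u, v[%classic : set RT) by [].
move/(negligibleP mu muv) => /=.
rewrite lebesgue_measure_itv/= lte_fin uv => /eqP; rewrite -EFinB eqe subr_eq0.
by move=> /eqP vu; move: uv; rewrite vu ltxx.
Qed.

(** Two values that differ at t stay different on a relative neighbourhood of t in [a, b], which has
    positive measure even at an endpoint. *)
Lemma within_continuous_ae_eq (c1 c2 : R -> 'rV[R]_d) :
  {within `[a, b], continuous c1} -> {within `[a, b], continuous c2} ->
  {ae leb_on a b, forall t : RT, c1 t = c2 t} ->
  forall t, t \in `[a, b] -> c1 t = c2 t.
Proof.
move=> k1 k2 c12 t tab; apply: contrapT => /eqP ne.
move/subspace_continuousP in k1; move/subspace_continuousP in k2.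
have kB : (c1 s - c2 s) @[s --> within `[a, b] (nbhs t)] --> c1 t - c2 t.
  by apply: cvgB; [exact: k1|exact: k2].
have e0 : 0 < `|c1 t - c2 t| by rewrite normr_gt0 subr_eq0.
move/cvgrPdist_lt : kB => /(_ _ e0).
rewrite near_withinE => -[e /= e1 he].
move: tab; rewrite in_itv/= => /andP[at_ tb].
have [|||s] := @ae_leb_on_ex _ (Num.max a (t - e)) (Num.min b (t + e)) _ _ _ c12.
- by rewrite le_max lexx.
- by rewrite lt_min !gt_max ab /=; apply/and3P; split; lra.
- by rewrite ge_min lexx.
rewrite in_itv/= gt_max lt_min => /andP[/andP[as_ ts] /andP[sb st]] cs.
have := he s; rewrite /= in_itv/= !ltW//= cs subrr subr0 ltxx.
by move=> h; suff /h/(_ isT) : `|t - s| < e by []; rewrite distrC ltr_distl; apply/andP; split; lra.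
Qed.

Definition primitive g i t : R := \int[mu]_(s in `[a, t]) ext g i s.

Lemma integrable_ext_on g i (A : set RT) : measurable A ->
  mu.-integrable A (EFin \o ext g i).
Proof. by move=> mA; apply: integrableS (integrable_ext g i). Qed.

Lemma primitiveB g i p q : a <= p -> p <= q -> q <= b ->
  primitive g i q - primitive g i p = \int[mu]_(t in `]p, q[) coord g i t.
Proof.
move=> ap pq qb; rewrite /primitive Rintegral_itvB; last 3 first.
- exact: integrable_ext_on.
- by rewrite bnd_simp.
- by rewrite bnd_simp.
rewrite -Rintegral_itv_bndo_bndc; last exact: integrable_ext_on.
apply: eq_Rintegral => t; rewrite inE/= in_itv/= => /andP[pt tq].
by rewrite ext_in// in_itv/= (le_lt_trans ap)//= (lt_le_trans tq).
Qed.

Lemma ae_lebesgue_pts f : {ae mu, forall x : RT, forall i, lebesgue_pt (ext f i) x}.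
Proof. by apply: filter_forall => i; exact: ae_lebesgue_pt_ext. Qed.

Lemma continuous_primitive g i : {within `[a, b], continuous (primitive g i)}.
Proof.
apply: parameterized_integral_continuous; first exact: ltW.
exact: integrable_ext_on.
Qed.

Lemma continuous_row (c : R -> 'rV[R]_d) (A : set R) :
  (forall i, {within A, continuous (fun t => c t 0 i)}) ->
  {within A, continuous c}.
Proof.
move=> h; apply/subspace_continuousP => t At.
apply/cvgrPdist_le => e e0.
have : \forall s \near within A (nbhs t), forall i, `|c t 0 i - c s 0 i| <= e.
  apply: filter_forall => i.
  by have := h i => /subspace_continuousP/(_ t At)/cvgrPdist_le/(_ e e0).
apply: filterS => s hs.
rewrite /Num.norm/= mx_normrE; apply: (big_ind (fun x => x <= e)) => //.
- exact: ltW.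
- by move=> x y xe ye; rewrite ge_max xe.
by move=> [k i] _; rewrite (ord1 k) !mxE /=; exact: hs.
Qed.

Definition lift_primitive (x : 'rV[R]_d) g (p t : R) : 'rV[R]_d :=
  \row_i (x 0 i + (primitive g i t - primitive g i p)).

Lemma continuous_lift_primitive x g p :
  {within `[a, b], continuous (lift_primitive x g p)}.
Proof.
apply: continuous_row => i; rewrite (_ : (fun _ => _) =
    (fun t => x 0 i + (primitive g i t - primitive g i p))); last first.
  by apply/funext => t; rewrite mxE.
apply/subspace_continuousP => t tab; apply: cvgD; first exact: cvg_cst.
apply: cvgB; last exact: cvg_cst.
by have /subspace_continuousP := @continuous_primitive g i; apply.
Qed.

(** Anchor at a point p which is a Lebesgue point of every coordinate of f; the increment formula
    then identifies f with the primitive of g at every other common Lebesgue point, hence almost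
    everywhere. *)
Lemma weak_derivative_lift f g : weak_derivative f g -> exists x p,
  {ae leb_on a b, forall t : RT, lift_primitive x g p t = L2_fun f t}.
Proof.
move=> fg.
have [//|//|//|p pab lp] := @ae_leb_on_ex _ a b _ _ _ (ae_leb_on_sub (ae_lebesgue_pts f)).
exists (L2_fun f p), p.
apply/leb_on_negligible.
apply: negligibleS (ae_lebesgue_pts f) => t /= [nt tab] lt; apply: nt.
move: (pab) (tab); rewrite !in_itv/= => /andP[ap pb] /andP[at_ tb].
apply/rowP => i; rewrite mxE.
have [->|ptn] := eqVneq p t; first by rewrite subrr addr0.
have [pt|tp] := ltP p t.
  rewrite primitiveB ?(ltW ap) ?(ltW pt) ?(ltW tb)//.
  by rewrite -(weak_derivative_increment fg ap pt tb (lp i) (lt i)) addrC subrK.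
have {}tp : t < p by rewrite lt_neqAle eq_sym ptn.
rewrite -[X in _ + X]opprB primitiveB ?(ltW at_) ?(ltW tp) ?(ltW pb)//.
rewrite -(weak_derivative_increment fg at_ tp pb (lt i) (lp i)) /coord.
by rewrite opprB addrC subrK.
Qed.

(** A primitive of the weak derivative inhabits the set from which [xget] selects, so [crep] does
    not fall back on its default. *)
Lemma crepP f : W12 f -> {within `[a, b], continuous (crep f)} /\
  {ae leb_on a b, forall t : RT, crep f t = L2_fun f t}.
Proof.
move=> Wf; rewrite /crep; case: xgetP => [c _ [_ c1 c2]|]; first by [].
have [g fg] := Wf; have [x [p h]] := weak_derivative_lift fg.
move=> /(_ (lift_primitive x g p)) []; split => //.
exact: continuous_lift_primitive.
Qed.

Lemma crep_unique f c : W12 f -> {within `[a, b], continuous c} ->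
  {ae leb_on a b, forall t : RT, c t = L2_fun f t} ->
  forall t, t \in `[a, b] -> crep f t = c t.
Proof.
move=> Wf kc cf t tab; have [k1 k2] := crepP Wf.
apply: (within_continuous_ae_eq k1 kc _ tab).
by apply: filterS2 k2 cf => s -> ->.
Qed.

Lemma crep_lift f g : weak_derivative f g -> exists x p,
  forall t, t \in `[a, b] -> crep f t = lift_primitive x g p t.
Proof.
move=> fg; have [x [p h]] := weak_derivative_lift fg; exists x, p.
by apply: crep_unique => //; [exists g|exact: continuous_lift_primitive].
Qed.

Lemma crepB f g i p q : weak_derivative f g -> a <= p -> p <= q -> q <= b ->
  crep f q 0 i - crep f p 0 i = \int[mu]_(t in `]p, q[) coord g i t.
Proof.
move=> fg ap pq qb; have [x [p0 h]] := crep_lift fg.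
rewrite !h ?in_itv/= ?ap ?qb ?(le_trans ap pq) ?(le_trans pq qb)// !mxE.
by rewrite -primitiveB// opprD addrACA subrr add0r opprB addrA subrK.
Qed.

(** A primitive is differentiable at the Lebesgue points of its integrand. Quotients along the
    sequence 1/(n+1) suffice, and a countable family is what keeps the velocity measurable later. *)
Lemma crep_difference_quotient f g i t : weak_derivative f g ->
  lebesgue_pt (ext g i) t -> a < t -> t < b ->
  n.+1%:R * (crep f (t + n.+1%:R^-1) 0 i - crep f t 0 i) @[n --> \oo] -->
    coord g i t.
Proof.
move=> fg lt at_ tb; have [x [p0 h]] := crep_lift fg.
have [D DE] : derivable (primitive g i) t 1 /\
    (primitive g i)^`()%classic t = ext g i t.
  apply: (@FTC1_lebesgue_pt R (ext g i) (BLeft a) t b tb) => //.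
  exact: integrable_ext_on.
rewrite -ext_in; last by rewrite in_itv/= at_.
rewrite -DE derive1E.
have := @cvg_natSinv_dnbhs R.
move=> /cvg_comp /(_ D); apply: cvg_trans; apply: near_eq_cvg; near=> n.
have n0 : 0 < n.+1%:R^-1 :> R by [].
rewrite /= invrK [n.+1%:R^-1 *: 1]mulr1 !h.
- rewrite !mxE opprD addrACA subrr add0r opprB addrA subrK.
  by rewrite (addrC t).
- by rewrite in_itv/= !ltW.
- rewrite in_itv/= (ltW (lt_trans at_ _)) ?ltrDl//=.
  rewrite -lerBrDl; apply: ltW; near: n; apply: near_natSinv_lt.
  by rewrite subr_gt0.
Unshelve. all: by end_near. Qed.

(** Both are limits of the same difference quotients of [crep f] at their common Lebesgue points. *)
Lemma weak_derivative_uniq f g1 g2 : weak_derivative f g1 -> weak_derivative f g2 ->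
  g1 = g2.
Proof.
move=> fg1 fg2; apply: L2_eq; apply/leb_on_negligible.
apply: negligibleS (negligibleU (ae_lebesgue_pts g1) (ae_lebesgue_pts g2)).
move=> t /= [nt tab]; apply/not_andP => -[l1 l2]; apply: nt.
move: tab; rewrite in_itv/= => /andP[at_ tb].
apply/rowP => i.
have c1 := crep_difference_quotient fg1 (l1 i) at_ tb.
have c2 := crep_difference_quotient fg2 (l2 i) at_ tb.
exact: (cvg_unique (@Rhausdorff R) c1 c2).
Qed.

Lemma wderivP f g : weak_derivative f g -> wderiv f = g.
Proof.
move=> fg; apply: weak_derivative_uniq (fg) => //.
by apply: (@getPex _ (weak_derivative f)); exists g.
Qed.

End representative.

Lemma is_derive_difference_quotient {R : realType} {d : nat} (F : R -> 'rV[R]_d)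
    (t : R) (v : 'rV[R]_d) i : is_derive t 1 F v ->
  n.+1%:R * (F (t + n.+1%:R^-1) 0 i - F t 0 i) @[n --> \oo] --> v 0 i.
Proof.
move=> -[D DE].
have h := @cvg_natSinv_dnbhs R.
have := cvg_comp _ _ h D; rewrite -/('D_1 F t) DE => hD.
have := cvg_comp _ _ hD (@coord_continuous R 1 d 0 i v).
apply: cvg_trans; apply: near_eq_cvg; near=> n.
by rewrite /= !mxE invrK [n.+1%:R^-1 *: 1]mulr1 (addrC t).
Unshelve. all: by end_near. Qed.


(** * Measurability of maps into Borel spaces *)

Section borel_target.
Context d (T : measurableType d) (R : realType).

(** The target carries the sigma-algebra of its open sets, not a product one. A countable family [B]
    refining all neighbourhoods writes every open set as a countable union, so it is enough to test
    the preimages of the members of [B]. *)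
Lemma measurable_to_borel (X : ptopologicalType) (B : nat -> set X) (h : T -> X) :
  (forall U x, nbhs x U -> exists n, B n x /\ B n `<=` U) ->
  (forall n, measurable (h @^-1` B n)) ->
  measurable_fun setT (h : T -> borel X).
Proof.
move=> basisB mh; apply: (@measurability _ _ T (borel X) setT h open erefl).
move=> _ [U oU <-]; rewrite setTI.
pose C n := if `[< B n `<=` U >] then h @^-1` B n else set0.
rewrite (_ : _ @^-1` U = \bigcup_n C n).
  by apply: bigcupT_measurable => n; rewrite /C; case: asboolP.
apply/seteqP; split => t /=; last first.
  by move=> [n _]; rewrite /C; case: asboolP => // + ht => /(_ _ ht).
move=> Ut; have [n [nt nU]] := basisB U (h t) (open_nbhs_nbhs (conj oU Ut)).
by exists n => //; rewrite /C ifT//; exact/asboolP.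
Qed.

Lemma separable_ball_basis (X : pseudoMetricType R) (s : nat -> X) :
  (forall x (e : R), 0 < e -> exists n, ball (s n) e x) ->
  forall U x, nbhs x U -> exists n k : nat,
    ball (s n) (k.+1%:R^-1 : R) x /\ ball (s n) (k.+1%:R^-1 : R) `<=` U.
Proof.
move=> sdense U x; rewrite -nbhs_ballE => -[e /= e0 eU].
have [k _ ke] := near_natSinv_lt (divr_gt0 e0 (ltr0Sn R 1)).
have k0 : 0 < k.+1%:R^-1 :> R by [].
have {}ke : k.+1%:R^-1 <= e / 2 :> R by apply: ltW; apply: ke => /=.
have [n hn] := sdense x _ k0.
exists n, k; split => // y ny.
apply: eU; rewrite (splitr e).
apply: (@ball_triangle _ _ (s n)); last exact: le_ball ny.
by apply: ball_sym; apply: le_ball hn.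
Qed.

Definition rat_row n (k : nat) : 'rV[R]_n :=
  if unpickle k is Some u then map_mx (@ratr R) u else 0.

Lemma rat_row_dense n (x : 'rV[R]_n) (e : R) : 0 < e ->
  exists k, ball (rat_row n k) e x.
Proof.
move=> e0.
have h (i : 'I_n) : exists q : rat, `|ratr q - x 0 i| < e.
  have /rat_in_itvoo[q] : x 0 i - e < x 0 i + e by rewrite ltrD2l gtrN.
  rewrite in_itv/= => /andP[q1 q2]; exists q.
  by rewrite ltr_distl q1.
exists (pickle (\row_i projT1 (cid (h i)) : 'rV[rat]_n)).
rewrite /rat_row pickleK; split => // i j; rewrite !mxE ord1 /ball/=.
exact: projT2 (cid (h j)).
Qed.

Lemma measurable_preimage_ball n (h : T -> 'rV[R]_n) (x : 'rV[R]_n) (e : R) :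
  (forall i, measurable_fun setT (fun t => h t 0 i)) ->
  measurable (h @^-1` ball x e).
Proof.
move=> mh; have [e0|e0] := ltP 0 e; last first.
  rewrite (_ : _ @^-1` _ = set0)//; apply/seteqP; split => // t /= -[].
  by rewrite ltNge e0.
rewrite (_ : _ @^-1` _ = \bigcap_(i in [set: 'I_n])
    ((fun t => h t 0 i) @^-1` ball (x 0 i) e)).
  apply: fin_bigcap_measurable => // i _.
  by rewrite -[X in measurable X]setTI; apply: mh => //; exact: measurable_ball.
apply/seteqP; split => t /= ht; first by move=> i _; exact: ht.2.
by split => // i j; rewrite ord1; exact: ht.
Qed.

Lemma measurable_row n (h : T -> 'rV[R]_n) :
  (forall i, measurable_fun setT (fun t => h t 0 i)) ->
  measurable_fun setT (h : T -> borel 'rV[R]_n).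
Proof.
move=> mh.
pose B k : set 'rV[R]_n := if unpickle k is Some u then
  ball (rat_row n u.1) (u.2.+1%:R^-1 : R) else set0.
apply: (@measurable_to_borel _ B) => [U x xU|k].
  have [k1 [k2 h12]] := separable_ball_basis (@rat_row_dense n) xU.
  by exists (pickle (k1, k2)); rewrite /B pickleK.
by rewrite /B; case: unpickle => [u|]; [exact: measurable_preimage_ball|rewrite preimage_set0].
Qed.

Lemma measurable_row_pair n m (h1 : T -> 'rV[R]_n) (h2 : T -> 'rV[R]_m) :
  (forall i, measurable_fun setT (fun t => h1 t 0 i)) ->
  (forall i, measurable_fun setT (fun t => h2 t 0 i)) ->
  measurable_fun setT
    ((fun t => (h1 t, h2 t)) : T -> borel ('rV[R]_n * 'rV[R]_m)%type).
Proof.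
move=> mh1 mh2.
pose B k : set ('rV[R]_n * 'rV[R]_m) := if unpickle k is Some (a, b) then
  ball (rat_row n a.1) (a.2.+1%:R^-1 : R) `*` ball (rat_row m b.1) (b.2.+1%:R^-1 : R)
  else set0.
apply: (@measurable_to_borel _ B) => [U x [[U1 U2] [xU1 xU2] U12]|k].
  have [k1 [k2 [h12 k12]]] := separable_ball_basis (@rat_row_dense n) xU1.
  have [j1 [j2 [i12 j12]]] := separable_ball_basis (@rat_row_dense m) xU2.
  exists (pickle ((k1, k2), (j1, j2))); rewrite /B pickleK; split => // y [y1 y2].
  by apply: U12; split; [exact: k12|exact: j12].
rewrite /B; case: unpickle => [[a b]|]; last by rewrite preimage_set0.
rewrite (_ : _ @^-1` _ = (h1 @^-1` ball (rat_row n a.1) (a.2.+1%:R^-1 : R)) `&`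
   (h2 @^-1` ball (rat_row m b.1) (b.2.+1%:R^-1 : R)))//.
by apply: measurableI; exact: measurable_preimage_ball.
Qed.

End borel_target.

Lemma measurable_continuous_borel (R : realType) (X : ptopologicalType) (f : X -> R) :
  continuous f -> measurable_fun setT (f : borel X -> R).
Proof.
move=> /continuousP cf.
apply: (@measurability _ _ (borel X) R setT _ _ (RGenOpens.measurableE R)).
move=> _ [_ [x [y ->]] <-]; rewrite setTI.
by apply: sub_sigma_algebra; apply: cf; exact: interval_open.
Qed.

Lemma measurable_continuous_borel2 (X Y : ptopologicalType) (f : X -> Y) :
  continuous f -> measurable_fun setT (f : borel X -> borel Y).
Proof.
move=> /continuousP cf.
apply: (@measurability _ _ (borel X) (borel Y) setT f open erefl).
move=> _ [U oU <-]; rewrite setTI.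
by apply: sub_sigma_algebra; exact: cf.
Qed.

(** * Lipschitz functionals on L^2 *)

Section L2_metric.
Context {R : realType} (a b : R) (d : nat).
Local Notation RT := (measurableTypeR R).
Implicit Types (f g u v : L2 a b d) (h : R -> R).

Lemma L2_dist_ge0 u v : 0 <= L2_dist u v.
Proof. by rewrite /L2_dist fine_ge0// L2_norm_ge0. Qed.

Lemma sqr_L2_norm (w : R -> 'rV[R]_d) : (0 <= \int[leb_on a b]_t (enorm (w t) ^+ 2)%:E)%E ->
  (L2_norm a b w ^+ 2 = \int[leb_on a b]_t (enorm (w t) ^+ 2)%:E)%E.
Proof.
move=> I0; rewrite L2_normE; case: (integral _ _ _) I0 => [r r0| _|//].
  rewrite poweR_EFin -EFin_expe; congr EFin.
  by rewrite powR12_sqrt// sqr_sqrtr.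
by rewrite poweRyr ?invr_eq0// expe2 mulyy.
Qed.

Lemma sqr_L2_dist u v : (L2_dist u v ^+ 2)%:E =
  (\int[leb_on a b]_t (enorm (L2_fun u t - L2_fun v t) ^+ 2)%:E)%E.
Proof.
rewrite -sqr_L2_norm; last by apply: integral_ge0 => t _; rewrite lee_fin sqr_ge0.
by rewrite EFin_expe /L2_dist fineK// L2_dist_fin.
Qed.

Lemma measurable_sqr_L2_sub u v : measurable_fun setT
  (fun t : RT => (enorm (L2_fun u t - L2_fun v t) ^+ 2)%:E).
Proof.
by apply/measurable_EFinP; apply: measurable_funX; exact: measurable_L2_dist.
Qed.

Definition leb_mass : R := 1 + fine (leb_on a b setT).

Lemma leb_massE : leb_mass%:E = (1 + leb_on a b setT)%E.
Proof.
rewrite /leb_mass EFinD fineK// ge0_fin_numE//.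
exact: leb_on_lty.
Qed.

Lemma leb_mass_ge1 : 1 <= leb_mass.
Proof. by rewrite /leb_mass lerDl fine_ge0. Qed.

(** With e the L^2 distance, |x| <= e + x^2 / e pointwise; integrating gives e times the length of
    the interval plus e. Hence the constant [leb_mass], one plus the length, in place of the square
    root of Cauchy-Schwarz. *)
Lemma L1_coord_le u v i :
  (\int[leb_on a b]_t `|coord u i t - coord v i t|%:E <= (leb_mass * L2_dist u v)%:E)%E.
Proof.
have [/L2_dist_eq0 ->|uv0] := eqVneq (L2_dist u v) 0.
  under eq_integral do rewrite subrr normr0.
  by rewrite integral0 lee_fin mulr_ge0 ?L2_dist_ge0// (le_trans _ leb_mass_ge1).
have uv : 0 < L2_dist u v by rewrite lt_neqAle eq_sym uv0 L2_dist_ge0.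
pose e := L2_dist u v.
apply: (@le_trans _ _ (\int[leb_on a b]_t
    (e%:E + (e^-1)%:E * (enorm (L2_fun u t - L2_fun v t) ^+ 2)%:E))%E).
  apply: ge0_le_integral => //.
  - apply/measurable_EFinP; apply: measurableT_comp => //.
    by apply: measurable_funB; exact: measurable_coord_L2.
  - by apply: emeasurable_funD => //; apply: measurable_funeM; exact: measurable_sqr_L2_sub.
  move=> t _; rewrite -EFinM -EFinD lee_fin.
  have -> : coord u i t - coord v i t = (L2_fun u t - L2_fun v t) 0 i by rewrite !mxE.
  apply: (le_trans (enorm_coord _ _)); set x := enorm _.
  rewrite -(ler_pM2l uv) mulrDr mulVKf//.
  have : 0 <= (x - e) ^+ 2 by exact: sqr_ge0.
  by have := enorm_ge0 (L2_fun u t - L2_fun v t); rewrite -/x -/e; nra.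
rewrite ge0_integralD//; last 3 first.
- by move=> t _; rewrite lee_fin ltW.
- by move=> t _; rewrite -EFinM lee_fin mulr_ge0 ?invr_ge0 ?sqr_ge0 ?ltW.
- by apply: measurable_funeM; exact: measurable_sqr_L2_sub.
rewrite ge0_integralZl//; last 3 first.
- exact: measurable_sqr_L2_sub.
- by move=> t _; rewrite lee_fin sqr_ge0.
- by rewrite lee_fin invr_ge0 ltW.
rewrite -sqr_L2_dist -/e integral_cst// -EFinM expr2 mulKf//.
by rewrite EFinM leb_massE ge0_muleDl// mul1e [leRHS]addeC muleC.
Qed.

Lemma integrableM_coord u i h (B : R) : measurable_fun [set: RT] h ->
  (forall t, t \in `]a, b[ -> `|h t| <= B) ->
  (leb_on a b).-integrable setT (EFin \o (fun t => coord u i t * h t)).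
Proof.
move=> mh hB.
have m : measurable_fun setT (fun t : RT => coord u i t * h t).
  by apply: measurable_funM => //; exact: measurable_coord_L2.
apply/integrable_leb_on; first exact/measurable_EFinP.
apply: (@le_integrable _ _ _ lebesgue_measure _ _ _
  (fun t => B%:E * (coord u i t)%:E)%E) => //.
- by apply/measurable_EFinP; exact: measurable_funTS.
- move=> t /= tab; rewrite lee_fin !normrM mulrC ler_wpM2r//.
  by rewrite (le_trans (hB _ tab))// ler_norm.
by apply: integrableZl => //; exact: integrable_coord_itv.
Qed.

Lemma pairing_lipschitz u v i h (B : R) : measurable_fun [set: RT] h ->
  (forall t, t \in `]a, b[ -> `|h t| <= B) -> 0 <= B ->
  `|\int[leb_on a b]_t (coord u i t * h t) - \int[leb_on a b]_t (coord v i t * h t)|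
    <= B * leb_mass * L2_dist u v.
Proof.
move=> mh hB B0.
have iu := integrableM_coord u i mh hB; have iv := integrableM_coord v i mh hB.
rewrite -RintegralB//.
apply: (le_trans (le_normr_Rintegral measurableT (integrableB measurableT iu iv))).
have mD : measurable_fun setT (fun t : RT => coord u i t - coord v i t).
  by apply: measurable_funB; exact: measurable_coord_L2.
have hfin : (\int[leb_on a b]_t `|coord u i t * h t - coord v i t * h t|%:E <=
    (B * leb_mass * L2_dist u v)%:E)%E.
  rewrite -mulrA EFinM; apply: (le_trans _ (lee_pmul _ _ (lexx _) (L1_coord_le u v i))) => //.
    rewrite -ge0_integralZl//; last first.
      by apply/measurable_EFinP; exact: measurableT_comp.
    rewrite !ge0_integral_leb_on//.
    - apply: ge0_le_integral => //.
      + apply/measurable_EFinP; apply: measurable_funTS; apply: measurableT_comp => //.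
        by apply: measurable_funB; apply: measurable_funM => //; exact: measurable_coord_L2.
      + by apply: measurable_funTS; apply: measurable_funeM; apply/measurable_EFinP; exact: measurableT_comp.
      move=> t /= tab; rewrite -EFinM lee_fin -mulrBl normrM mulrC ler_wpM2r//.
      exact: hB.
    - by apply: measurable_funeM; apply/measurable_EFinP; exact: measurableT_comp.
    - by move=> t; rewrite -EFinM lee_fin mulr_ge0.
    - apply/measurable_EFinP; apply: measurableT_comp => //.
      by apply: measurable_funB; apply: measurable_funM => //; exact: measurable_coord_L2.
  by apply: integral_ge0.
rewrite -lee_fin /Rintegral fineK//.
by rewrite ge0_fin_numE ?integral_ge0// (le_lt_trans hfin)// ltry.
Qed.

Lemma lipschitz_continuous_L2 (K : R) (F : L2 a b d -> R) :
  (forall u v, `|F u - F v| <= K * L2_dist u v) -> continuous F.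
Proof.
move=> hF u.
apply/(@cvgrPdist_lt _ _ _ (nbhs (u : L2 a b d)) (nbhs_filter u)) => e e0.
have K1 : 0 < `|K| + 1 by rewrite ltr_wpDl.
apply/nbhs_ballP; exists (e / (`|K| + 1)); first by rewrite /= divr_gt0.
move=> v; rewrite /ball/= => uv.
apply: (le_lt_trans (hF u v)); rewrite mulrC.
apply: (@le_lt_trans _ _ (L2_dist u v * (`|K| + 1))).
  by rewrite ler_wpM2l ?L2_dist_ge0// (le_trans (ler_norm _))// lerDl.
by rewrite -ltr_pdivlMr.
Qed.

Lemma continuous_pairing i h (B : R) : measurable_fun [set: RT] h ->
  (forall t, t \in `]a, b[ -> `|h t| <= B) -> 0 <= B ->
  continuous (fun u : L2 a b d => \int[leb_on a b]_t (coord u i t * h t)).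
Proof.
move=> mh hB B0; apply: (@lipschitz_continuous_L2 (B * leb_mass)) => u v.
exact: pairing_lipschitz.
Qed.

End L2_metric.


Lemma limn_einf_le {R : realType} (u : (\bar R)^nat) (C : \bar R) :
  (forall n, u n <= C)%E -> (limn_einf u <= C)%E.
Proof.
move=> uC; rewrite limn_einf_lim; apply: lime_le; first exact: is_cvg_einfs.
apply: nearW => n; apply: le_trans (uC n); apply: ereal_inf_lbound.
by exists n => //=.
Qed.

Lemma summable_increments_cvg {R : realType} (x : R^nat) :
  (\sum_(0 <= n <oo) `|x n - x n.+1|%:E < +oo)%E -> cvgn x.
Proof.
move=> h.
have : cvgn (series (fun n => `|x n.+1 - x n|)).
  apply: nondecreasing_is_cvgn.
    by apply: nondecreasing_series => n _ _; exact: normr_ge0.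
  exists (fine (\sum_(0 <= n <oo) `|x n - x n.+1|%:E)%E) => _ [n _ <-].
  rewrite -lee_fin fineK; last first.
    by rewrite ge0_fin_numE//; apply: nneseries_ge0 => *; rewrite lee_fin.
  rewrite /series/= -sumEFin.
  under eq_bigr do rewrite distrC.
  by apply: nneseries_lim_ge => *; rewrite lee_fin.
move=> /normed_cvg h2.
rewrite (_ : x = (fun n => x 0 + series (fun n => x n.+1 - x n) n)).
  by apply: is_cvgD => //; exact: is_cvg_cst.
apply/funext => n; rewrite /series/=.
by rewrite telescope_sumr// addrC subrK.
Qed.

Lemma cvgn_sum {R : realType} (I : finType) (f : I -> nat -> R) (l : I -> R) :
  (forall i, f i n @[n --> \oo] --> l i) ->
  (\sum_i f i n) @[n --> \oo] --> \sum_i l i.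
Proof.
move=> fl; elim: (index_enum I) => [|i s IH].
  by rewrite big_nil; under eq_cvg do rewrite big_nil; exact: cvg_cst.
by rewrite big_cons; under eq_cvg do rewrite big_cons; exact: cvgD.
Qed.

(** * Completeness of L^2 *)

Section L2_complete.
Context {R : realType} (a b : R) (d : nat).
Local Notation RT := (measurableTypeR R).
Implicit Types (f g u v : L2 a b d) (h : R -> R).

Lemma L2_make (w : RT -> 'rV[R]_d) :
  (forall i, measurable_fun setT (fun t => w t 0 i)) ->
  (\int[leb_on a b]_t (enorm (w t) ^+ 2)%:E < +oo)%E ->
  exists u : L2 a b d, {ae leb_on a b, forall t : RT, L2_fun u t = w t}.
Proof.
move=> mw wfin.
pose W : {mfun RT >-> borel 'rV[R]_d} :=
  HB.pack (w : RT -> borel 'rV[R]_d)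
    (isMeasurableFun.Build _ _ _ _ (w : RT -> borel 'rV[R]_d) (measurable_row mw)).
have W2 : (L2_norm a b W < +oo)%E by rewrite L2_normE; apply: poweR_lty.
by exists (L2_class W2); exact: L2_classE.
Qed.

Lemma L2_dist_le_sum (g : nat -> L2 a b d) n p :
  L2_dist (g n) (g (n + p)%N) <= \sum_(n <= k < n + p) L2_dist (g k) (g k.+1).
Proof.
elim: p => [|p IH]; first by rewrite addn0 big_geq// L2_distxx.
rewrite addnS big_nat_recr ?leq_addr//=.
by rewrite (le_trans (L2_dist_triangle (g (n + p)%N) _ _))// lerD2r.
Qed.

Lemma sum_half_pow n p : \sum_(n <= k < n + p) (2^-1 : R) ^+ k <= 2 * 2^-1 ^+ n.
Proof.
suff : \sum_(n <= k < n + p) (2^-1 : R) ^+ k + 2 * 2^-1 ^+ (n + p) = 2 * 2^-1 ^+ n.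
  by move=> <-; rewrite lerDl mulr_ge0// exprn_ge0// invr_ge0.
elim: p => [|p IH]; first by rewrite addn0 big_geq// add0r.
rewrite addnS big_nat_recr ?leq_addr//= -IH exprS mulrA divff// mul1r.
by rewrite -addrA mulr_natl.
Qed.

(** The L^1 norms of the increments are summable, so the coordinates converge almost everywhere;
    Fatou's lemma applied to the distances from [g n] to later terms bounds the distance to the
    limit and shows that the limit is square integrable. *)
Lemma L2_fast_cauchy_cvg (g : nat -> L2 a b d) :
  (forall n, L2_dist (g n) (g n.+1) <= 2^-1 ^+ n) ->
  exists u, forall n, L2_dist (g n) u <= 2 * 2^-1 ^+ n.
Proof.
move=> gC.
have mabs n i : measurable_fun setT
    (fun t : RT => `|coord (g n) i t - coord (g n.+1) i t|%:E).
  apply/measurable_EFinP; apply: measurableT_comp => //.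
  by apply: measurable_funB; exact: measurable_coord_L2.
have cvg_ae i : {ae leb_on a b, forall t : RT, cvgn (fun n => coord (g n) i t)}.
  have S : (\int[leb_on a b]_t (\sum_(0 <= n <oo)
      `|coord (g n) i t - coord (g n.+1) i t|%:E) < +oo)%E.
    rewrite integral_nneseries//.
    apply: (@le_lt_trans _ _ (leb_mass a b * 2)%:E); last by rewrite ltry.
    apply: lime_le.
      by apply: is_cvg_nneseries => n _ _; exact: integral_ge0.
    apply: nearW => n /=.
    apply: (@le_trans _ _ (\sum_(0 <= k < n) (leb_mass a b * 2^-1 ^+ k)%:E)%E).
      apply: lee_sum => k _; apply: (le_trans (L1_coord_le _ _ _)).
      by rewrite lee_fin ler_wpM2l// (le_trans _ (leb_mass_ge1 _ _)).
    rewrite sumEFin lee_fin -mulr_sumr ler_wpM2l// ?(le_trans _ (leb_mass_ge1 _ _))//.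
    by have := sum_half_pow 0 n; rewrite add0n expr0 mulr1.
  have : (leb_on a b).-integrable setT (fun t : RT => \sum_(0 <= n <oo)
      `|coord (g n) i t - coord (g n.+1) i t|%:E)%E.
    apply/integrableP; split.
      by apply: ge0_emeasurable_sum; [move=> n t _ _; rewrite lee_fin|move=> n _; exact: mabs].
    under eq_integral do rewrite gee0_abs ?nneseries_ge0//.
    exact: S.
  move=> /integrable_ae -/(_ measurableT); apply: filterS => t /= /(_ I) fint.
  apply: summable_increments_cvg.
  by rewrite -ge0_fin_numE// nneseries_ge0.
(* The upper limit is defined and measurable everywhere, and equals the limit wherever the latter
   exists. *)
pose w (t : RT) : 'rV[R]_d := \row_i fine (limn_esup (fun n => (coord (g n) i t)%:E)).
have mw i : measurable_fun setT (fun t => w t 0 i).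
  rewrite (_ : (fun t => _) = fine \o (fun t => limn_esup (fun n => (coord (g n) i t)%:E))).
    apply: measurableT_comp => //; apply: measurable_fun_limn_esup => n.
    by apply/measurable_EFinP; exact: measurable_coord_L2.
  by apply/funext => t; rewrite /w mxE.
have cvg_w : {ae leb_on a b, forall t : RT, forall i,
    coord (g n) i t @[n --> \oo] --> w t 0 i}.
  apply: filter_forall => i; apply: filterS (cvg_ae i) => t h.
  rewrite /w mxE.
  have hE : (coord (g n) i t)%:E @[n --> \oo] --> (limn (fun n => coord (g n) i t))%:E.
    by apply: cvg_EFin; [exact: nearW|exact: h].
  by rewrite (cvg_limn_einf_sup hE).2 /=; exact: h.
have cvg_norm : {ae leb_on a b, forall t : RT, forall n,
    (enorm (L2_fun (g n) t - L2_fun (g (n + p)%N) t) ^+ 2) @[p --> \oo] -->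
    (enorm (L2_fun (g n) t - w t) ^+ 2)}.
  apply: filterS cvg_w => t h n; rewrite enorm_sqr.
  under eq_cvg do rewrite enorm_sqr.
  apply: cvgn_sum => i.
  have c : coord (g n) i t - coord (g (n + p)%N) i t @[p --> \oo] -->
      coord (g n) i t - w t 0 i.
    apply: cvgB; first exact: cvg_cst.
    have := h i; rewrite -(cvg_shiftn n) /=.
    by under [X in X -> _]eq_cvg do rewrite addnC.
  have -> : (L2_fun (g n) t - w t) 0 i = coord (g n) i t - w t 0 i.
    by rewrite [LHS]mxE [X in _ + X]mxE.
  under eq_cvg => p.
    rewrite (_ : (L2_fun (g n) t - L2_fun (g (n + p)%N) t) 0 i =
      coord (g n) i t - coord (g (n + p)%N) i t); last by rewrite !mxE.
    over.
  exact: (cvgM c c).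
have mN n (w' : RT -> 'rV[R]_d) : (forall i, measurable_fun setT (fun t => w' t 0 i)) ->
    measurable_fun setT (fun t : RT => (enorm (L2_fun (g n) t - w' t) ^+ 2)%:E).
  move=> mw'; apply: measurable_enorm_sqr => i.
  rewrite (_ : (fun t => _) = (fun t => coord (g n) i t - w' t 0 i)).
    by apply: measurable_funB => //; exact: measurable_coord_L2.
  by apply/funext => t; rewrite !mxE.
have fat n : (\int[leb_on a b]_t (enorm (L2_fun (g n) t - w t) ^+ 2)%:E <=
    ((2 * 2^-1 ^+ n) ^+ 2)%:E)%E.
  apply: (@le_trans _ _ (\int[leb_on a b]_t
      limn_einf (fun p => (enorm (L2_fun (g n) t - L2_fun (g (n + p)%N) t) ^+ 2)%:E))%E).
    rewrite le_eqVlt; apply/orP; left; apply/eqP.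
    apply: ae_eq_integral => //.
    - exact: mN.
    - rewrite /limn_einf; apply: measurableT_comp => //.
      apply: measurable_fun_limn_esup => p; apply: measurableT_comp => //.
      by apply: mN => i; exact: measurable_coord_L2.
    apply: filterS cvg_norm => t /(_ n) h _.
    apply/esym; refine (cvg_limn_einf_sup _).1.
    by apply: cvg_EFin; [exact: nearW|exact: h].
  apply: (le_trans (fatou _ _ _ _)) => //.
  - by move=> p; apply: mN => i; exact: measurable_coord_L2.
  - by move=> p t _; rewrite lee_fin sqr_ge0.
  apply: limn_einf_le => p.
  rewrite -sqr_L2_dist lee_fin ler_sqr ?nnegrE ?L2_dist_ge0//.
  apply: (le_trans (L2_dist_le_sum _ _ _)).
  by apply: le_trans (sum_half_pow n p); apply: ler_sum => k _.
have [u uw] : exists u : L2 a b d, {ae leb_on a b, forall t : RT, L2_fun u t = w t}.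
  apply: L2_make => //.
  apply: (@le_lt_trans _ _ (\int[leb_on a b]_t
    (2%:E * (enorm (L2_fun (g 0) t - w t) ^+ 2)%:E
     + 2%:E * (enorm (L2_fun (g 0) t) ^+ 2)%:E))%E).
    apply: ge0_le_integral => //.
    - by move=> t _; rewrite lee_fin sqr_ge0.
    - exact: measurable_enorm_sqr.
    - apply: emeasurable_funD; apply: measurable_funeM; first exact: mN.
      by apply: measurable_enorm_sqr => i; exact: measurable_coord_L2.
    move=> t _; rewrite -!EFinM -EFinD lee_fin.
    have : enorm (w t) <= enorm (L2_fun (g 0) t - w t) + enorm (L2_fun (g 0) t).
      rewrite -(enormN (L2_fun (g 0) t - w t)) -[X in enorm X <= _](subrK (L2_fun (g 0) t)).
      by rewrite (le_trans (enormD _ _))// opprB.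
    have := enorm_ge0 (w t); have := enorm_ge0 (L2_fun (g 0) t).
    have := enorm_ge0 (L2_fun (g 0) t - w t).
    set x := enorm _; set y := enorm _; set z := enorm _ => x0 y0 z0 zxy.
    have : 0 <= (x - y) ^+ 2 by exact: sqr_ge0.
    nra.
  rewrite ge0_integralD//; last 4 first.
  - by move=> t _; rewrite -EFinM lee_fin mulr_ge0// sqr_ge0.
  - by apply: measurable_funeM; exact: mN.
  - by move=> t _; rewrite -EFinM lee_fin mulr_ge0// sqr_ge0.
  - apply: measurable_funeM; apply: measurable_enorm_sqr => i; exact: measurable_coord_L2.
  have Z (F : RT -> R) : measurable_fun setT (fun t => (F t)%:E) ->
      (forall t, 0 <= F t) ->
      (\int[leb_on a b]_t (2%:E * (F t)%:E) = 2%:E * \int[leb_on a b]_t (F t)%:E)%E.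
    by move=> mF F0; apply: ge0_integralZl => // *; rewrite lee_fin.
  rewrite [X in (X + _)%E]Z; last 2 first.
  - exact: mN.
  - by move=> t; exact: sqr_ge0.
  rewrite [X in (_ + X)%E]Z; last 2 first.
  - by apply: measurable_enorm_sqr => i; exact: measurable_coord_L2.
  - by move=> t; exact: sqr_ge0.
  have two_lt (x : \bar R) : (x < +oo)%E -> (2%:E * x < +oo)%E.
    by move=> xoo; apply: lte_mul_pinfty.
  apply: lte_add_pinfty; apply: two_lt; last exact: L2_sqr_lty.
  by rewrite (le_lt_trans (fat 0))// ltry.
exists u => n.
rewrite -(@ler_pXn2r _ 2)// ?nnegrE ?L2_dist_ge0 ?mulr_ge0 ?exprn_ge0 ?invr_ge0//.
rewrite -lee_fin sqr_L2_dist; apply: le_trans (fat n).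
rewrite le_eqVlt; apply/orP; left; apply/eqP.
apply: ae_eq_integral => //.
- by apply: mN => i; exact: measurable_coord_L2.
- exact: mN.
by apply: filterS uw => t -> _.
Qed.

End L2_complete.


Lemma ge0_integral_lin d (T : measurableType d) (R : realType)
    (nu : {measure set T -> \bar R}) (D : set T) (k l : R) (F G : T -> R) :
  measurable D -> measurable_fun D F -> measurable_fun D G ->
  (forall t, 0 <= F t) -> (forall t, 0 <= G t) -> 0 <= k -> 0 <= l ->
  (\int[nu]_(t in D) (k * F t + l * G t)%:E =
   k%:E * \int[nu]_(t in D) (F t)%:E + l%:E * \int[nu]_(t in D) (G t)%:E)%E.
Proof.
move=> mD mF mG F0 G0 k0 l0.
have m c (H : T -> R) : measurable_fun D H -> measurable_fun D (fun t => (c * H t)%:E).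
  by move=> mH; apply/measurable_EFinP; exact: measurable_funM.
have Z c (H : T -> R) : 0 <= c -> measurable_fun D H -> (forall t, 0 <= H t) ->
    (\int[nu]_(t in D) (c * H t)%:E = c%:E * \int[nu]_(t in D) (H t)%:E)%E.
  move=> c0 mH H0; rewrite -ge0_integralZl//; last by move=> t _; rewrite lee_fin.
  exact/measurable_EFinP.
rewrite -(Z k F)// -(Z l G)// -ge0_integralD//; try exact: m.
- by move=> t _; rewrite lee_fin mulr_ge0.
- by move=> t _; rewrite lee_fin mulr_ge0.
Qed.

(** * Lower semicontinuity of the energy *)

Section energy.
Context {R : realType} (a b : R) (d : nat) (ab : a < b).
Local Notation RT := (measurableTypeR R).
Implicit Types (f g u v w h : L2 a b d).

Lemma continuous_bounded_itv (phi : R -> R) : continuous phi ->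
  exists2 B, 0 <= B & forall t, t \in `]a, b[ -> `|phi t| <= B.
Proof.
move=> cphi.
have : compact (phi @` `[a, b]%classic).
  apply: continuous_compact; last exact: segment_compact.
  by apply: continuous_subspaceT.
move=> /compact_bounded [M [_ hM]].
exists (`|M| + 1); first by rewrite addr_ge0.
move=> t tab; apply: (hM (`|M| + 1)); first by rewrite (le_lt_trans (ler_norm _))// ltrDl.
by exists t => //; move: tab; apply: subset_itv_oo_cc.
Qed.

Lemma test_function_bounded phi : test_function a b phi -> exists B, [/\ 0 <= B,
  measurable_fun [set: RT] phi, measurable_fun [set: RT] (derive1 phi),
  forall t, t \in `]a, b[ -> `|phi t| <= B &
  forall t, t \in `]a, b[ -> `|derive1 phi t| <= B].
Proof.
move=> [sphi _].
have c0 : continuous phi.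
  by move=> t; apply: differentiable_continuous; apply/derivable1_diffP; exact: (sphi 0).
have c1 : continuous (derive1 phi).
  move=> t; apply: differentiable_continuous; apply/derivable1_diffP.
  exact: (sphi 1%N).
have [B0 B00 hB0] := continuous_bounded_itv c0.
have [B1 B10 hB1] := continuous_bounded_itv c1.
exists (B0 + B1); split.
- exact: addr_ge0.
- by apply: continuous_measurable_fun.
- by apply: continuous_measurable_fun.
- by move=> t /hB0/le_trans; apply; rewrite lerDl.
- by move=> t /hB1/le_trans; apply; rewrite lerDr.
Qed.

(** Both sides of the defining identity are Lipschitz in L^2 for a fixed test function, so each
    costs at most K [e n]. *)
Lemma weak_derivative_closed f g (fs gs : nat -> L2 a b d) (e : nat -> R) :
  (forall n, weak_derivative (fs n) (gs n)) ->
  (forall n, L2_dist (fs n) f <= e n) -> (forall n, L2_dist (gs n) g <= e n) ->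
  e n @[n --> \oo] --> (0 : R) -> weak_derivative f g.
Proof.
move=> wd hf hg e0 phi tphi i.
have [B [B0 m0 m1 b0 b1]] := test_function_bounded tphi.
pose K := B * leb_mass a b.
have K0 : 0 <= K by rewrite mulr_ge0// (le_trans _ (leb_mass_ge1 _ _)).
apply/eqP; rewrite -subr_eq0 -normr_le0; apply/ler_addgt0Pr => r r0.
rewrite add0r.
have [n _ hn] : \forall n \near \oo, `|0 - e n| < r / (2 * K + 1).
  by move/cvgrPdist_lt : e0; apply; rewrite divr_gt0// ltr_wpDl// mulr_ge0.
have {}hn := hn n (leqnn n).
have F := pairing_lipschitz (fs n) f i m1 b1 B0.
have G := pairing_lipschitz (gs n) g i m0 b0 B0.
have W : \int[leb_on a b]_t (coord (fs n) i t * derive1 phi t) =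
  - \int[leb_on a b]_t (coord (gs n) i t * phi t) := wd n phi tphi i.
rewrite -/K in F G; change (`|\int[leb_on a b]_t (coord f i t * derive1 phi t) -
  - \int[leb_on a b]_t (coord g i t * phi t)| <= r).
rewrite W in F.
set F1 := \int[leb_on a b]_t (coord f i t * derive1 phi t) in F *.
set G1 := \int[leb_on a b]_t (coord g i t * phi t) in G *.
have {}F := le_trans F (ler_wpM2l K0 (hf n)).
have {}G := le_trans G (ler_wpM2l K0 (hg n)).
have en : e n < r / (2 * K + 1) by apply: le_lt_trans hn; rewrite sub0r normrN ler_norm.
rewrite ltr_pdivlMr in en; last by rewrite ltr_wpDl// mulr_ge0.
have e_ge0 : 0 <= e n by apply: le_trans (hf n); exact: L2_dist_ge0.
move: F G; rewrite !ler_norml => /andP[F F'] /andP[G G'].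
by apply/andP; split; lra.
Qed.

Definition sqn g : R := fine (\int[leb_on a b]_t (enorm (L2_fun g t) ^+ 2)%:E)%E.

Lemma sqnE g : (sqn g)%:E = (\int[leb_on a b]_t (enorm (L2_fun g t) ^+ 2)%:E)%E.
Proof.
rewrite fineK// ge0_fin_numE ?L2_sqr_lty//.
by apply: integral_ge0 => t _; rewrite lee_fin sqr_ge0.
Qed.

Lemma sqn_ge0 g : 0 <= sqn g.
Proof. by rewrite -lee_fin sqnE integral_ge0// => t _; rewrite lee_fin sqr_ge0. Qed.

Lemma measurable_sqr_L2 g :
  measurable_fun setT (fun t : RT => (enorm (L2_fun g t) ^+ 2)%:E).
Proof. by apply: measurable_enorm_sqr => i; exact: measurable_coord_L2. Qed.

Lemma sqn_L2_dist0 g : sqn g = L2_dist g (L2_0 a b d) ^+ 2.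
Proof.
apply: EFin_inj; rewrite sqnE sqr_L2_dist; apply: ae_eq_integral => //.
- exact: measurable_sqr_L2.
- exact: measurable_sqr_L2_sub.
apply: filterS (L2_classE (L2_norm0 a b d)) => t h _.
by rewrite /L2_0 h subr0.
Qed.

Lemma energyE f g : weak_derivative f g -> energy f = (sqn g)%:E.
Proof.
move=> fg; rewrite /energy ifT; last by apply/asboolP; exists g.
rewrite (wderivP ab fg) sqr_L2_norm ?sqnE//.
by apply: integral_ge0 => t _; rewrite lee_fin sqr_ge0.
Qed.

Lemma energy_leP f (M : R) : (energy f <= M%:E)%E <->
  exists2 g, weak_derivative f g & sqn g <= M.
Proof.
split=> [fM|[g fg gM]]; last by rewrite (energyE fg) lee_fin.
have [[g fg]|nW] := pselect (W12 f).
  by exists g => //; rewrite -lee_fin -(energyE fg).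
by move: fM; rewrite /energy ifF ?leye_eq//; apply/asboolP.
Qed.

Lemma L2_mid u v : exists w : L2 a b d, {ae leb_on a b, forall t : RT,
  L2_fun w t = 2^-1 *: (L2_fun u t + L2_fun v t)}.
Proof.
have m i : measurable_fun setT (fun t : RT => (2^-1 *: (L2_fun u t + L2_fun v t)) 0 i).
  rewrite (_ : (fun t => _) = (fun t => 2^-1 * (coord u i t + coord v i t))).
    by apply: measurable_funM => //; apply: measurable_funD; exact: measurable_coord_L2.
  by apply/funext => t; rewrite !mxE.
apply: L2_make => //.
apply: (@le_lt_trans _ _ (\int[leb_on a b]_t
  ((enorm (L2_fun u t) ^+ 2)%:E + (enorm (L2_fun v t) ^+ 2)%:E))%E).
  apply: ge0_le_integral => //.
  - by move=> t _; rewrite lee_fin sqr_ge0.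
  - exact: measurable_enorm_sqr.
  - by apply: emeasurable_funD; exact: measurable_sqr_L2.
  move=> t _; rewrite -EFinD lee_fin !enorm_sqr -big_split/=.
  apply: ler_sum => i _; rewrite !mxE.
  set x := L2_fun u t 0 i; set y := L2_fun v t 0 i.
  have : 0 <= (x - y) ^+ 2 by exact: sqr_ge0.
  have : 0 <= x ^+ 2 by exact: sqr_ge0.
  have : 0 <= y ^+ 2 by exact: sqr_ge0.
  nra.
rewrite ge0_integralD//; last 4 first.
- by move=> t _; rewrite lee_fin sqr_ge0.
- exact: measurable_sqr_L2.
- by move=> t _; rewrite lee_fin sqr_ge0.
- exact: measurable_sqr_L2.
by apply: lte_add_pinfty; exact: L2_sqr_lty.
Qed.

Lemma pairing_mid u v w i (phi : R -> R) (B : R) : measurable_fun [set: RT] phi ->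
  (forall t, t \in `]a, b[ -> `|phi t| <= B) ->
  {ae leb_on a b, forall t : RT, L2_fun w t = 2^-1 *: (L2_fun u t + L2_fun v t)} ->
  \int[leb_on a b]_t (coord w i t * phi t) = 2^-1 *
  (\int[leb_on a b]_t (coord u i t * phi t) + \int[leb_on a b]_t (coord v i t * phi t)).
Proof.
move=> mphi bphi hw.
have iu := integrableM_coord u i mphi bphi.
have iv := integrableM_coord v i mphi bphi.
have iuv := integrableD measurableT iu iv.
rewrite -RintegralD// -RintegralZl//.
congr fine; apply: ae_eq_integral => //.
- by apply/measurable_EFinP; apply: measurable_funM => //; exact: measurable_coord_L2.
- apply/measurable_EFinP; apply: measurable_funM => //; apply: measurable_funD;
    by apply: measurable_funM => //; exact: measurable_coord_L2.
apply: filterS hw => t ht _; congr EFin.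
by rewrite /coord ht !mxE -mulrA mulrDl.
Qed.

Lemma weak_derivative_mid f1 f2 g1 g2 : weak_derivative f1 g1 -> weak_derivative f2 g2 ->
  exists f g, [/\ weak_derivative f g,
    {ae leb_on a b, forall t : RT, L2_fun f t = 2^-1 *: (L2_fun f1 t + L2_fun f2 t)} &
    {ae leb_on a b, forall t : RT, L2_fun g t = 2^-1 *: (L2_fun g1 t + L2_fun g2 t)}].
Proof.
move=> w1 w2; have [f hf] := L2_mid f1 f2; have [g hg] := L2_mid g1 g2.
exists f, g; split => // phi tphi i.
have [B [B0 m0 m1 b0 b1]] := test_function_bounded tphi.
have F := pairing_mid i m1 b1 hf; have G := pairing_mid i m0 b0 hg.
rewrite [LHS]F [X in - X]G -mulrN opprD; congr (_ * (_ + _)).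
  exact: w1.
exact: w2.
Qed.

(** The idle factor [1] puts both sides in the shape k F + l G of [ge0_integral_lin], so the
    identity reduces to a pointwise one. *)
Lemma parallelogram g1 g2 g :
  {ae leb_on a b, forall t : RT, L2_fun g t = 2^-1 *: (L2_fun g1 t + L2_fun g2 t)} ->
  1 * L2_dist g1 g2 ^+ 2 + 4 * sqn g = 2 * sqn g1 + 2 * sqn g2.
Proof.
move=> hg; apply: EFin_inj.
have E (k l x y : R) (X Y : \bar R) : x%:E = X -> y%:E = Y ->
  (k * x + l * y)%:E = (k%:E * X + l%:E * Y)%E by move=> <- <-.
rewrite (E _ _ _ _ _ _ (sqr_L2_dist g1 g2) (sqnE g)).
rewrite (E _ _ _ _ _ _ (sqnE g1) (sqnE g2)).
have m1 := measurable_sqr_L2 g1; have m2 := measurable_sqr_L2 g2.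
have m := measurable_sqr_L2 g; have m12 := measurable_sqr_L2_sub g1 g2.
move/measurable_EFinP in m1; move/measurable_EFinP in m2.
move/measurable_EFinP in m; move/measurable_EFinP in m12.
have p (w : RT -> 'rV[R]_d) t : 0 <= enorm (w t) ^+ 2 by exact: sqr_ge0.
rewrite -(ge0_integral_lin _ measurableT m12 m (p _) (p _))//.
rewrite -(ge0_integral_lin _ measurableT m1 m2 (p _) (p _))//.
apply: ae_eq_integral => //.
- by apply/measurable_EFinP; apply: measurable_funD; apply: measurable_funM.
- by apply/measurable_EFinP; apply: measurable_funD; apply: measurable_funM.
apply: filterS hg => t ht _; rewrite ht; congr EFin.
rewrite !enorm_sqr !mulr_sumr -!big_split/=; apply: eq_bigr => i _.
by rewrite !mxE; field.
Qed.

Lemma L2_dist_mid f f1 f2 fm :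
  {ae leb_on a b, forall t : RT, L2_fun fm t = 2^-1 *: (L2_fun f1 t + L2_fun f2 t)} ->
  L2_dist f fm ^+ 2 <= 2^-1 * L2_dist f f1 ^+ 2 + 2^-1 * L2_dist f f2 ^+ 2.
Proof.
move=> hm; rewrite -lee_fin EFinD (EFinM _ (L2_dist f f1 ^+ 2)) (EFinM _ (L2_dist f f2 ^+ 2)).
rewrite !sqr_L2_dist.
have m1 := measurable_sqr_L2_sub f f1; have m2 := measurable_sqr_L2_sub f f2.
move/measurable_EFinP in m1; move/measurable_EFinP in m2.
have p (w : RT -> 'rV[R]_d) t : 0 <= enorm (w t) ^+ 2 by exact: sqr_ge0.
have h0 : 0 <= 2^-1 :> R by rewrite invr_ge0.
rewrite -(ge0_integral_lin _ measurableT m1 m2 (p _) (p _) h0 h0).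
have mfm := measurable_sqr_L2_sub f fm.
apply: ae_ge0_le_integral => //.
- by move=> t _; rewrite lee_fin sqr_ge0.
- by move=> t _; rewrite lee_fin addr_ge0// mulr_ge0// sqr_ge0.
- by apply/measurable_EFinP; apply: measurable_funD; apply: measurable_funM.
apply: filterS hm => t ht _; rewrite lee_fin ht !enorm_sqr !mulr_sumr -big_split/=.
apply: ler_sum => i _; rewrite !mxE.
set x := L2_fun f t 0 i; set y := L2_fun f1 t 0 i; set z := L2_fun f2 t 0 i.
by have : 0 <= (y - z) ^+ 2 by [exact: sqr_ge0]; nra.
Qed.

Lemma natSinv_half n : 2^-1 ^+ n <= 1 :> R.
Proof. by rewrite exprn_ile1// ?invr_ge0// invf_le1// ler1n. Qed.

Lemma cvg_half_pow (k : R) : k * 2^-1 ^+ n @[n --> \oo] --> (0 : R).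
Proof.
rewrite -[X in _ --> X](mulr0 k); apply: cvgMr.
by apply: cvg_expr; rewrite ger0_norm ?invr_ge0// invf_lt1// ltr1n.
Qed.

(** A substitute for weak compactness. Let m be the least level such that f is a limit of functions
    of energy at most about m. Near-minimisers close to f have midpoints that are also close to f,
    hence of energy not much below m; the parallelogram identity then makes their derivatives a
    Cauchy sequence, and its limit is the weak derivative of f by closedness. *)
Lemma energy_le_closure f (M : R) :
  (forall e : R, 0 < e -> exists h, L2_dist f h <= e /\ (energy h <= M%:E)%E) ->
  (energy f <= M%:E)%E.
Proof.
move=> hf.
pose S := [set r : R | forall e : R, 0 < e -> exists h g,
  [/\ weak_derivative h g, L2_dist f h <= e & sqn g <= r]].
have SM : S M.
  move=> e e0; have [h [fh /energy_leP [g hg gM]]] := hf e e0.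
  by exists h, g.
have M0 : 0 <= M.
  by have [h [g [_ _ gM]]] := SM 1 ltr01; exact: le_trans (sqn_ge0 g) gM.
have S_lb : lbound S 0.
  by move=> r /(_ 1 ltr01) [h [g [_ _ gr]]]; exact: le_trans (sqn_ge0 g) gr.
have hinf : has_inf S by split; [exists M|exists 0].
pose m := inf S.
have mM : m <= M by apply: ge_inf => //; exists 0.
(* The parallelogram identity bounds the squared distance of successive derivatives by 2 (m + eta) +
   2 (m + eta) - 4 (m - eta) = 8 eta, which is to be 4^-k. *)
pose eta k : R := (2^-1 ^+ k) ^+ 2 / 8.
have half_gt0 k : 0 < 2^-1 ^+ k :> R by rewrite exprn_gt0// invr_gt0.
have eta0 k : 0 < eta k by rewrite divr_gt0// exprn_gt0.
have upS k : S (m + eta k).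
  have [r Sr rm] := inf_adherent (eta0 k) hinf.
  move=> e e0; have [h [g [hg fh gr]]] := Sr e e0; exists h, g; split => //.
  by rewrite (le_trans gr)// ltW.
(* Otherwise m - eta would belong to S, against the choice of m as its infimum. *)
have dn k : exists2 e : R, 0 < e & forall h g, weak_derivative h g ->
    L2_dist f h <= e -> m - eta k < sqn g.
  apply: contrapT => nS.
  have /(ge_inf hinf.2) : S (m - eta k).
    move=> e e0; apply: contrapT => nh; apply: nS; exists e => // h g hg fh.
    by rewrite ltNge; apply/negP => gm; apply: nh; exists h, g.
  by rewrite -/m; have := eta0 k; lra.
pose e k := projT1 (cid2 (dn k)).
have e0 k : 0 < e k by rewrite /e; case: cid2.
have eP k h g : weak_derivative h g -> L2_dist f h <= e k -> m - eta k < sqn g.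
  by rewrite /e; case: cid2 => x /= _; apply.
have ex k : exists hg : L2 a b d * L2 a b d, [/\ weak_derivative hg.1 hg.2,
    L2_dist f hg.1 <= e k, L2_dist f hg.1 <= 2^-1 ^+ k & sqn hg.2 <= m + eta k].
  have [|h [g [hg fh gm]]] := upS k (Num.min (e k) (2^-1 ^+ k)).
    by rewrite lt_min e0 half_gt0.
  exists (h, g); split => //.
    by rewrite (le_trans fh)// ge_min lexx.
  by rewrite (le_trans fh)// ge_min lexx orbT.
pose hs k := (projT1 (cid (ex k))).1; pose gs k := (projT1 (cid (ex k))).2.
have [wd he hh gm] : [/\ forall k, weak_derivative (hs k) (gs k),
    forall k, L2_dist f (hs k) <= e k, forall k, L2_dist f (hs k) <= 2^-1 ^+ k &
    forall k, sqn (gs k) <= m + eta k].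
  by split => k; rewrite /hs /gs; case: cid => -[h g] [].
have etaS k : eta k.+1 <= eta k.
  rewrite /eta ler_pM2r ?invr_gt0// ler_sqr ?nnegrE; [|exact: ltW|exact: ltW].
  by rewrite exprS ler_piMl; [|exact: ltW|rewrite invf_le1// ler1n].
have gC k : L2_dist (gs k) (gs k.+1) <= 2^-1 ^+ k.
  have [fm [g [wm hfm hgm]]] := weak_derivative_mid (wd k) (wd k.+1).
  have pl := parallelogram hgm.
  have low : m - eta k < sqn g.
    have dm := L2_dist_mid f hfm.
    have d0 := L2_dist_ge0 f fm; have d1 := L2_dist_ge0 f (hs k).
    have d2 := L2_dist_ge0 f (hs k.+1).
    (* The midpoint is no farther from f than the farther of the two functions. Which one that is
       decides whether the radius [e k] or [e k.+1] applies; the latter even gives the better level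
       m - [eta k.+1]. *)
    have [le21|/ltW le12] := leP (L2_dist f (hs k.+1)) (L2_dist f (hs k)).
      apply: (eP k _ _ wm); apply: le_trans (he k).
      rewrite -(@ler_pXn2r _ 2)// ?nnegrE//.
      have : L2_dist f (hs k.+1) ^+ 2 <= L2_dist f (hs k) ^+ 2 by rewrite ler_sqr ?nnegrE.
      by move: dm; clear; lra.
    apply: (@le_lt_trans _ _ (m - eta k.+1)); first by have := etaS k; clear; lra.
    apply: (eP k.+1 _ _ wm); apply: le_trans (he k.+1).
    rewrite -(@ler_pXn2r _ 2)// ?nnegrE//.
    have : L2_dist f (hs k) ^+ 2 <= L2_dist f (hs k.+1) ^+ 2 by rewrite ler_sqr ?nnegrE.
    by move: dm; clear; lra.
  rewrite -(@ler_pXn2r _ 2)// ?nnegrE ?L2_dist_ge0 ?(ltW (half_gt0 k))//.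
  have -> : (2^-1 ^+ k) ^+ 2 = 8 * eta k by rewrite /eta mulrC divfK// pnatr_eq0.
  move: (gm k) (gm k.+1) (etaS k) pl low; rewrite mul1r.
  move: (eta k) (eta k.+1) (sqn (gs k)) (sqn (gs k.+1)) (sqn g) (L2_dist _ _ ^+ 2).
  by clear; move=> *; lra.
have [u hu] := L2_fast_cauchy_cvg gC.
have wdu : weak_derivative f u.
  apply: (@weak_derivative_closed f u hs gs (fun k => 2 * 2^-1 ^+ k) wd) => //.
  - move=> k; rewrite L2_dist_sym (le_trans (hh k))//.
    by rewrite ler_peMl ?ltW// ltr1n.
  - exact: cvg_half_pow.
apply/energy_leP; exists u => //.
have sM0 := sqrtr_ge0 M; have sM : Num.sqrt M ^+ 2 = M by rewrite sqr_sqrtr.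
rewrite sqn_L2_dist0 -[leRHS]sM ler_sqr ?nnegrE ?L2_dist_ge0//.
apply/ler_addgt0Pr => r r0.
have [k _ hk] : \forall k \near \oo, `|0 - 3 * 2^-1 ^+ k| < r.
  by move/cvgrPdist_lt : (@cvg_half_pow 3); apply.
have {}hk := hk k (leqnn k).
rewrite sub0r normrN ger0_norm ?mulr_ge0 ?ltW// in hk.
have tri := L2_dist_triangle (gs k) u (L2_0 a b d).
rewrite (L2_dist_sym u (gs k)) in tri.
have nk : L2_dist (gs k) (L2_0 a b d) <= Num.sqrt M + 2^-1 ^+ k.
  have sMk : 0 <= Num.sqrt M + 2^-1 ^+ k by rewrite addr_ge0// ltW.
  rewrite -(@ler_pXn2r _ 2)// ?nnegrE ?L2_dist_ge0//.
  rewrite -sqn_L2_dist0 (le_trans (gm k))// sqrrD sM /eta.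
  have : 0 <= Num.sqrt M * 2^-1 ^+ k by rewrite mulr_ge0// ltW.
  have : 0 <= (2^-1 ^+ k) ^+ 2 :> R by exact: sqr_ge0.
  move: mM; rewrite mulr2n; move: (_ * _) ((_ ^+ k) ^+ 2).
  by clear; move=> *; lra.
move: (hu k) tri nk hk; move: (2^-1 ^+ k) (Num.sqrt M).
by move: (L2_dist _ _) (L2_dist _ _) (L2_dist _ _); clear; move=> *; lra.
Qed.

Lemma closed_energy_le (M : R) : closed [set f : L2 a b d | (energy f <= M%:E)%E].
Proof.
move=> f /= clf; apply: energy_le_closure => e e0.
have /clf [h [/= hM fh]] : nbhs f (ball f e).
  by apply/nbhs_ballP; exists e.
by exists h; split => //; exact: ltW.
Qed.

(** Sublevel sets are closed in L^2, so the energy is lower semicontinuous and therefore Borel,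
    although its definition goes through [get]. *)
Lemma measurable_energy :
  measurable_fun setT (fun f : borel (L2 a b d) => energy f).
Proof.
apply: (@measurability _ _ (borel (L2 a b d)) (\bar R) setT _ _ (ErealGenOInfty.measurableE R)).
move=> _ [_ [r ->] <-]; rewrite setTI.
rewrite (_ : _ @^-1` _ = ~` [set f : L2 a b d | (energy f <= r%:E)%E]).
  by apply: sub_sigma_algebra; apply: closed_openC; exact: closed_energy_le.
apply/seteqP; split => f /=; rewrite in_itv/= andbT ltNge.
  by move/negP.
by move=> /negP.
Qed.

End energy.


(** * Conditional expectations given by a disintegration *)

Section disintegration_integral.
Context d1 d2 (X : measurableType d1) (Y : measurableType d2) (R : realType).
Variables (eta : probability X R) (om : R.-pker Y ~> X) (p : X -> Y).
Hypothesis mp : measurable_fun setT p.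
Hypothesis etaE : forall A, measurable A -> eta A = (\int[eta]_x om (p x) A)%E.
Hypothesis conc : {ae eta, forall x, om (p x) (~` (p @^-1` [set p x])) = 0}.
Hypothesis mset1 : forall y : Y, measurable [set y].

(** The dummy coordinate in [unit] makes this composable by [kcomp] with [eta] seen as a kernel from
    [unit]; the composition is [eta] again, and [integral_kcomp] becomes the tower property. *)
Definition fiber_kernel (z : unit * X) : {measure set X -> \bar R} := om (p z.2).

Let measurable_fiber_kernel U : measurable U ->
  measurable_fun [set: unit * X] (fiber_kernel ^~ U).
Proof.
move=> mU; apply: (measurableT_comp (measurable_kernel om U mU)).
exact: measurableT_comp.
Qed.

HB.instance Definition _ := isKernel.Build _ _ _ _ R fiber_kernel
  measurable_fiber_kernel.

Let fiber_kernel_prob z : fiber_kernel z setT = 1%E.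
Proof. exact: prob_kernel. Qed.

HB.instance Definition _ := Kernel_isProbability.Build _ _ _ _ R fiber_kernel
  fiber_kernel_prob.

Lemma ge0_integral_disintegration (h : X -> \bar R) :
  (forall x, 0 <= h x)%E -> measurable_fun setT h ->
  (\int[eta]_x h x = \int[eta]_x \int[om (p x)]_x' h x')%E.
Proof.
move=> h0 mh.
have ml : measurable_fun [set: unit] (cst eta : unit -> pprobability X R).
  exact: measurable_cst.
pose l := kprobability ml.
rewrite (@eq_measure_integral _ _ _ _ (kcomp l fiber_kernel tt)).
  by rewrite integral_kcomp.
by move=> A mA _; exact: etaE.
Qed.

Definition cond_expect (w : X -> \bar R) (y : Y) : \bar R := (\int[om y]_x w x)%E.

Lemma measurable_cond_expect w : (forall x, 0 <= w x)%E -> measurable_fun setT w ->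
  measurable_fun setT (cond_expect w).
Proof.
move=> w0 mw; apply: measurable_fun_integral_kernel => // U mU.
exact: measurable_kernel.
Qed.

(** Since [om (p x)] is concentrated on the fibre of [p x], the factor F (p x') is almost surely the
    constant F (p x) under it and can be taken out of the inner integral. *)
Lemma ge0_cond_expectP (F : Y -> R) (w : X -> \bar R) :
  measurable_fun setT F -> (forall y, 0 <= F y) ->
  measurable_fun setT w -> (forall x, 0 <= w x)%E ->
  (\int[eta]_x ((F (p x))%:E * cond_expect w (p x)) = \int[eta]_x ((F (p x))%:E * w x))%E.
Proof.
move=> mF F0 mw w0.
have mFp : measurable_fun setT (fun x => (F (p x))%:E).
  by apply/measurable_EFinP; exact: measurableT_comp mF mp.
rewrite [RHS]ge0_integral_disintegration; last 2 first.
- by move=> x; rewrite mule_ge0// lee_fin.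
- exact: emeasurable_funM.
apply: ae_eq_integral => //.
- apply: emeasurable_funM => //.
  by apply: measurableT_comp mp; exact: measurable_cond_expect.
- apply: (@measurableT_comp _ _ _ _ _ _
    (cond_expect (fun x' => (F (p x'))%:E * w x')%E) _ p) => //.
  apply: measurable_cond_expect => [x|]; first by rewrite mule_ge0// lee_fin.
  exact: emeasurable_funM.
apply: filterS conc => x cx _; rewrite /cond_expect -ge0_integralZl//; last first.
  by rewrite lee_fin.
apply: ae_eq_integral => //.
- exact: measurable_funeM.
- exact: emeasurable_funM.
exists (~` (p @^-1` [set p x])); split => //.
  by apply: measurableC; rewrite -[X in measurable X]setTI; exact: mp.
by move=> x' /= nE px'; apply: nE => _; rewrite px'.
Qed.

Definition cond_exp (w : X -> R) (y : Y) : R := \int[om y]_x w x.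

Lemma cond_expE w y : cond_exp w y =
  fine (cond_expect ((EFin \o w)^\+)%E y - cond_expect ((EFin \o w)^\-)%E y)%E.
Proof. by rewrite /cond_exp /Rintegral integralE. Qed.

Lemma measurable_cond_exp w : measurable_fun setT w ->
  measurable_fun setT (cond_exp w).
Proof.
move=> /measurable_EFinP mw.
rewrite (_ : cond_exp w = fun y => fine (cond_expect ((EFin \o w)^\+)%E y -
    cond_expect ((EFin \o w)^\-)%E y)%E); last by apply/funext => y; exact: cond_expE.
apply: measurableT_comp => //; apply: emeasurable_funB.
  by apply: measurable_cond_expect => //; exact: measurable_funepos.
by apply: measurable_cond_expect => //; exact: measurable_funeneg.
Qed.

(** Reduction to the nonnegative case: w is split into positive and negative parts, and F is written
    as (F + B) - B with both terms nonnegative and bounded. *)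
Lemma cond_expP (F : Y -> R) (w : X -> R) (B : R) : measurable_fun setT F ->
  (forall y, `|F y| <= B) -> eta.-integrable setT (EFin \o w) ->
  eta.-integrable setT (EFin \o (fun x => F (p x) * cond_exp w (p x))) /\
  \int[eta]_x (F (p x) * cond_exp w (p x)) = \int[eta]_x (F (p x) * w x).
Proof.
move=> mF FB iw.
have mw : measurable_fun setT w by apply/measurable_EFinP; exact: measurable_int iw.
pose wp := ((EFin \o w)^\+)%E; pose wn := ((EFin \o w)^\-)%E.
have iwp : eta.-integrable setT wp by exact: integrable_funepos.
have iwn : eta.-integrable setT wn by exact: integrable_funeneg.
have half (u : X -> \bar R) (G : Y -> R) (C : R) : eta.-integrable setT u ->
    (forall x, 0 <= u x)%E ->
    measurable_fun setT G -> (forall y, 0 <= G y) -> (forall y, G y <= C) ->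
    eta.-integrable setT (fun x => (G (p x))%:E * u x)%E /\
    eta.-integrable setT (fun x => (G (p x))%:E * cond_expect u (p x))%E.
  move=> iu u0 mG G0 GC; have mu := measurable_int _ iu.
  have mGp : measurable_fun setT (fun x => (G (p x))%:E).
    by apply/measurable_EFinP; exact: measurableT_comp mG mp.
  have i1 : eta.-integrable setT (fun x => (G (p x))%:E * u x)%E.
    apply: (@le_integrable _ _ _ _ _ _ _ (fun x => C%:E * u x)%E) => //.
    - exact: emeasurable_funM.
    - move=> x _; have C0 : 0 <= C by apply: le_trans (GC (p x)).
      rewrite !gee0_abs ?mule_ge0 ?lee_fin//.
      by apply: lee_wpmul2r; rewrite ?u0 ?lee_fin.
    - exact: integrableZl.
  split => //; apply/integrableP; split.
    apply: emeasurable_funM => //.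
    by apply: measurableT_comp mp; exact: measurable_cond_expect.
  have c0 y : (0 <= cond_expect u y)%E by apply: integral_ge0.
  under eq_integral do rewrite gee0_abs ?mule_ge0 ?lee_fin//.
  rewrite ge0_cond_expectP//.
  have /integrableP[_] := i1.
  by under eq_integral do rewrite gee0_abs ?mule_ge0 ?lee_fin//.
(* With constant weight 1 the conditional expectation is integrable, hence finite almost surely;
   only then does the [fine] hidden in [cond_exp] commute with the difference of the two parts. *)
have fin_c (u : X -> \bar R) : eta.-integrable setT u -> (forall x, 0 <= u x)%E ->
    {ae eta, forall x, cond_expect u (p x) \is a fin_num}.
  move=> iu u0; have [] := half u (cst 1) 1 iu u0 (measurable_cst _) _ _ => //.
  move=> _ /integrable_ae -/(_ measurableT); apply: filterS => x /(_ I).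
  by rewrite mul1e.
have fp := fin_c _ iwp (funepos_ge0 _); have fn := fin_c _ iwn (funeneg_ge0 _).
have nonneg (G : Y -> R) (C : R) : measurable_fun setT G -> (forall y, 0 <= G y) ->
    (forall y, G y <= C) ->
    eta.-integrable setT (EFin \o (fun x => G (p x) * cond_exp w (p x))) /\
    (\int[eta]_x (G (p x) * cond_exp w (p x))%:E = \int[eta]_x (G (p x) * w x)%:E)%E.
  move=> mG G0 GC.
  have [ip1 ip2] := half _ _ _ iwp (funepos_ge0 _) mG G0 GC.
  have [in1 in2] := half _ _ _ iwn (funeneg_ge0 _) mG G0 GC.
  have mGc : measurable_fun setT (EFin \o (fun x => G (p x) * cond_exp w (p x))).
    apply/measurable_EFinP; apply: measurable_funM; first exact: measurableT_comp mG mp.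
    by apply: measurableT_comp mp; exact: measurable_cond_exp.
  have E : {ae eta, forall x, setT x -> (G (p x) * cond_exp w (p x))%:E =
     (G (p x))%:E * cond_expect wp (p x) - (G (p x))%:E * cond_expect wn (p x)}%E.
    apply: filterS2 fp fn => x xp xn _.
    by rewrite cond_expE -(fineK xp) -(fineK xn) /= -!EFinM -EFinB mulrBr.
  split.
    have /integrableP[mI fI] := integrableB measurableT ip2 in2.
    apply/integrableP; split => //; move: fI; congr (_ < _)%E.
    apply: ae_eq_integral => //; try exact: measurableT_comp.
    by apply: filterS E => x h xT; rewrite -(h xT).
  rewrite (ae_eq_integral _ _ _ _ _ E)//; last first.
    by apply: emeasurable_funB; [exact: measurable_int ip2|exact: measurable_int in2].
  rewrite integralB// !ge0_cond_expectP//; last 4 first.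
  - exact: measurable_int iwn.
  - exact: funeneg_ge0.
  - exact: measurable_int iwp.
  - exact: funepos_ge0.
  rewrite -integralB//; apply: eq_integral => x _.
  rewrite -muleBr//; last exact: add_def_funeposneg.
  rewrite EFinM; congr (_ * _)%E.
  by have /(congr1 (fun f => f x)) /= -> := funeposneg (EFin \o w).
have abs_bound y : - B <= F y <= B by rewrite -ler_norml.
have mFB : measurable_fun setT (fun y => F y + B) by exact: measurable_funD.
have [y|y|i1 e1] := nonneg (fun y => F y + B) (B + B) mFB.
- by have /andP[] := abs_bound y; lra.
- by have /andP[] := abs_bound y; lra.
have [y|y|i2 e2] := nonneg (cst B) B (measurable_cst _).
- by rewrite (le_trans _ (FB y)).
- by [].
have bd1 (G : Y -> R) (C : R) : measurable_fun setT G -> (forall y, `|G y| <= C) ->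
    eta.-integrable setT (EFin \o (fun x => G (p x) * w x)).
  move=> mG GC; apply: (@le_integrable _ _ _ _ _ _ _ (fun x => C%:E * (w x)%:E)%E) => //.
  - apply/measurable_EFinP; apply: measurable_funM => //; exact: measurableT_comp mG mp.
  - move=> x _ /=; rewrite lee_fin !normrM ler_wpM2r//.
    by rewrite (le_trans (GC _))// ler_norm.
  - exact: integrableZl.
have j1 := bd1 (fun y => F y + B) (B + B) mFB _.
have j2 := bd1 (cst B) B (measurable_cst _) _.
have DE (u : X -> R) x : F (p x) * u x = (F (p x) + B) * u x - B * u x by ring.
split.
  have := integrableB measurableT i1 i2.
  by apply: eq_integrable => // x _ /=; rewrite -EFinB (DE (cond_exp w \o p)).
have -> : \int[eta]_x (F (p x) * cond_exp w (p x)) =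
    \int[eta]_x ((F (p x) + B) * cond_exp w (p x)) - \int[eta]_x (B * cond_exp w (p x)).
  by rewrite -RintegralB//; apply: eq_Rintegral => x _; exact: (DE (cond_exp w \o p)).
have -> : \int[eta]_x (F (p x) * w x) =
    \int[eta]_x ((F (p x) + B) * w x) - \int[eta]_x (B * w x).
  rewrite -RintegralB//.
  - by apply: eq_Rintegral => x _; exact: DE.
  - apply: j1 => y; rewrite ger0_norm; have /andP[] := abs_bound y; lra.
  - by apply: j2 => y; rewrite /= ger0_norm// (le_trans _ (FB y)).
congr (_ - _); congr fine.
  exact: e1.
exact: e2.
Qed.

End disintegration_integral.


(** * Pointwise values as Borel functions of the L^2 class *)

Section trace.
Context {R : realType} (a b : R) (d : nat) (ab : a < b).
Local Notation RT := (measurableTypeR R).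
Local Notation mu := (@lebesgue_measure R).
Implicit Types (f g : L2 a b d).

Definition right_avg f t i n : R :=
  n.+1%:R * \int[leb_on a b]_s (coord f i s * \1_(`]t, t + n.+1%:R^-1[%classic) s).

(** A Borel formula for the value at t, in contrast to [crep], which is picked by choice: each right
    average is continuous on L^2. Averaging on the right only makes the value depend on the future
    alone and lets t be the left end of the interval. *)
Definition trace f t i : R := fine (limn_esup (fun n => (right_avg f t i n)%:E)).

Lemma continuous_right_avg t i n : continuous (fun f => right_avg f t i n).
Proof.
apply: (@lipschitz_continuous_L2 _ _ _ _ (n.+1%:R * (1 * leb_mass a b))) => u v.
rewrite /right_avg -mulrBr normrM ger0_norm// -mulrA ler_wpM2l//.
apply: pairing_lipschitz => // s _; rewrite ger0_norm ?indic_ge0// /indic.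
Qed.

Lemma measurable_trace t i : measurable_fun setT (fun f : borel (L2 a b d) => trace f t i).
Proof.
have m : measurable_fun setT
    (fun f : borel (L2 a b d) => limn_esup (fun n => (right_avg f t i n)%:E)).
  apply: measurable_fun_limn_esup => n.
  apply/measurable_EFinP; apply: measurable_continuous_borel.
  exact: continuous_right_avg.
exact: (measurableT_comp (@fine_measurable R setT measurableT) m).
Qed.

Lemma right_avgE f t i n : right_avg f t i n =
  n.+1%:R * \int[mu]_(s in `]a, b[%classic `&` `]t, t + n.+1%:R^-1[%classic) coord f i s.
Proof.
congr (_ * _); rewrite Rintegral_leb_on; last first.
  by apply: measurable_funM; [exact: measurable_coord_L2|].
rewrite Rintegral_mkcondr; apply: eq_Rintegral => s _.
by rewrite patchE indicE; case: (s \in _); rewrite ?mulr1 ?mulr0.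
Qed.

Lemma trace_eq f t i x : right_avg f t i n @[n --> \oo] --> x -> trace f t i = x.
Proof.
move=> h; rewrite /trace (_ : limn_esup _ = x%:E)//.
by refine (cvg_limn_einf_sup _).2; apply: cvg_EFin; [exact: nearW|exact: h].
Qed.

Lemma itv_setI_right (t : R) n : a <= t -> t + n.+1%:R^-1 < b ->
  `]a, b[%classic `&` `]t, t + n.+1%:R^-1[%classic = `]t, t + n.+1%:R^-1[%classic.
Proof.
move=> at_ tb; apply/setIidPr => s /=; rewrite !in_itv/= => /andP[ts st].
by rewrite (le_lt_trans at_ ts) (lt_trans st tb).
Qed.

Lemma right_avg_cvg f t i : W12 f -> a <= t -> t < b ->
  right_avg f t i n @[n --> \oo] --> crep f t 0 i.
Proof.
move=> Wf at_ tb; have [kf cf] := crepP ab Wf.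
have tab : t \in `[a, b] by rewrite in_itv/= at_ ltW.
apply/cvgrPdist_le => e e0.
have kfi : crep f s 0 i @[s --> within `[a, b] (nbhs t)] --> crep f t 0 i.
  have h : crep f s @[s --> within `[a, b] (nbhs t)] --> crep f t.
    by move/subspace_continuousP : kf; apply.
  exact: (cvg_comp _ _ h (@coord_continuous R 1 d 0 i (crep f t))).
move/cvgrPdist_le : kfi => /(_ _ e0); rewrite near_withinE => -[r /= r0 hr].
have n1 : \forall n \near \oo, n.+1%:R^-1 < b - t by apply: near_natSinv_lt; rewrite subr_gt0.
have n2 := near_natSinv_lt r0.
near=> n.
have c0 : 0 < n.+1%:R^-1 :> R by [].
have cb : t + n.+1%:R^-1 < b by rewrite -ltrBrDl; near: n.
have cr : n.+1%:R^-1 < r by near: n.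
set I := `]t, t + n.+1%:R^-1[%classic : set RT.
have mI : measurable I by exact: measurable_itv.
have muI : mu I = (n.+1%:R^-1)%:E.
  have -> : mu I = mu (`]t, t + n.+1%:R^-1[%classic : set R) by [].
  by rewrite lebesgue_measure_itv/= lte_fin ltrDl c0 -EFinB addrC addKr.
have muIfin : (mu I < +oo)%E by rewrite muI ltry.
have sI : I `<=` `]a, b[.
  move=> s /=; rewrite !in_itv/= => /andP[ts st].
  by rewrite (le_lt_trans at_ ts) (lt_trans st cb).
have icf : mu.-integrable I (EFin \o coord f i).
  exact: (integrableS _ mI sI (integrable_coord_itv f i)).
have icst : mu.-integrable I (EFin \o cst (crep f t 0 i)) by exact: integrable_cst_lty.
rewrite right_avgE itv_setI_right//.
have -> : crep f t 0 i = n.+1%:R * \int[mu]_(s in I) crep f t 0 i.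
  rewrite Rintegral_cst// [X in fine X](_ : _ = (n.+1%:R^-1)%:E)//=.
  by rewrite mulrCA divff ?mulr1.
rewrite -mulrBr -RintegralB// normrM ger0_norm//.
have iD : mu.-integrable I (EFin \o (fun s => crep f t 0 i - coord f i s)).
  by have := integrableB mI icst icf.
rewrite [leLHS]mulrC -ler_pdivlMr// (le_trans (le_normr_Rintegral mI iD))//.
have bnd : (\int[mu]_(s in I) `|crep f t 0 i - coord f i s|%:E <= (e / n.+1%:R)%:E)%E.
  rewrite EFinM -muI -integral_cst//.
  apply: ae_ge0_le_integral => //.
  - apply/measurable_EFinP; apply: measurableT_comp => //.
    by apply/measurable_EFinP; exact: (measurable_int _ iD).
  - by move=> s _; rewrite lee_fin ltW.
  move/leb_on_negligible : cf; apply: negligibleS => s /= /not_implyP[Is ne].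
  split; last exact: sI.
  move=> cE; apply: ne; rewrite lee_fin /coord -cE; apply: hr.
    move: Is; rewrite /I/= in_itv/= => /andP[ts st].
    by rewrite ltr0_norm ?subr_lt0// opprB ltrBlDl (lt_trans st)// ltrD2l.
  by move: (sI _ Is); rewrite /= !in_itv/= => /andP[as_ sb]; rewrite !ltW.
rewrite -lee_fin fineK// ge0_fin_numE ?integral_ge0//.
by rewrite (le_lt_trans bnd)// ltry.
Unshelve. all: by end_near. Qed.

Lemma crep_trace f t i : W12 f -> a <= t -> t < b -> crep f t 0 i = trace f t i.
Proof. by move=> Wf at_ tb; apply/esym; apply: trace_eq; exact: right_avg_cvg. Qed.

End trace.

Section trace_restr.
Context {R : realType} (a a' b : R) (d : nat).
Local Notation mu := (@lebesgue_measure R).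
Local Notation RT := (measurableTypeR R).

(** Right averages at t never look to the left of t. This is how the position at time t becomes a
    function of [Trestr s] for s <= t. *)
Lemma trace_restr (f : L2 a b d) t i : a <= a' -> a' <= t ->
  trace (restr a' b f) t i = trace f t i.
Proof.
move=> aa at_; suff E n : right_avg (restr a' b f) t i n = right_avg f t i n.
  by rewrite /trace (_ : (fun n => _) = fun n => (right_avg f t i n)%:E)//;
    apply/funext => n; rewrite E.
rewrite !right_avgE; congr (_ * _).
have sub : `]a', b[%classic `&` `]t, t + n.+1%:R^-1[%classic =
    `]a, b[%classic `&` `]t, t + n.+1%:R^-1[%classic :> set R.
  apply/seteqP; split => s [] /=; rewrite !in_itv/= => /andP[s1 s2] /andP[s3 s4].
    by rewrite (le_lt_trans aa s1) s2 s3 s4.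
  by rewrite (le_lt_trans at_ s3) s2 s3 s4.
have mI : measurable (`]a', b[%classic `&` `]t, t + n.+1%:R^-1[%classic : set RT).
  exact: measurableI.
rewrite -sub; congr fine; apply: ae_eq_integral => //.
- by apply/measurable_EFinP; apply: measurable_funTS; exact: measurable_coord_L2.
- by apply/measurable_EFinP; apply: measurable_funTS; exact: measurable_coord_L2.
have /leb_on_negligible := restrE f aa (lexx b).
apply: negligibleS => s /= /not_implyP[[sab _] ne]; split => //.
by move=> E; apply: ne; rewrite /coord E.
Qed.

Lemma L2_dist_restr (f g : L2 a b d) : a <= a' ->
  L2_dist (restr a' b f) (restr a' b g) <= L2_dist f g.
Proof.
move=> aa; rewrite -(@ler_pXn2r _ 2)// ?nnegrE ?L2_dist_ge0// -lee_fin !sqr_L2_dist.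
rewrite !ge0_integral_leb_on; try exact: measurable_sqr_L2_sub;
  try by move=> t; rewrite lee_fin sqr_ge0.
have sub : `]a', b[ `<=` `]a, b[ by apply: subset_itvr; rewrite bnd_simp.
apply: (@le_trans _ _ (\int[mu]_(x in `]a', b[) (enorm (L2_fun f x - L2_fun g x) ^+ 2)%:E)%E).
  apply: ae_ge0_le_integral => //.
  - by move=> t _; rewrite lee_fin sqr_ge0.
  - by apply: measurable_funTS; exact: measurable_sqr_L2_sub.
  - by move=> t _; rewrite lee_fin sqr_ge0.
  - by apply: measurable_funTS; exact: measurable_sqr_L2_sub.
  have /leb_on_negligible hf := restrE f aa (lexx b).
  have /leb_on_negligible hg := restrE g aa (lexx b).
  apply: negligibleS (negligibleU hf hg) => s /= /not_implyP[sab ne].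
  have [E1|] := pselect (L2_fun (restr a' b f) s = L2_fun f s); last by left.
  right; split => // E2; apply: ne; by rewrite E1 E2.
apply: ge0_subset_integral => //.
- by apply: measurable_funTS; exact: measurable_sqr_L2_sub.
- by move=> t _; rewrite lee_fin sqr_ge0.
Qed.

Lemma continuous_restr : a <= a' -> continuous (@restr R a b a' b d).
Proof.
move=> aa f A /nbhs_ballP[e /= e0 eA]; apply/nbhs_ballP; exists e => // g fg.
apply: eA; rewrite /ball/=; apply: le_lt_trans fg; exact: L2_dist_restr.
Qed.

End trace_restr.

(** * Measurable functions on the space of curves *)

Section Gamma_measurable.
Context {R : realType} (d : nat) (T : R) (T0 : 0 < T).
Local Notation Gam := (Gamma d T).

Lemma continuous_Gamma_val : continuous (set_val : Gam -> L2 (-1) T d).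
Proof. exact: initial_continuous. Qed.

Lemma continuous_Trestr t : -1 <= t -> continuous (@Trestr R d T t).
Proof.
move=> t1 g; apply: continuous_comp; first exact: continuous_Gamma_val.
exact: continuous_restr.
Qed.

Lemma measurable_Trestr t : -1 <= t ->
  measurable_fun setT (Trestr t : borel Gam -> borel (L2 t T d)).
Proof. by move=> t1; apply: measurable_continuous_borel2; exact: continuous_Trestr. Qed.

Lemma measurable_Gamma_val :
  measurable_fun setT (set_val : borel Gam -> borel (L2 (-1) T d)).
Proof. by apply: measurable_continuous_borel2; exact: continuous_Gamma_val. Qed.

Let ltN1T : -1 < T. Proof. by rewrite (lt_trans _ T0). Qed.

Lemma measurable_Gamma_energy :
  measurable_fun setT (fun g : borel Gam => energy (set_val g)).
Proof. exact: (measurableT_comp (measurable_energy ltN1T) measurable_Gamma_val). Qed.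

Definition Gamma_W12 : set (borel Gam) := [set g | W12 (set_val g)].

Lemma Gamma_W12E : Gamma_W12 = [set g : borel Gam | (energy (set_val g) < +oo)%E].
Proof.
apply/seteqP; split => g /=; rewrite /Gamma_W12/=.
  by move=> [w hw]; rewrite (energyE ltN1T hw) ltry.
by rewrite /energy; case: asboolP.
Qed.

Lemma measurable_Gamma_W12 : measurable Gamma_W12.
Proof.
rewrite Gamma_W12E -[X in measurable X]setTI.
apply: emeasurable_fun_infty_o => //; exact: measurable_Gamma_energy.
Qed.

Lemma position_not_W12 (g : Gam) : ~ Gamma_W12 g -> position g = cst 0.
Proof.
move=> nW; rewrite /position /crep; case: xgetP => // c _ [] //.
Qed.

Lemma position_trace (g : Gam) t i : Gamma_W12 g -> -1 <= t -> t < T ->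
  position g t 0 i = trace (set_val g) t i.
Proof. by move=> Wg t1 tT; exact: crep_trace. Qed.

Lemma position_trace_restr (g : Gam) s t i : Gamma_W12 g -> -1 <= s -> s <= t -> t < T ->
  position g t 0 i = trace (Trestr s g) t i.
Proof.
move=> Wg s1 st tT; rewrite trace_restr// position_trace//.
exact: le_trans st.
Qed.

Lemma measurable_position t i : -1 <= t -> t < T ->
  measurable_fun setT (fun g : borel Gam => position g t 0 i).
Proof.
move=> t1 tT.
rewrite (_ : (fun _ => _) = fun g => if g \in Gamma_W12 then trace (set_val g) t i else 0).
  apply: measurable_fun_ifT => //.
  - apply: (measurable_fun_bool true); rewrite setTI preimage_mem_true.
    exact: measurable_Gamma_W12.
  - exact: (measurableT_comp (measurable_trace t i) measurable_Gamma_val).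
apply/funext => g; case: ifPn => [/set_mem Wg|/negP nW]; first exact: position_trace.
by rewrite position_not_W12 ?mxE// => /mem_set.
Qed.

End Gamma_measurable.


(** * Joint measurability in time and curve *)

Section right_continuous.
Context d (X : measurableType d) (R : realType).
Local Notation RT := (measurableTypeR R).

(** Time is rounded up to the grid of mesh 1/(n+1). The rounded function is constant in time on each
    cell of a countable partition, hence jointly measurable, and right continuity gives the
    limit. *)
Lemma measurable_right_continuous (f : R -> X -> R) :
  (forall s, measurable_fun setT (f s)) ->
  (forall s x, f ^~ x @ s^'+ --> f s x) ->
  measurable_fun setT (fun z : RT * X => f z.1 z.2).
Proof.
move=> mf cf.
(* The added 1 keeps [g n s] strictly to the right of s, even when s is a grid point, as [s^'+]
   requires. *)
pose g n (s : R) : R := (Num.floor (n.+1%:R * s) + 1)%:~R / n.+1%:R.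
pose h n (z : RT * X) := f (g n z.1) z.2.
apply: (@measurable_fun_cvg _ _ _ _ h) => [n|[s x] _].
- pose E (k : int) : set (RT * X) := [set z | Num.floor (n.+1%:R * (z.1 : R)) = k].
  have mE k : measurable (E k).
    have -> : E k = (`[k%:~R / n.+1%:R, (k + 1)%:~R / n.+1%:R[%classic : set RT) `*` setT.
      apply/seteqP; split => -[s x] /=; rewrite in_itv/= ler_pdivrMr// ltr_pdivlMr//.
        by move/eqP; rewrite floor_eq mulrC.
      by rewrite mulrC => -[sk _]; apply/eqP; rewrite floor_eq.
    by apply: measurableX => //; exact: measurable_itv.
  have U : \bigcup_k E k = setT.
    by apply/seteqP; split => // z _; exists (Num.floor (n.+1%:R * (z.1 : R))).
  move=> _ B mB; rewrite setTI.
  have -> : h n @^-1` B = \bigcup_k (E k `&` (setT `*` (f ((k + 1)%:~R / n.+1%:R) @^-1` B))).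
    apply/seteqP; split => [z Bz|z [k _ [Ek [_ Bz]]]].
      by exists (Num.floor (n.+1%:R * (z.1 : R))).
    by rewrite /= /h /g Ek.
  apply: countable_bigcupT_measurable => [|k]; first exact: countableP.
  apply: measurableI => //; apply: measurableX => //.
  by rewrite -[X in measurable X]setTI; exact: mf.
- rewrite /h/=.
  have c : (fun n => g n s) @ \oo --> s^'+.
    move=> A [e /= e0 eA]; suff : \forall n \near \oo, A (g n s) by [].
    near=> n; apply: eA.
      have gs : s < g n s.
        by rewrite /g ltr_pdivlMr// mulrC; have /andP[] := floor_itv (n.+1%:R * s).
      rewrite /ball/= ltr0_norm ?subr_lt0// opprB ltrBlDl.
      apply: (@le_lt_trans _ _ (s + n.+1%:R^-1)).
        rewrite /g ler_pdivrMr// mulrDl mulVf// intrD lerD2r (mulrC s).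
        exact: floor_le.
      by rewrite ltrD2l; near: n; exact: near_natSinv_lt.
    by rewrite /g ltr_pdivlMr// mulrC; have /andP[] := floor_itv (n.+1%:R * s).
  exact: (cvg_comp _ _ c (cf s x)).
Unshelve. all: by end_near. Qed.

Lemma measurable_shift (f : R -> X -> R) (c : R) :
  measurable_fun setT (fun z : RT * X => f z.1 z.2) ->
  measurable_fun setT (fun z : RT * X => f ((z.1 : R) + c) z.2).
Proof.
move=> mf; have m1 : measurable_fun setT (fun z : RT * X => z.1 : RT).
  exact: measurable_fst.
have ma : measurable_fun setT (fun z : RT * X => (z.1 : R) + c : RT).
  exact: (measurable_funD m1 (measurable_cst _)).
have m2 := @measurable_snd _ _ RT X.
exact: (measurableT_comp mf (measurable_fun_pair ma m2)).
Qed.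

Lemma measurable_section1 (f : RT * X -> R) x : measurable_fun setT f ->
  measurable_fun setT (fun s : RT => f (s, x)).
Proof. move=> mf; exact: (measurableT_comp mf (@pair2_measurable _ _ RT X x)). Qed.

Lemma measurable_section2 (f : RT * X -> R) t : measurable_fun setT f ->
  measurable_fun setT (fun x => f (t, x)).
Proof. move=> mf; exact: (measurableT_comp mf (@pair1_measurable _ _ RT X t)). Qed.

End right_continuous.

(** * A jointly measurable velocity *)

Section speed.
Context {R : realType} (d : nat) (T : R) (T0 : 0 < T).
Local Notation Gam := (Gamma d T).
Local Notation RT := (measurableTypeR R).
Local Notation mu := (@lebesgue_measure R).
Implicit Types g : Gam.

Let ltN1T : -1 < T. Proof. by rewrite (lt_trans _ T0). Qed.

Lemma cvg_position g t i : -1 <= t -> t <= T ->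
  position g s 0 i @[s --> within `[-1, T] (nbhs t)] --> position g t 0 i.
Proof.
move=> t1 tT; have [Wg|nW] := pselect (Gamma_W12 g); last first.
  by rewrite position_not_W12//; apply: cvg_cst.
have h : position g s @[s --> within `[-1, T] (nbhs t)] --> position g t.
  have [kf _] := crepP ltN1T Wg.
  by move/subspace_continuousP : kf; apply; rewrite /= in_itv/= t1 tT.
exact: (cvg_comp _ _ h (@coord_continuous R 1 d 0 i (position g t))).
Qed.

(** [position] is meaningful on [-1, T] only. Freezing it before time 0 and setting it to 0 from T
    on gives a function right continuous on the whole line, including at the junctions. *)
Definition pos i t g : R := if t < T then position g (Num.max 0 t) 0 i else 0.

Lemma posE i t g : 0 <= t -> t < T -> pos i t g = position g t 0 i.
Proof. by move=> t0 tT; rewrite /pos tT max_r. Qed.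

Lemma measurable_pos i t : measurable_fun setT (pos i t : borel Gam -> R).
Proof.
have [tT|Tt] := ltP t T; last first.
  rewrite (_ : pos i t = cst 0); first exact: measurable_cst.
  by apply/funext => g; rewrite /pos ltNge Tt.
rewrite (_ : pos i t = fun g => position g (Num.max 0 t) 0 i); last first.
  by apply/funext => g; rewrite /pos tT.
apply: measurable_position => //; first by rewrite le_max; apply/orP; left.
by rewrite gt_max T0.
Qed.

Lemma right_continuous_pos i t g : pos i ^~ g @ t^'+ --> pos i t g.
Proof.
have [tT|Tt] := ltP t T; last first.
  rewrite /pos ltNge Tt/=; apply: cvg_near_cst; near=> s.
  rewrite ltNge (le_trans Tt)//; apply: ltW; near: s; exact: nbhs_right_gt.
have [t0|t0] := ltP t 0.
  apply: cvg_near_cst; near=> s.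
  have s0 : s < 0 by near: s; exact: nbhs_right_lt.
  by rewrite /pos (lt_trans s0 T0) tT !max_l// ltW.
rewrite posE//.
have t1 : -1 <= t by apply: le_trans t0.
move=> A /(@cvg_position g t i t1 (ltW tT)) [e /= e0 eA].
suff : \forall s \near t^'+, A (pos i s g) by [].
near=> s.
have ts : t < s by near: s; exact: nbhs_right_gt.
have sT : s < T by near: s; exact: nbhs_right_lt.
rewrite /= posE//; last by rewrite (le_trans t0)// ltW.
apply: eA.
  rewrite /ball/= ltr0_norm ?subr_lt0// opprB ltrBlDl.
  by near: s; apply: nbhs_right_lt; rewrite ltrDl.
by rewrite /= in_itv/= (le_trans t1 (ltW ts)) ltW.
Unshelve. all: by end_near. Qed.

Lemma measurable_pos2 i : measurable_fun setT (fun z : RT * borel Gam => pos i z.1 z.2).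
Proof.
apply: measurable_right_continuous => [s|s x]; first exact: measurable_pos.
exact: right_continuous_pos.
Qed.

Definition quot i n t g : R := n.+1%:R * (pos i (t + n.+1%:R^-1) g - pos i t g).

(** A version of the velocity defined for all pairs (time, curve) and jointly measurable, so that
    Fubini applies. It equals the derivative where there is one, and for a W^{1,2} curve the weak
    derivative at almost every time. *)
Definition speed i (z : RT * borel Gam) : R :=
  fine (limn_esup (fun n => (quot i n z.1 z.2)%:E)).

Lemma measurable_speed i : measurable_fun setT (speed i).
Proof.
have m : measurable_fun setT
    (fun z : RT * borel Gam => limn_esup (fun n => (quot i n z.1 z.2)%:E)).
  apply: measurable_fun_limn_esup => n; apply/measurable_EFinP.
  apply: measurable_funM => //; apply: measurable_funB; last exact: measurable_pos2.
  exact: (@measurable_shift _ (borel Gam) R (pos i) n.+1%:R^-1 (measurable_pos2 i)).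
exact: (measurableT_comp (@fine_measurable R setT measurableT) m).
Qed.

Lemma measurable_speed_curve i g : measurable_fun [set: RT] (fun s : RT => speed i (s, g)).
Proof. exact: (@measurable_section1 _ (borel Gam) R (speed i) g (measurable_speed i)). Qed.

Lemma measurable_speed_time i t : measurable_fun setT (fun g : borel Gam => speed i (t, g)).
Proof. exact: (@measurable_section2 _ (borel Gam) R (speed i) t (measurable_speed i)). Qed.

Lemma speed_eq i t g x : 0 <= t -> t < T ->
  n.+1%:R * (position g (t + n.+1%:R^-1) 0 i - position g t 0 i) @[n --> \oo] --> x ->
  speed i (t, g) = x.
Proof.
move=> t0 tT h; rewrite /speed (_ : limn_esup _ = x%:E)//.
refine (cvg_limn_einf_sup _).2; apply: cvg_EFin; first exact: nearW.
apply: cvg_trans h; apply: near_eq_cvg; near=> n.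
rewrite /= /quot !posE//; first by rewrite addr_ge0.
by rewrite -ltrBrDl; near: n; apply: near_natSinv_lt; rewrite subr_gt0.
Unshelve. all: by end_near. Qed.

Lemma speed_derive i t g v : 0 <= t -> t < T ->
  is_derive (t : R) 1 (position g) v -> speed i (t, g) = v 0 i.
Proof.
move=> t0 tT h; apply: speed_eq => //; exact: is_derive_difference_quotient.
Qed.

Lemma speed_wderiv g w : weak_derivative (set_val g) w ->
  {ae mu, forall t : RT, t \in `[0, T[ -> forall i, speed i (t, g) = coord w i t}.
Proof.
move=> gw; apply: filterS (ae_lebesgue_pts w) => t lt.
rewrite in_itv/= => /andP[t0 tT] i; apply: speed_eq => //.
by apply: crep_difference_quotient => //; rewrite (lt_le_trans _ t0).
Qed.

Lemma position_increment i g p q : Gamma_W12 g -> 0 <= p -> p <= q -> q <= T ->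
  mu.-integrable (`]p, q[%classic : set RT) (EFin \o (fun s => speed i (s, g))) /\
  position g q 0 i - position g p 0 i = \int[mu]_(s in `]p, q[) speed i (s, g).
Proof.
move=> [w gw] p0 pq qT.
have p1 : -1 <= p by apply: le_trans p0.
have mI : measurable (`]p, q[%classic : set RT) by exact: measurable_itv.
have E : {ae mu, forall s : RT, `]p, q[%classic s ->
    (coord w i s)%:E = (speed i (s, g))%:E}.
  apply: filterS (speed_wderiv gw) => s h; rewrite /= in_itv/= => /andP[ps sq].
  by rewrite h// in_itv/= (le_trans p0 (ltW ps)) (lt_le_trans sq).
have mS : measurable_fun [set: RT] (fun s => speed i (s, g)).
  exact: (measurable_speed_curve i g).
have iw : mu.-integrable (`]p, q[%classic : set RT) (EFin \o coord w i).
  apply: integrableS (integrable_coord_itv w i) => //.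
  by apply: subset_itv; rewrite bnd_simp.
split; last first.
  rewrite /position (crepB ltN1T i gw)//; congr fine; apply: ae_eq_integral => //.
    by apply/measurable_EFinP; apply: measurable_funTS; exact: measurable_coord_L2.
  by apply/measurable_EFinP; apply: measurable_funTS.
have /integrableP[m1 f1] := iw; apply/integrableP; split.
  by apply/measurable_EFinP; apply: measurable_funTS.
rewrite (_ : (\int[_]_(_ in _) _)%E = (\int[mu]_(x in `]p, q[) `|(EFin \o coord w i) x|)%E)//.
apply: ae_eq_integral => //.
- apply: measurableT_comp => //.
  by apply/measurable_EFinP; apply: measurable_funTS.
- by apply: measurableT_comp => //.
- by apply: filterS E => s h sI; case: (h sI) => /= ->.
Qed.

(** From |x| <= 1 + |x|^2. With the bound on the mean energy it makes the velocity integrable over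
    time and curves. *)
Lemma abs_speed_le_energy i g : Gamma_W12 g ->
  (\int[mu]_(s in `]0%R, T[) (`|speed i (s, g)|%R)%:E <= T%:E + energy (set_val g))%E.
Proof.
move=> [w gw]; rewrite (energyE ltN1T gw) sqnE.
have mI : measurable (`]0, T[%classic : set RT) by exact: measurable_itv.
have mS : measurable_fun [set: RT] (fun s => speed i (s, g)).
  exact: (measurable_speed_curve i g).
have mw : measurable_fun setT (fun t : RT => (enorm (L2_fun w t) ^+ 2)%:E).
  exact: measurable_sqr_L2.
rewrite ge0_integral_leb_on//; last by move=> t; rewrite lee_fin sqr_ge0.
apply: (@le_trans _ _ (\int[mu]_(s in `]0%R, T[) (1%:E + ((enorm (L2_fun w s) ^+ 2)%R)%:E))%E).
  apply: ae_ge0_le_integral => //.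
  - by apply/measurable_EFinP; apply: measurable_funTS; exact: measurableT_comp.
  - by move=> s _; rewrite adde_ge0// lee_fin ?sqr_ge0.
  - by apply: emeasurable_funD => //; exact: measurable_funTS.
  - apply: filterS (speed_wderiv gw) => s h sI.
    rewrite h; last by apply: subset_itv sI; rewrite bnd_simp.
    rewrite -EFinD lee_fin (le_trans (enorm_coord _ i))//.
    have := sqr_ge0 (enorm (L2_fun w s) - 1); have := sqr_ge0 (enorm (L2_fun w s)); lra.
rewrite ge0_integralD//; last 2 first.
- by move=> s _; rewrite lee_fin sqr_ge0.
- exact: measurable_funTS.
apply: leeD.
  rewrite integral_cst// mul1e.
  have h : mu (`]0, T[%classic : set R) = T%:E.
    by rewrite lebesgue_measure_itv/= lte_fin T0 oppr0 adde0.
  by rewrite -[leRHS]h.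
apply: ge0_subset_integral => //.
- exact: measurable_funTS.
- by move=> t _; rewrite lee_fin sqr_ge0.
- by apply: subset_itv; rewrite bnd_simp.
Qed.

End speed.


(** * Integrability under a probability, and sections of null sets *)

Section probability_facts.
Context d (X : measurableType d) (R : realType) (P : probability X R).

Lemma integrable_bounded (f : X -> R) (B : R) : measurable_fun setT f ->
  (forall x, `|f x| <= B) -> P.-integrable setT (EFin \o f).
Proof.
move=> mf fB; apply: measurable_bounded_integrable => //.
  by apply: (le_lt_trans (probability_le1 P measurableT)); exact: ltry.
by exists B; split => [|M /ltW BM t _ /=]; rewrite ?num_real// (le_trans (fB t)).
Qed.

Lemma integrable_boundedM (f u : X -> R) (B : R) : measurable_fun setT f ->
  (forall x, `|f x| <= B) -> P.-integrable setT (EFin \o u) ->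
  P.-integrable setT (EFin \o (fun x => f x * u x)).
Proof.
move=> mf fB iu.
have mu : measurable_fun setT u by apply/measurable_EFinP; exact: measurable_int iu.
apply: (@le_integrable _ _ _ _ _ _ _ (fun x => B%:E * (u x)%:E)%E) => //.
- by apply/measurable_EFinP; exact: measurable_funM.
- move=> x _ /=; rewrite lee_fin !normrM ler_wpM2r//.
  by rewrite (le_trans (fB _))// ler_norm.
- exact: integrableZl.
Qed.

Lemma ae_eq_integrable (f g : X -> R) : measurable_fun setT g ->
  {ae P, forall x, f x = g x} -> P.-integrable setT (EFin \o f) ->
  P.-integrable setT (EFin \o g).
Proof.
move=> mg fg /integrableP[mf If]; apply/integrableP; split; first exact/measurable_EFinP.
rewrite (_ : (\int[_]_(_ in _) _)%E = (\int[P]_x `|(EFin \o f) x|)%E)//.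
apply: ae_eq_integral => //; try exact: measurableT_comp.
- by apply: measurableT_comp => //; exact/measurable_EFinP.
- by apply: filterS fg => x /= ->.
Qed.

Lemma ae_eq_Rintegral (f g : X -> R) : measurable_fun setT f -> measurable_fun setT g ->
  {ae P, forall x, f x = g x} -> \int[P]_x f x = \int[P]_x g x.
Proof.
move=> mf mg fg; congr fine; apply: ae_eq_integral => //; try exact/measurable_EFinP.
by apply: filterS fg => x ->.
Qed.

Lemma integrable_normr (f : X -> R) : P.-integrable setT (EFin \o f) ->
  P.-integrable setT (EFin \o (fun x => `|f x|)).
Proof. by move=> /integrable_norm. Qed.

Lemma integrable_sqr_moment (f : X -> R) : measurable_fun setT f ->
  (\int[P]_x (f x ^+ 2)%:E < +oo)%E -> P.-integrable setT (EFin \o f).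
Proof.
move=> mf f2.
apply: (@le_integrable _ _ _ _ _ _ _ (EFin \o (fun x : X => 1 + f x ^+ 2))) => //.
- exact/measurable_EFinP.
- move=> x _; rewrite /= lee_fin [leRHS]ger0_norm ?addr_ge0 ?sqr_ge0//.
  rewrite -(real_normK (num_real (f x))).
  have := sqr_ge0 (`|f x| - 1); have := sqr_ge0 (`|f x|); lra.
have i1 : P.-integrable setT (EFin \o cst 1).
  by apply: (@integrable_bounded _ 1) => // x; rewrite normr1.
have i2 : P.-integrable setT (EFin \o (fun x => f x ^+ 2)).
  apply/integrableP; split; first by apply/measurable_EFinP; exact: measurable_funX.
  by under eq_integral do rewrite /= ger0_norm ?sqr_ge0//.
by have := integrableD measurableT i1 i2.
Qed.

Lemma ae_ge0_probability1 (A : set X) : measurable A -> P (~` A) = 0 -> {ae P, forall x, A x}.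
Proof. by move=> mA A0; exists (~` A); split => //; exact: measurableC. Qed.

End probability_facts.

Section ae_product.
Context d1 d2 (X : measurableType d1) (Y : measurableType d2) (R : realType).
Variables (m1 : {sigma_finite_measure set X -> \bar R})
  (m2 : {sigma_finite_measure set Y -> \bar R}).

Lemma ae_xsection (Q : X * Y -> Prop) : {ae (m1 \x m2)%E, forall z, Q z} ->
  {ae m1, forall x, {ae m2, forall y, Q (x, y)}}.
Proof.
move=> [A [mA A0 QA]].
have /(ae_eq_integral_abs m1 measurableT (measurable_fun_xsection m2 mA)) h :
    (\int[m1]_x `|(m2 \o xsection A) x| = 0)%E.
  by rewrite -[RHS]A0; apply: eq_integral => x _; rewrite gee0_abs.
apply: filterS h => x /(_ I) h; exists (xsection A x); split => //.
  exact: measurable_xsection.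
by move=> y nQ; rewrite /xsection/= inE; exact: QA.
Qed.

End ae_product.

(** * Jensen's inequality for the excess over a level *)

Section cond_exp_excess.
Context d1 d2 (X : measurableType d1) (Y : measurableType d2) (R : realType).
Variables (eta : probability X R) (om : R.-pker Y ~> X) (p : X -> Y).
Hypothesis mp : measurable_fun setT p.
Hypothesis etaE : forall A, measurable A -> eta A = (\int[eta]_x om (p x) A)%E.
Hypothesis conc : {ae eta, forall x, om (p x) (~` (p @^-1` [set p x])) = 0}.
Hypothesis mset1 : forall y : Y, measurable [set y].

Definition excess (M x : R) : R := Num.max 0 (`|x| - M).

Lemma excess_ge0 M x : 0 <= excess M x. Proof. by rewrite le_max lexx. Qed.

Lemma measurable_excess M : measurable_fun setT (excess M).
Proof.
apply: measurable_maxr; first exact: measurable_cst.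
by apply: measurable_funB => //; exact: measurableT_comp.
Qed.

(* Jensen's inequality for the convex function [excess M]. *)
Lemma integral_cond_exp_excess (w : X -> R) (M : R) : 0 <= M ->
  eta.-integrable setT (EFin \o w) ->
  (\int[eta]_x (excess M (cond_exp om w (p x)))%:E <= \int[eta]_x (excess M (w x))%:E)%E.
Proof.
move=> M0 iw; pose c := cond_exp om w.
have mw : measurable_fun setT w by apply/measurable_EFinP; exact: measurable_int iw.
have mc : measurable_fun setT c by exact: measurable_cond_exp.
have mcp : measurable_fun setT (c \o p) by exact: measurableT_comp.
(* F selects a subgradient of [excess M] at the conditional expectation c. Then [excess M] of c is
   exactly F c - M |F|, linear in c, so c can be exchanged for w, and F w - M |F| never exceeds
   [excess M] of w. *)
pose F y : R := if M < c y then 1 else if c y < - M then -1 else 0.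
have mF : measurable_fun setT F.
  apply: measurable_fun_ifT => //; first exact: measurable_fun_ltr.
  apply: measurable_fun_ifT => //; exact: measurable_fun_ltr.
have F1 y : `|F y| <= 1.
  by rewrite /F; case: ifP => _; [|case: ifP => _]; rewrite ?normrN ?normr1 ?normr0.
have [i1 e1] := cond_expP mp etaE conc mset1 mF F1 iw.
have mFp : measurable_fun setT (F \o p) by exact: measurableT_comp.
have i2 : eta.-integrable setT (EFin \o (fun x => M * `|F (p x)|)).
  apply: (@integrable_bounded _ _ _ _ _ M).
    by apply: measurable_funM => //; exact: measurableT_comp.
  by move=> x; rewrite normrM normr_id ger0_norm// ler_piMr.
have i3 : eta.-integrable setT (EFin \o (fun x => F (p x) * w x)).
  by apply: (@integrable_boundedM _ _ _ _ _ _ 1).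
have ex x : excess M (c (p x)) = F (p x) * c (p x) - M * `|F (p x)|.
  rewrite /excess /F; case: ifPn => [Mc|].
    rewrite mul1r normr1 mulr1 gtr0_norm ?(le_lt_trans M0)// max_r// subr_ge0 ltW//.
  rewrite -leNgt => cM; case: ifPn => [cM'|].
    have c0 : c (p x) < 0 by rewrite (lt_le_trans cM')// oppr_le0.
    rewrite mulN1r normrN normr1 mulr1 ltr0_norm// max_r// subr_ge0 -lerN2 opprK ltW//.
  rewrite -leNgt => cM'; rewrite mul0r normr0 mulr0 subrr max_l// subr_le0.
  by rewrite ler_norml cM' cM.
under eq_integral do rewrite ex.
have iB1 : eta.-integrable setT (EFin \o (fun x => F (p x) * c (p x) - M * `|F (p x)|)).
  by have := integrableB measurableT i1 i2.
have iB2 : eta.-integrable setT (EFin \o (fun x => F (p x) * w x - M * `|F (p x)|)).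
  by have := integrableB measurableT i3 i2.
have -> : (\int[eta]_x (F (p x) * c (p x) - M * `|F (p x)|)%:E =
    \int[eta]_x (F (p x) * w x - M * `|F (p x)|)%:E)%E.
  rewrite -[LHS]fineK; last exact: (integrable_fin_num measurableT iB1).
  rewrite -[RHS]fineK; last exact: (integrable_fin_num measurableT iB2).
  congr EFin; rewrite -/(Rintegral _ _ _) -/(Rintegral _ _ _).
  by rewrite !RintegralB// e1.
apply: le_integral => //.
  apply: (@le_integrable _ _ _ _ _ _ _ (EFin \o (fun x => `|w x|))) => //.
  - by apply/measurable_EFinP; exact: (measurableT_comp (measurable_excess M) mw).
  - move=> x _; rewrite /= lee_fin (ger0_norm (excess_ge0 _ _)) normr_id.
    by rewrite ge_max normr_ge0 gerBl.
  - exact: integrable_normr.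
move=> x _; rewrite lee_fin le_max; apply/orP.
have [Fx|Fx] : `|F (p x)| = 0 \/ `|F (p x)| = 1.
  by rewrite /F; case: ifP => _; [|case: ifP => _]; rewrite ?normrN ?normr1 ?normr0; auto.
  by left; rewrite Fx (normr0_eq0 Fx) mul0r mulr0 subrr.
by right; rewrite Fx mulr1 lerD2r (le_trans (ler_norm _))// normrM Fx mul1r.
Qed.

End cond_exp_excess.


(** * Fubini over a subset of the first factor *)

Section partial_integral.
Context d1 d2 (X : measurableType d1) (Y : measurableType d2) (R : realType).
Variables (m : {sigma_finite_measure set X -> \bar R}) (D : set X) (mD : measurable D).

Lemma integral_partial (h : X * Y -> \bar R) y :
  (\int[m]_(x in D) h (x, y) = \int[m]_x (h \_ (D `*` setT)) (x, y))%E.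
Proof.
rewrite integral_mkcond; apply: eq_integral => x _; rewrite !patchE.
have [xD|xD] := pselect (D x); first by rewrite !mem_set.
by rewrite !memNset// => -[].
Qed.

Lemma measurable_integral_partial (h : X * Y -> \bar R) : measurable_fun setT h ->
  (forall z, 0 <= h z)%E -> measurable_fun setT (fun y => \int[m]_(x in D) h (x, y))%E.
Proof.
move=> mh h0.
have mDT : measurable (D `*` setT : set (X * Y)) by exact: measurableX.
have m1 : measurable_fun setT (h \_ (D `*` setT)).
  by apply/(measurable_restrictT _ mDT); exact: measurable_funTS.
have m2 := measurable_fun_fubini_tonelli_G (m1:=m) _ m1 (erestrict_ge0 (fun z _ => h0 z)).
by under eq_fun do rewrite integral_partial.
Qed.

Lemma ge0_fubini_partial (P : {sigma_finite_measure set Y -> \bar R}) (h : X * Y -> \bar R) :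
  measurable_fun setT h -> (forall z, 0 <= h z)%E ->
  (\int[P]_y \int[m]_(x in D) h (x, y) = \int[m]_(x in D) \int[P]_y h (x, y))%E.
Proof.
move=> mh h0.
have mDT : measurable (D `*` setT : set (X * Y)) by exact: measurableX.
have m1 : measurable_fun setT (h \_ (D `*` setT)).
  by apply/(measurable_restrictT _ mDT); exact: measurable_funTS.
under eq_integral do rewrite integral_partial.
rewrite -(fubini_tonelli (m1:=m) (m2:=P) _ m1 (erestrict_ge0 (fun z _ => h0 z))).
rewrite [RHS]integral_mkcond; apply: eq_integral => x _; rewrite patchE.
case: ifPn => xD.
  by apply: eq_integral => y _; rewrite patchE mem_set//; split => //; exact: set_mem.
by apply: integral0_eq => y _; rewrite patchE memNset// => -[/= Dx _]; rewrite mem_set in xD.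
Qed.

(** The form used for the orthogonality: the integral in x is known for almost every y (an increment
    along a curve), and the integral in y is the same constant for almost every x (a mean at a given
    time). *)
Lemma fubini_partial_ae (P : {sigma_finite_measure set Y -> \bar R}) (h : X * Y -> \bar R)
    (k : Y -> \bar R) (c : R) :
  measurable_fun setT h -> (\int[P]_y \int[m]_(x in D) `|h (x, y)| < +oo)%E ->
  measurable_fun setT k -> {ae P, forall y, (\int[m]_(x in D) h (x, y) = k y)%E} ->
  {ae m, forall x, D x -> (\int[P]_y h (x, y) = c%:E)%E} ->
  (\int[P]_y k y = c%:E * m D)%E.
Proof.
move=> mh hoo mk kE cE.
have mDT : measurable (D `*` setT : set (X * Y)) by exact: measurableX.
have m1 : measurable_fun setT (h \_ (D `*` setT)).
  by apply/(measurable_restrictT _ mDT); exact: measurable_funTS.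
have ih : (m \x P)%E.-integrable setT (h \_ (D `*` setT)).
  apply: (integrable21ltyP m P m1).2; apply: le_lt_trans hoo.
  rewrite le_eqVlt; apply/orP; left; apply/eqP.
  apply: eq_integral => y _; rewrite [RHS](integral_partial (fun z => `|h z|)%E).
  by apply: eq_integral => x _; rewrite !patchE; case: ifP => // _; rewrite abse0.
have mF := measurable_fubini_F ih.
have mG := measurable_fubini_G ih.
transitivity (\int[P]_y fubini_G m (h \_ (D `*` setT)) y)%E.
  apply: ae_eq_integral => //.
  by apply: filterS kE => y ky _; rewrite -ky integral_partial.
rewrite -[LHS](Fubini ih) -(integral_cst m mD) [RHS]integral_mkcond.
apply: ae_eq_integral => //.
  by apply/(measurable_restrictT _ mD); exact: measurable_cst.
apply: filterS cE => x cx _; rewrite patchE; case: ifPn => xD.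
  rewrite -cx; last exact: set_mem.
  by apply: eq_integral => y _; rewrite patchE mem_set//; split => //; exact: set_mem.
by apply: integral0_eq => y _; rewrite patchE memNset// => -[/= Dx _]; rewrite mem_set in xD.
Qed.

End partial_integral.

(** * Consequences of dissipativity *)

Section dissipative_speed.
Context {R : realType} (d : nat) (T : R) (T0 : 0 < T).
Local Notation Gam := (Gamma d T).
Local Notation RT := (measurableTypeR R).
Local Notation mu := (@lebesgue_measure R).
Local Notation phase := ('rV[R]_d * 'rV[R]_d)%type.
Implicit Types eta : probability (borel Gam) R.

Lemma measurable_e0 i : measurable_fun setT (fun g : borel Gam => e0 g 0 i).
Proof. by apply: measurable_position => //; rewrite lerN10. Qed.

Lemma measurable_W0 i : measurable_fun setT (fun g : borel Gam => W0 g 0 i).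
Proof.
rewrite (_ : (fun _ => _) = fun g : borel Gam => position g 0 0 i - position g (-1) 0 i).
  apply: measurable_funB; first exact: measurable_e0.
  by apply: measurable_position => //; rewrite (lt_trans _ T0).
by apply/funext => g; rewrite /W0 !mxE.
Qed.

Lemma measurable_set1_L2 (a b : R) (f : L2 a b d) : measurable ([set f] : set (borel (L2 a b d))).
Proof.
rewrite -(setCK [set f]); apply: measurableC; apply: sub_sigma_algebra.
by apply: closed_openC; apply: accessible_closed_set1; apply: hausdorff_accessible; exact: metric_hausdorff.
Qed.

Lemma ae_pushforward d1 d2 (X : measurableType d1) (Y : measurableType d2)
    (m : {measure set X -> \bar R}) (p : X -> Y) (mp : measurable_fun setT p) (Q : Y -> Prop) :
  {ae pushforward m p, forall y, Q y} -> {ae m, forall x, Q (p x)}.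
Proof.
move=> [A [mA A0 QA]]; exists (p @^-1` A); split => //.
  by rewrite -[X in measurable X]setTI; exact: mp.
by move=> x nQ; exact: QA.
Qed.

Lemma disintegration_map eta t (om : kernel_at d T t) : -1 <= t -> disintegration eta om ->
  (forall A, measurable A -> eta A = (\int[eta]_x om (Trestr t x) A)%E) /\
  {ae eta, forall x : borel Gam, om (Trestr t x) (~` (Trestr t @^-1` [set Trestr t x])) = 0}.
Proof.
move=> t1 [h1 h2]; have mT := @measurable_Trestr R d T t t1; split.
  move=> A mA; rewrite h1// (ge0_integral_pushforward mT)//.
  exact: measurable_kernel.
exact: (ae_pushforward mT h2).
Qed.

(** Almost every time section of the null set in time and curves is null; at such a time the
    derivative exists for almost every curve and is therefore the measurable [speed]. *)
Lemma dissipative_speed eta : dissipative (eta : Prob R Gam) ->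
  {ae mu, forall s : RT, s \in `[0, T[ -> exists om : kernel_at d T s, [/\
    (forall A, measurable A -> eta A = (\int[eta]_x om (Trestr s x) A)%E),
    {ae eta, forall x : borel Gam, om (Trestr s x) (~` (Trestr s @^-1` [set Trestr s x])) = 0} &
    {ae eta, forall g : borel Gam, forall i, speed i (s, g) =
      cond_exp om (fun g' => W0 g' 0 i) (Trestr s g)}]}.
Proof.
move=> [_ [om [dis /ae_xsection h]]]; apply: filterS h => s hs sT.
have s0T : 0 <= s < T by move: sT; rewrite in_itv.
have [s0 sT'] := andP s0T.
have [h1 h2] := disintegration_map (le_trans (lerN10 R) s0) (dis s sT).
exists (om s); split => //; apply: filterS hs => g /(_ sT) /= hg i.
by rewrite (speed_derive i s0 sT' hg) /velocity mxE.
Qed.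

Lemma energy_ge0 (a b : R) (f : L2 a b d) : (0 <= energy f)%E.
Proof. by rewrite /energy; case: asboolP => // _; rewrite expe_ge0// L2_norm_ge0. Qed.

Lemma ae_Gamma_W12 eta : MGamma (eta : Prob R Gam) -> {ae eta, forall g : borel Gam, Gamma_W12 g}.
Proof.
move=> [_ hE].
have i : eta.-integrable setT (fun g : borel Gam => energy (set_val g)).
  apply/integrableP; split; first exact: measurable_Gamma_energy.
  apply: le_lt_trans (ltry (T + 1)); apply: le_trans hE.
  rewrite le_eqVlt; apply/orP; left; apply/eqP; apply: eq_integral => g _.
  by rewrite gee0_abs//; exact: energy_ge0.
have := integrable_ae measurableT i; apply: filterS => g /(_ I) fg.
have : [set g | (energy (set_val g) < +oo)%E] g by rewrite /= ltey_eq fg.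
by rewrite -(Gamma_W12E d T0).
Qed.


Section with_data.
Variables (eta : probability (borel Gam) R) (nu : probability (borel phase) R).
Hypotheses (deta : dissipative (eta : Prob R Gam))
  (ieta : initial_data (eta : Prob R Gam) (nu : Prob R phase))
  (nu21 : P21 (nu : Prob R phase)).

Let MG : MGamma (eta : Prob R Gam) := deta.1.

Let p0 : Gam -> phase := fun g => (e0 g, W0 g).

Let mp0 : measurable_fun setT (p0 : borel Gam -> borel phase).
Proof. by apply: measurable_row_pair => i; [exact: measurable_e0|exact: measurable_W0]. Qed.

Lemma integral_initial (f : borel phase -> \bar R) : measurable_fun setT f ->
  (forall z, 0 <= f z)%E -> (\int[eta]_g f (p0 g) = \int[nu]_z f z)%E.
Proof.
move=> mf f0.
transitivity (\int[pushforward eta (p0 : borel Gam -> borel phase)]_z f z)%E.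
  by rewrite (ge0_integral_pushforward mp0).
by apply: eq_measure_integral => A mA _; exact: ieta.
Qed.

Lemma measurable_fst_coord i : measurable_fun setT (fun z : borel phase => z.1 0 i : R).
Proof.
apply: (@measurable_continuous_borel R phase) => z.
apply: (@continuous_comp phase 'rV[R]_d R fst (fun x => x 0 i)); first exact: cvg_fst.
exact: coord_continuous.
Qed.

Lemma measurable_snd_coord i : measurable_fun setT (fun z : borel phase => z.2 0 i : R).
Proof.
apply: (@measurable_continuous_borel R phase) => z.
apply: (@continuous_comp phase 'rV[R]_d R snd (fun x => x 0 i)); first exact: cvg_snd.
exact: coord_continuous.
Qed.

Lemma sqr_coord_le (x : 'rV[R]_d) i : x 0 i ^+ 2 <= enorm x ^+ 2.
Proof. by rewrite -(real_normK (num_real (x 0 i))) lerXn2r ?nnegrE ?enorm_ge0// enorm_coord. Qed.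

Lemma measurable_enorm_borel (f : borel phase -> 'rV[R]_d) :
  (forall i, measurable_fun setT (fun z => f z 0 i)) ->
  measurable_fun setT (fun z => (enorm (f z) ^+ 2)%:E).
Proof.
move=> mf; apply/measurable_EFinP.
rewrite (_ : (fun _ => _) = fun z => \sum_(i < d) f z 0 i ^+ 2).
  by apply: measurable_sum => i; exact: measurable_funX.
by apply/funext => z; rewrite enorm_sqr.
Qed.

Lemma e0_moment i : (\int[eta]_g (e0 g 0 i ^+ 2)%:E <= 1)%E.
Proof.
rewrite (integral_initial (f := fun z => (z.1 0 i ^+ 2)%:E)); last 2 first.
- by apply/measurable_EFinP; apply: measurable_funX; exact: measurable_fst_coord.
- by move=> z; rewrite lee_fin sqr_ge0.
apply: le_trans nu21.1; apply: ge0_le_integral => //.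
- by move=> z _; rewrite lee_fin sqr_ge0.
- by apply/measurable_EFinP; apply: measurable_funX; exact: measurable_fst_coord.
- by apply: measurable_enorm_borel; exact: measurable_fst_coord.
- by move=> z _; rewrite lee_fin sqr_coord_le.
Qed.

Lemma W0_moment i : (\int[eta]_g (W0 g 0 i ^+ 2)%:E <= 1)%E.
Proof.
rewrite (integral_initial (f := fun z => (z.2 0 i ^+ 2)%:E)); last 2 first.
- by apply/measurable_EFinP; apply: measurable_funX; exact: measurable_snd_coord.
- by move=> z; rewrite lee_fin sqr_ge0.
apply: le_trans nu21.2; apply: ge0_le_integral => //.
- by move=> z _; rewrite lee_fin sqr_ge0.
- by apply/measurable_EFinP; apply: measurable_funX; exact: measurable_snd_coord.
- by apply: measurable_enorm_borel; exact: measurable_snd_coord.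
- by move=> z _; rewrite lee_fin sqr_coord_le.
Qed.

Lemma integrable_e0 i : eta.-integrable setT (EFin \o (fun g : borel Gam => e0 g 0 i)).
Proof. 
apply: integrable_sqr_moment; first exact: measurable_e0.
by apply: (le_lt_trans (e0_moment i)); rewrite ltry. Qed.

Lemma integrable_W0 i : eta.-integrable setT (EFin \o (fun g : borel Gam => W0 g 0 i)).
Proof. 
apply: integrable_sqr_moment; first exact: measurable_W0.
by apply: (le_lt_trans (W0_moment i)); rewrite ltry. Qed.

Let mI (a b : R) : measurable (`]a, b[%classic : set RT).
Proof. exact: measurable_itv. Qed.

Lemma integral_abs_speed_lty i :
  (\int[eta]_g \int[mu]_(s in `]0%R, T[) (`|speed i (s, g)|%R)%:E < +oo)%E.
Proof.
have mE := @measurable_Gamma_energy R d T T0.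
apply: (@le_lt_trans _ _ (\int[eta]_g (T%:E + energy (set_val g)))%E).
  apply: ae_ge0_le_integral => //.
  - by move=> g _; apply: integral_ge0 => s _; rewrite lee_fin.
  - apply: (@measurable_integral_partial _ _ RT (borel Gam) R mu _ (mI 0 T)
      (fun z => (`|speed i z|)%:E)) => //.
    by apply/measurable_EFinP; apply: measurableT_comp => //; exact: measurable_speed.
  - by move=> g _; rewrite adde_ge0 ?energy_ge0// lee_fin ltW.
  - exact: emeasurable_funD.
  - have W := ae_Gamma_W12 MG.
    by apply: filterS W => g Wg _; exact: abs_speed_le_energy.
rewrite ge0_integralD//; last 2 first.
- by move=> g _; rewrite lee_fin ltW.
- by move=> g _; exact: energy_ge0.
rewrite lte_add_pinfty//; last by apply: (le_lt_trans MG.2); rewrite ltry.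
rewrite integral_cst//; apply: (@le_lt_trans _ _ (T%:E * 1)%E); last by rewrite mule1 ltry.
by rewrite lee_pmul2l// ?lte_fin// probability_le1.
Qed.

Lemma measurable_position_row t : 0 <= t -> t < T ->
  measurable_fun setT ((fun g => position g t) : borel Gam -> borel 'rV[R]_d).
Proof.
move=> t0 tT; apply: measurable_row => i; apply: measurable_position => //.
by rewrite (le_trans _ t0)// lerN10.
Qed.

(** For s < t the position at t is determined by the curve on ]s, T[, so F of it is an admissible
    test function for the conditional expectation given [Trestr s], and W0 may replace its
    conditional expectation, the velocity at s. *)
Lemma ae_speed_cond_exp (F : borel 'rV[R]_d -> R) t i : measurable_fun setT F ->
  (forall x, `|F x| <= 1) -> 0 <= t -> t < T ->
  {ae mu, forall s : RT, `]0, t[%classic s ->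
    eta.-integrable setT (EFin \o (fun g => F (position g t) * speed i (s, g))) /\
    \int[eta]_g (F (position g t) * speed i (s, g)) =
    \int[eta]_g (F (position g t) * W0 g 0 i)}.
Proof.
move=> mF F1 t0 tT; apply: filterS (dissipative_speed deta) => s.
rewrite /= !in_itv/= => hs /andP[s0 st].
have [|om [h1 h2 h3]] := hs; first by rewrite (ltW s0) (lt_trans st).
have s1 : -1 <= s by rewrite (le_trans _ (ltW s0))// lerN10.
(* [tr] reads the position at time t off the restriction of the curve to ]s, T[. *)
pose tr (y : borel (L2 s T d)) : borel 'rV[R]_d := \row_j trace y t j.
have mtr : measurable_fun setT tr.
  apply: measurable_row => j; under eq_fun do rewrite mxE; exact: measurable_trace.
have FtrE : {ae eta, forall g : borel Gam, F (tr (Trestr s g)) = F (position g t)}.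
  apply: filterS (ae_Gamma_W12 MG) => g Wg; congr F; apply/rowP => j.
  by rewrite mxE (position_trace_restr T0 j Wg s1 (ltW st) tT).
have mFp : measurable_fun setT (fun g : borel Gam => F (position g t)).
  exact: (measurableT_comp mF (measurable_position_row t0 tT)).
have mFtr := measurableT_comp mF mtr.
have mT := @measurable_Trestr R d T s s1.
have mc := measurable_cond_exp om (measurable_W0 i).
have [i1 e1] := cond_expP mT h1 h2 (@measurable_set1_L2 s T) mFtr
  (fun y => F1 (tr y)) (integrable_W0 i).
have msp := measurable_speed_time T0 i s.
have E1 : {ae eta, forall g : borel Gam,
    F (tr (Trestr s g)) * cond_exp om (fun g => W0 g 0 i) (Trestr s g) =
    F (position g t) * speed i (s, g)}.
  by apply: filterS2 FtrE h3 => g -> ->.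
have E2 : {ae eta, forall g : borel Gam, F (tr (Trestr s g)) * W0 g 0 i = F (position g t) * W0 g 0 i}.
  by apply: filterS FtrE => g ->.
have m1 : measurable_fun setT (fun g : borel Gam => F (position g t) * speed i (s, g)).
  exact: measurable_funM.
have m2 : measurable_fun setT (fun g : borel Gam => F (position g t) * W0 g 0 i).
  exact: (measurable_funM mFp (measurable_W0 i)).
have m3 : measurable_fun setT (fun g : borel Gam => F (tr (Trestr s g)) * W0 g 0 i).
  by apply: measurable_funM; [exact: (measurableT_comp mFtr mT)|exact: measurable_W0].
have m4 : measurable_fun setT (fun g : borel Gam => F (tr (Trestr s g)) *
    cond_exp om (fun g => W0 g 0 i) (Trestr s g)).
  by apply: measurable_funM; [exact: (measurableT_comp mFtr mT)|exact: (measurableT_comp mc mT)].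
split; first exact: (ae_eq_integrable m1 E1 i1).
rewrite -(ae_eq_Rintegral m4 m1 E1) -(ae_eq_Rintegral m3 m2 E2).
exact: e1.
Qed.

Lemma integrable_position t i : 0 <= t -> t < T ->
  eta.-integrable setT (EFin \o (fun g : borel Gam => position g t 0 i)).
Proof.
move=> t0 tT.
have mpos : measurable_fun setT (fun g : borel Gam => position g t 0 i).
  by apply: measurable_position => //; rewrite (le_trans _ t0)// lerN10.
have i1 : eta.-integrable setT (EFin \o (fun g : borel Gam => position g t 0 i - e0 g 0 i)).
  apply/integrableP; split.
    by apply/measurable_EFinP; apply: measurable_funB => //; exact: measurable_e0.
  apply: le_lt_trans (integral_abs_speed_lty i); apply: ae_ge0_le_integral => //.
  - apply/measurable_EFinP; apply: measurableT_comp => //.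
    by apply: measurable_funB => //; exact: measurable_e0.
  - by move=> g _; apply: integral_ge0 => s _.
  - apply: (@measurable_integral_partial _ _ RT (borel Gam) R mu _ (mI 0 T)
      (fun z => (`|speed i z|)%:E)) => //.
    by apply/measurable_EFinP; apply: measurableT_comp => //; exact: measurable_speed.
  apply: filterS (ae_Gamma_W12 MG) => g Wg _.
  have [isp e] := position_increment T0 i Wg (lexx 0) t0 (ltW tT).
  rewrite /= /e0 e; apply: (@le_trans _ _ (\int[mu]_(s in `]0%R, t[) (`|speed i (s, g)|%R)%:E)%E).
    rewrite /Rintegral -abse_EFin fineK; last exact: integrable_fin_num isp.
    exact: (le_abse_integral mu (mI 0 t) (measurable_int _ isp)).
  apply: ge0_subset_integral => //.
  - by apply/measurable_EFinP; apply: measurable_funTS; apply: measurableT_comp => //;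
      exact: measurable_speed_curve.
  - by apply: subset_itvl; rewrite bnd_simp ltW.
have := integrableD measurableT i1 (integrable_e0 i).
by apply: eq_integrable => // g _; rewrite /= -EFinD subrK.
Qed.

(** The increment is the time integral of the velocity. After Fubini, each time s in ]0, t[
    contributes E[F W0] whatever s is, so the sum is t E[F W0]. *)
Lemma orthogonality (F : borel 'rV[R]_d -> R) t i : measurable_fun setT F ->
  (forall x, `|F x| <= 1) -> 0 <= t -> t < T ->
  \int[eta]_g (F (position g t) * (position g t 0 i - e0 g 0 i - t * W0 g 0 i)) = 0.
Proof.
move=> mF F1 t0 tT.
have mFp : measurable_fun setT (fun g : borel Gam => F (position g t)).
  exact: (measurableT_comp mF (measurable_position_row t0 tT)).
have mpos : measurable_fun setT (fun g : borel Gam => position g t 0 i).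
  by apply: measurable_position => //; rewrite (le_trans _ t0)// lerN10.
pose h (z : RT * borel Gam) : \bar R := (F (position z.2 t) * speed i z)%:E.
have mh : measurable_fun setT h.
  apply/measurable_EFinP; apply: measurable_funM; last exact: measurable_speed.
  by apply: (measurableT_comp mFp); exact: measurable_snd.
have bh : (\int[eta]_g \int[mu]_(s in `]0%R, t[) `|h (s, g)| < +oo)%E.
  apply: le_lt_trans (integral_abs_speed_lty i); apply: ge0_le_integral => //.
  - by move=> g _; apply: integral_ge0 => s _.
  - apply: (@measurable_integral_partial _ _ RT (borel Gam) R mu _ (mI 0 t)
      (fun z => `|h z|)%E) => //; exact: measurableT_comp.
  - apply: (@measurable_integral_partial _ _ RT (borel Gam) R mu _ (mI 0 T)
      (fun z => (`|speed i z|)%:E)) => //.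
    by apply/measurable_EFinP; apply: measurableT_comp => //; exact: measurable_speed.
  move=> g _; apply: (@le_trans _ _ (\int[mu]_(s in `]0%R, t[) (`|speed i (s, g)|%R)%:E)%E).
    apply: ge0_le_integral => //.
    - apply: measurableT_comp => //; apply: measurable_funTS.
      apply/measurable_EFinP.
      exact: (measurable_funM (@measurable_cst _ _ RT R setT (F (position g t)))
        (measurable_speed_curve T0 i g)).
    - by apply/measurable_EFinP; apply: measurable_funTS; apply: measurableT_comp => //;
        exact: measurable_speed_curve.
    by move=> s _; rewrite /h/= lee_fin normrM ler_piMl.
  apply: ge0_subset_integral => //.
  - by apply/measurable_EFinP; apply: measurable_funTS; apply: measurableT_comp => //;
      exact: measurable_speed_curve.
  - by apply: subset_itvl; rewrite bnd_simp ltW.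
have iW : eta.-integrable setT (EFin \o (fun g : borel Gam => F (position g t) * W0 g 0 i)).
  by apply: (integrable_boundedM mFp _ (integrable_W0 i)) => g; exact: F1.
have iD : eta.-integrable setT
    (EFin \o (fun g : borel Gam => F (position g t) * (position g t 0 i - e0 g 0 i))).
  apply: (integrable_boundedM mFp (fun g => F1 (position g t))).
  by have := integrableB measurableT (integrable_position i t0 tT) (integrable_e0 i).
pose k (g : borel Gam) := (F (position g t) * (position g t 0 i - e0 g 0 i))%:E.
have mk : measurable_fun setT k by exact: measurable_int iD.
pose c := \int[eta]_g (F (position g t) * W0 g 0 i).
have kE : {ae eta, forall g : borel Gam, (\int[mu]_(s in `]0%R, t[) h (s, g) = k g)%E}.
  apply: filterS (ae_Gamma_W12 MG) => g Wg.
  have [isp e] := position_increment T0 i Wg (lexx 0) t0 (ltW tT).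
  rewrite /k /e0 e /h.
  transitivity (\int[mu]_(s in `]0%R, t[)
      ((F (position g t))%:E * (EFin \o (fun s => speed i (s, g))) s))%E.
    by apply: eq_integral => s _; rewrite EFinM.
  rewrite (integralZl (mI 0 t) isp) EFinM /Rintegral fineK//.
  exact: (integrable_fin_num (mI 0 t) isp).
have cE : {ae mu, forall s : RT, `]0, t[%classic s -> (\int[eta]_g h (s, g) = c%:E)%E}.
  apply: filterS (ae_speed_cond_exp i mF F1 t0 tT) => s + sI => /(_ sI)[isp e].
  by rewrite /c -e /Rintegral fineK//; exact: (integrable_fin_num measurableT isp).
have hk : (\int[eta]_y k y = c%:E * t%:E)%E.
  have <- : mu (`]0, t[%classic : set R) = t%:E.
    rewrite lebesgue_measure_itv/= lte_fin; case: ltP => h0; rewrite ?oppr0 ?adde0//.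
    by congr EFin; apply/eqP; rewrite eq_le t0 h0.
  exact: (fubini_partial_ae (mI 0 t) mh bh mk kE cE).
transitivity (\int[eta]_g (F (position g t) * (position g t 0 i - e0 g 0 i)
    - t * (F (position g t) * W0 g 0 i))).
  by apply: eq_Rintegral => g _; ring.
have itW : eta.-integrable setT
    (EFin \o (fun g : borel Gam => t * (F (position g t) * W0 g 0 i))).
  by have := integrableZl measurableT t iW; apply: eq_integrable => // g _; rewrite /= EFinM.
rewrite RintegralB// RintegralZl// -/c {1}/Rintegral.
by rewrite [X in fine X]hk -EFinM /= mulrC subrr.
Qed.

Let muI a b : a <= b -> mu (`]a, b[%classic : set R) = (b - a)%:E.
Proof.
move=> ab; rewrite lebesgue_measure_itv/= lte_fin; case: ltP => h0; rewrite -?EFinB//.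
by congr EFin; apply/eqP; rewrite eq_sym subr_eq0 eq_le ab h0.
Qed.

(** At almost every time the velocity is a conditional expectation of W0, so Jensen bounds its mean
    excess by that of W0; integration over ]0, T[ adds the factor T. *)
Lemma integral_excess_speed (M : R) i : 0 <= M ->
  (\int[eta]_g \int[mu]_(s in `]0%R, T[) (excess M (speed i (s, g)))%:E <=
   T%:E * \int[eta]_g (excess M (W0 g 0 i))%:E)%E.
Proof.
move=> M0; pose h (z : RT * borel Gam) := (excess M (speed i z))%:E.
have mh : measurable_fun setT h.
  apply/measurable_EFinP; exact: (measurableT_comp (measurable_excess M) (measurable_speed T0 i)).
have h0 z : (0 <= h z)%E by rewrite lee_fin excess_ge0.
rewrite [leLHS](ge0_fubini_partial mu (mI 0 T) eta mh h0).
set E := (\int[eta]_g _)%E.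
have E0 : (0 <= E)%E by apply: integral_ge0 => g _; rewrite lee_fin excess_ge0.
have mW : measurable_fun setT (fun g : borel Gam => excess M (W0 g 0 i)).
  exact: (measurableT_comp (measurable_excess M) (measurable_W0 i)).
have sE : (\int[mu]_(s in `]0%R, T[) E = T%:E * E)%E.
  by rewrite integral_cst// muleC -[X in _ = (X%:E * _)%E]subr0 -(muI (ltW T0)).
rewrite -sE; apply: ae_ge0_le_integral => //.
- by move=> s _; exact: integral_ge0.
- apply: measurable_funTS.
  exact: (measurable_fun_fubini_tonelli_F (m2:=eta) _ mh h0).
apply: filterS (dissipative_speed deta) => s hs; rewrite /= in_itv/= => /andP[s0 sT].
have [|om [h1 h2 h3]] := hs; first by rewrite in_itv/= (ltW s0).
have s1 : -1 <= s by rewrite (le_trans _ (ltW s0))// lerN10.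
have mT := @measurable_Trestr R d T s s1.
have J := integral_cond_exp_excess mT h1 h2 (@measurable_set1_L2 s T) M0 (integrable_W0 i).
apply: le_trans J; rewrite le_eqVlt; apply/orP; left; apply/eqP.
have mc := measurable_cond_exp om (measurable_W0 i).
apply: ae_eq_integral => //.
- by apply/measurable_EFinP; apply: (measurableT_comp (measurable_excess M));
    exact: measurable_speed_time.
- apply/measurable_EFinP; apply: (measurableT_comp (measurable_excess M)).
  exact: (measurableT_comp mc mT).
- by apply: filterS h3 => g sg _; rewrite /h sg.
Qed.

(** An increment is at most M (t - s) plus the total excess of the speed over M. Markov's inequality
    for this total excess, summed over coordinates, makes it less than rho off a set of controlled
    mass. The set does not depend on s and t. *)
Lemma increment_bound (M rho : R) : 0 <= M -> 0 < rho ->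
  exists A : set (borel Gam), [/\ measurable A,
    (rho%:E * eta (~` A) <= \sum_(i < d) (T%:E * \int[eta]_g (excess M (W0 g 0 i))%:E))%E &
    forall g, A g -> forall i s t, 0 <= s -> s <= t -> t < T ->
      `|position g t 0 i - position g s 0 i| <= M * (t - s) + rho].
Proof.
move=> M0 r0.
pose N i (g : borel Gam) := (\int[mu]_(s in `]0%R, T[) (excess M (speed i (s, g)))%:E)%E.
have N0 i g : (0 <= N i g)%E by apply: integral_ge0 => s _; rewrite lee_fin excess_ge0.
have mN i : measurable_fun setT (N i).
  apply: (@measurable_integral_partial _ _ RT (borel Gam) R mu _ (mI 0 T)
    (fun z => (excess M (speed i z))%:E)) => [|z]; last by rewrite lee_fin excess_ge0.
  apply/measurable_EFinP; exact: (measurableT_comp (measurable_excess M) (measurable_speed T0 i)).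
pose S g := (\sum_(i < d) N i g)%E.
have mS : measurable_fun setT S by exact: emeasurable_sum.
have S0 g : (0 <= S g)%E by exact: sume_ge0.
pose B := [set g : borel Gam | (rho%:E <= `|S g|)%E].
have mB : measurable B.
  rewrite -[X in measurable X]setTI; apply: emeasurable_fun_c_infty => //.
  exact: measurableT_comp.
have mW := @measurable_Gamma_W12 R d T T0.
pose W : set (borel Gam) := @Gamma_W12 R d T.
exists (W `&` ~` B); split.
- by apply: measurableI => //; exact: measurableC.
- have eW : eta (~` W) = 0%E.
    apply/(negligibleP _ (measurableC mW)); exact: (ae_Gamma_W12 MG).
  rewrite setCI setCK.
  apply: (@le_trans _ _ (rho%:E * eta B)%E).
    rewrite lee_pmul2l ?lte_fin//.
    apply: le_trans (measureU2 eta (measurableC mW) mB) _.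
    by rewrite [X in (X + _)%E]eW add0e.
  have := le_integral_abse eta measurableT mS r0; rewrite setTI => /le_trans; apply.
  under eq_integral do rewrite gee0_abs//.
  rewrite ge0_integral_sum//; apply: lee_sum => i _; exact: integral_excess_speed.
move=> g [Wg /negP]; rewrite -ltNge gee0_abs// => Sg i s t s0 st tT.
have [isp e] := position_increment T0 i Wg s0 st (ltW tT).
have mSp := measurable_speed_curve T0 i g.
have mex : measurable_fun setT (fun s : RT => (excess M (speed i (s, g)))%:E).
  by apply/measurable_EFinP; exact: (measurableT_comp (measurable_excess M) mSp).
rewrite -lee_fin e /Rintegral -abse_EFin fineK; last exact: (integrable_fin_num (mI s t) isp).
apply: le_trans (le_abse_integral mu (mI s t) (measurable_int _ isp)) _.
apply: (@le_trans _ _ (\int[mu]_(r in `]s, t[) (M%:E + (excess M (speed i (r, g)))%:E))%E).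
  apply: ge0_le_integral => //.
  - by apply/measurable_EFinP; apply: measurable_funTS; exact: measurableT_comp.
  - by apply: emeasurable_funD => //; exact: measurable_funTS.
  - move=> r _; rewrite /= -EFinD lee_fin -lerBlDl le_max; apply/orP; right; exact: lexx.
rewrite ge0_integralD//; last 2 first.
- by move=> r _; rewrite lee_fin excess_ge0.
- exact: measurable_funTS.
rewrite EFinD; apply: leeD.
  by rewrite integral_cst// EFinM -(muI st).
apply: (@le_trans _ _ (N i g)).
  apply: ge0_subset_integral => //.
  - exact: measurable_funTS.
  - by move=> r _; rewrite lee_fin excess_ge0.
  - by apply: subset_itv; rewrite bnd_simp// ltW.
apply: le_trans (ltW Sg); rewrite /S (bigD1 i)//= leeDl//.
exact: sume_ge0.
Qed.

End with_data.
End dissipative_speed.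


(** * Guessing the line from the position *)

Section free_lines.
Context {R : realType} (d K : nat) (p : 'I_K -> 'rV[R]_d * 'rV[R]_d) (T r C0 : R).
Hypotheses (T0 : 0 < T) (r0 : 0 < r) (C00 : 0 <= C0).

Definition line (z : 'rV[R]_d * 'rV[R]_d) (t : R) : 'rV[R]_d := z.1 + t *: z.2.

Hypothesis sep : forall k k' t, k != k' -> 0 <= t -> t <= T ->
  2 * r <= `|line (p k) t - line (p k') t|.
Hypothesis bnd : forall k t i, 0 <= t -> t <= T -> `|line (p k) t 0 i| <= C0.

(* The position of the only line passing close to [y] at time [t]. *)
Definition near_line (t : R) (y : 'rV[R]_d) i : R :=
  \sum_k (if `|y - line (p k) t| < r then line (p k) t 0 i else 0).

(** The lines are 2r apart at every time, so at most one open ball of radius r contains y and the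
    sum has a single nonzero term. *)
Lemma near_lineE t y i k : 0 <= t -> t <= T -> `|y - line (p k) t| < r ->
  near_line t y i = line (p k) t 0 i.
Proof.
move=> t0 tT yk; rewrite /near_line (bigD1 k)//= yk big1 ?addr0// => k' kk'.
rewrite ifN// -leNgt.
have := sep kk' t0 tT; rewrite -(subrKA y) => /le_trans /(_ (ler_normD _ _)).
rewrite -opprB normrN; move: yk; lra.
Qed.

Lemma near_line_bound t y i : 0 <= t -> t <= T -> `|near_line t y i| <= K%:R * C0.
Proof.
move=> t0 tT; apply: le_trans (ler_norm_sum _ _ _) _.
rewrite -[K in leRHS]card_ord mulr_natl -sumr_const; apply: ler_sum => k _.
by case: ifP => _; rewrite ?normr0// bnd.
Qed.

Lemma measurable_near_line t i :
  measurable_fun setT (fun y : borel 'rV[R]_d => near_line t y i).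
Proof.
apply: measurable_sum => k; apply: measurable_fun_ifT => //.
apply: (measurable_fun_bool true); rewrite setTI.
rewrite (_ : _ @^-1` _ = id @^-1` ball (line (p k) t) r).
  by apply: (@measurable_preimage_ball _ (borel 'rV[R]_d) R d id) => j; exact: measurable_coord.
by apply/seteqP; split => y; rewrite -ball_normE/= distrC.
Qed.

End free_lines.

(** * Propagation of small drift in short time steps *)

Section stability.
Context dd (X : measurableType dd) (R : realType) (P : probability X R) (d K : nat).
Variables (p : 'I_K -> 'rV[R]_d * 'rV[R]_d) (T r C0 M h e : R).
Hypotheses (T0 : 0 < T) (r0 : 0 < r) (C00 : 0 <= C0) (M0 : 0 <= M) (h0 : 0 < h).
Hypotheses (e0 : 0 < e) (e1 : e <= 1) (er : e * (1 + T) <= r / 2).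
Hypothesis sep : forall k k' t, k != k' -> 0 <= t -> t <= T ->
  2 * r <= `|line (p k) t - line (p k') t|.
Hypothesis bnd : forall k t i, 0 <= t -> t <= T -> `|line (p k) t 0 i| <= C0.
Hypothesis vbnd : forall k, `|(p k).2| <= M.
Hypothesis hM : (M + M + 1) * h <= r / 8.

Variables (x v : X -> 'rV[R]_d) (pos : R -> X -> 'rV[R]_d).
Hypothesis mx : forall i, measurable_fun setT (fun w => x w 0 i).
Hypothesis mv : forall i, measurable_fun setT (fun w => v w 0 i).
Hypothesis mpos : forall t, 0 <= t -> t < T -> measurable_fun setT (pos t : X -> borel 'rV[R]_d).
Hypothesis ipos : forall t i, 0 <= t -> t < T -> P.-integrable setT (EFin \o (fun w => pos t w 0 i)).
Hypothesis x2 : forall i, (\int[P]_w (x w 0 i ^+ 2)%:E <= 1)%E.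
Hypothesis v2 : forall i, (\int[P]_w (v w 0 i ^+ 2)%:E <= 1)%E.
Hypothesis pos0 : forall w, pos 0 w = x w.
Hypothesis orth : forall (F : borel 'rV[R]_d -> R) t i, measurable_fun setT F ->
  (forall y, `|F y| <= 1) -> 0 <= t -> t < T ->
  \int[P]_w (F (pos t w) * (pos t w 0 i - x w 0 i - t * v w 0 i)) = 0.
Variable G : set X.
Hypothesis mG : measurable G.
Hypothesis PG : (P (~` G) <= (e ^+ 2)%:E)%E.
Hypothesis nearG : forall w, G w -> exists k, `|x w - (p k).1| <= e /\ `|v w - (p k).2| <= e.
Hypothesis incG : forall w, G w -> forall i s t, 0 <= s -> s <= t -> t < T ->
  `|pos t w 0 i - pos s w 0 i| <= M * (t - s) + r / 8.

Definition drift t w : 'rV[R]_d := pos t w - line (x w, v w) t.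

Lemma line_near w k t : 0 <= t -> t <= T -> `|x w - (p k).1| <= e -> `|v w - (p k).2| <= e ->
  `|line (x w, v w) t - line (p k) t| <= e * (1 + T).
Proof.
move=> t0 tT xk vk; rewrite /line/=.
rewrite (_ : _ - _ = (x w - (p k).1) + t *: (v w - (p k).2)); last first.
  by rewrite scalerBr opprD addrACA.
apply: le_trans (ler_normD _ _) _; rewrite mulrDr mulr1 lerD// normrZ ger0_norm//.
by rewrite mulrC ler_pM.
Qed.

Lemma coord_le_norm (y : 'rV[R]_d) i : `|y 0 i| <= `|y|.
Proof. by rewrite [leRHS]/Num.norm/= mx_normrE; exact: (le_bigmax _ (fun k : 'I_1 * 'I_d => `|y k.1 k.2|) (ord0, i)). Qed.

Lemma norm_le_coord (y : 'rV[R]_d) c : 0 <= c -> (forall i, `|y 0 i| <= c) -> `|y| <= c.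
Proof.
move=> c0 yc; rewrite [leLHS]/Num.norm/= mx_normrE; apply: bigmax_le => // -[j i] _ /=.
by rewrite ord1.
Qed.

Lemma norm_le_sum (y : 'rV[R]_d) : `|y| <= \sum_i `|y 0 i|.
Proof.
apply: norm_le_coord => [|i]; first exact: sumr_ge0.
by rewrite (bigD1 i)//= lerDl sumr_ge0.
Qed.

(** Over a step of length at most h the position moves by at most M h + r/8 and the free motion by
    at most (M + 1) h; the choice of h makes the sum at most r/4. *)
Lemma drift_increment w k s t : G w -> `|v w - (p k).2| <= e ->
  0 <= s -> s <= t -> t < T -> t - s <= h -> `|drift t w - drift s w| <= r / 4.
Proof.
move=> Gw vk s0 st tT tsh.
have ts0 : 0 <= t - s by rewrite subr_ge0.
have E : drift t w - drift s w = (pos t w - pos s w) - (t - s) *: v w.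
  by rewrite /drift /line/= scalerBl; apply/rowP => i; rewrite !mxE; ring.
have vM : `|v w| <= M + 1.
  by rewrite -[v w](subrK (p k).2) (le_trans (ler_normD _ _))// addrC lerD// (le_trans vk).
rewrite E; apply: le_trans (ler_normB _ _) _.
rewrite normrZ ger0_norm//.
have h1 : `|pos t w - pos s w| <= M * (t - s) + r / 8.
  apply: norm_le_coord => [|i]; last by rewrite !mxE; exact: incG.
  by rewrite addr_ge0 ?mulr_ge0// ?divr_ge0// ltW.
have h2 : (t - s) * `|v w| <= (t - s) * (M + 1) by rewrite ler_wpM2l.
have h3 : (M + M + 1) * (t - s) <= (M + M + 1) * h.
  by rewrite ler_wpM2l// !addr_ge0.
have E2 : (M + M + 1) * (t - s) = M * (t - s) + (t - s) * (M + 1) by ring.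
by move: hM h1 h2 h3; rewrite E2; lra.
Qed.

(** [C2] bounds the guess and [C3] bounds the distance of the free position to a wrong guess: C0 + r
    for the former, C2 for the latter. *)
Let C2 := K%:R * C0.
Let C3 := C0 + C2 + r.

(** Three cases, one per term. If the drift at t is below r/2, the guess is the right line and the
    error is that of the data. If not, the drift was already at least r/4 at time s, and the bound
    [C3] is paid through Markov's inequality. Off [G] only the trivial bound is available. *)
Lemma line_near_line w i s t : 0 <= s -> s <= t -> t < T -> t - s <= h ->
  `|line (x w, v w) t 0 i - near_line p r t (pos t w) i| <=
  e * (1 + T) + C3 * (4 / r) * (\sum_j `|drift s w 0 j|) +
  \1_(~` G) w * (`|x w 0 i| + T * `|v w 0 i| + C2).
Proof.
move=> s0 st tT tsh; have t0 := le_trans s0 st.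
have eT : 0 <= e * (1 + T) by rewrite mulr_ge0 ?addr_ge0// ltW.
have C20 : 0 <= C2 by rewrite mulr_ge0.
have C30 : 0 <= C3 by rewrite !addr_ge0// ltW.
have C3r : 0 <= C3 * (4 / r) by rewrite mulr_ge0// divr_ge0// ltW.
have S0 : 0 <= \sum_j `|drift s w 0 j| by exact: sumr_ge0.
have nb := near_line_bound r C00 bnd (pos t w) i t0 (ltW tT).
have [Gw|nGw] := pselect (G w); last first.
  rewrite indicE mem_set// mul1r.
  apply: (@le_trans _ _ (`|x w 0 i| + T * `|v w 0 i| + C2)); last first.
    by rewrite lerDr addr_ge0// mulr_ge0.
  apply: le_trans (ler_normB _ _) _; rewrite lerD// /line/= !mxE.
  apply: le_trans (ler_normD _ _) _; rewrite lerD2l normrM ger0_norm//.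
  by rewrite ler_wpM2r// ltW.
rewrite indicE memNset ?mul0r ?addr0; last by move=> /(_ Gw).
have [k [xk vk]] := nearG Gw.
have lk := line_near t0 (ltW tT) xk vk.
have lki : `|line (x w, v w) t 0 i - line (p k) t 0 i| <= e * (1 + T).
  by apply: le_trans lk; have := coord_le_norm (line (x w, v w) t - line (p k) t) i; rewrite !mxE.
have [Zt|Zt] := ltP `|drift t w| (r / 2).
  rewrite (near_lineE sep i t0 (ltW tT) (k := k)).
    by rewrite (le_trans lki)// lerDl mulr_ge0.
  rewrite -(subrKA (line (x w, v w) t)) (le_lt_trans (ler_normD _ _))//.
  by move: Zt lk er; rewrite /drift; lra.
(* A drift of at least r/2 at t, of which at most r/4 was acquired since s. *)
have Zs : r / 4 <= \sum_j `|drift s w 0 j|.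
  apply: le_trans (norm_le_sum _).
  have := drift_increment Gw vk s0 st tT tsh.
  have := lerB_normD (drift t w) (drift s w - drift t w).
  rewrite [X in _ <= `|X| -> _]addrC.
  rewrite addrNK -(opprB (drift t w)) normrN; move: Zt; lra.
apply: (@le_trans _ _ C3).
  apply: le_trans (ler_normB _ _) _; rewrite /C3 addrAC lerD//.
  have := bnd k i t0 (ltW tT); move: lki er.
  have := ler_normD (line (x w, v w) t 0 i - line (p k) t 0 i) (line (p k) t 0 i).
  by rewrite subrK; move: r0; lra.
rewrite -[leLHS]add0r lerD// -mulrA ler_peMr//.
rewrite -(@ler_pM2l _ (r / 4)) ?divr_gt0// mulr1 mulrA.
by rewrite (_ : r / 4 * (4 / r) = 1) ?mul1r//; field; rewrite gt_eqF.
Qed.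

Let mGc : measurable (~` G). Proof. exact: measurableC. Qed.

Let mind : measurable_fun setT (\1_(~` G) : X -> R).
Proof. exact: measurable_indic. Qed.

Let ind1 w : `|\1_(~` G) w : R| <= 1.
Proof. by rewrite indicE; case: (_ \in _); rewrite ?normr1 ?normr0. Qed.

Let integrable1 (u : X -> R) : measurable_fun setT u ->
  (\int[P]_w (u w ^+ 2)%:E <= 1)%E -> P.-integrable setT (EFin \o u).
Proof.
by move=> mu u2; apply: integrable_sqr_moment => //; rewrite (le_lt_trans u2)// ltry.
Qed.

(* AM-GM: [1 * |u| <= e / 2 * u ^ 2 + 1 / (2 e)] on the bad set. *)
Lemma bad_moment (u : X -> R) : measurable_fun setT u -> (\int[P]_w (u w ^+ 2)%:E <= 1)%E ->
  P.-integrable setT (EFin \o (fun w => \1_(~` G) w * `|u w|)) /\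
  \int[P]_w (\1_(~` G) w * `|u w|) <= e.
Proof.
move=> mu u2.
have iu := integrable_boundedM mind ind1 (integrable_normr (integrable1 mu u2)).
split => //.
have mu2 : measurable_fun setT (fun w => (u w ^+ 2)%:E).
  by apply/measurable_EFinP; exact: measurable_funX.
rewrite -lee_fin /Rintegral fineK; last exact: (integrable_fin_num measurableT iu).
apply: (@le_trans _ _ (\int[P]_w ((e / 2)%:E * (u w ^+ 2)%:E +
    (e^-1 / 2)%:E * (\1_(~` G) w)%:E))%E).
  apply: ge0_le_integral => //.
  - exact: (measurable_int _ iu).
  - by apply: emeasurable_funD; apply: measurable_funeM => //; exact/measurable_EFinP.
  move=> w _; rewrite /= -!EFinM -EFinD lee_fin indicE.
  case: (_ \in _); last by rewrite mul0r mulr0 addr0 mulr_ge0 ?sqr_ge0// divr_ge0// ltW.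
  rewrite mul1r mulr1 -(real_normK (num_real (u w))).
  rewrite -(@ler_pM2l _ (2 * e)) ?mulr_gt0//.
  have -> : 2 * e * (e / 2 * `|u w| ^+ 2 + e^-1 / 2) = (e * `|u w|) ^+ 2 + 1.
    by field; rewrite gt_eqF.
  by have := sqr_ge0 (e * `|u w| - 1); lra.
rewrite ge0_integralD//; last 4 first.
- by move=> w _; rewrite mule_ge0 ?lee_fin ?sqr_ge0// divr_ge0// ltW.
- exact: measurable_funeM.
- by move=> w _; rewrite mule_ge0 ?lee_fin ?divr_ge0 ?invr_ge0 ?indicE// ltW.
- by apply: measurable_funeM; exact/measurable_EFinP.
rewrite !ge0_integralZl//; last 4 first.
- exact/measurable_EFinP.
- by rewrite lee_fin divr_ge0// invr_ge0 ltW.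
- by move=> w _; rewrite lee_fin sqr_ge0.
- by rewrite lee_fin divr_ge0// ltW.
rewrite integral_indic// setIT.
have -> : e%:E = ((e / 2)%:E * 1 + (e^-1 / 2)%:E * (e ^+ 2)%:E)%E.
  by rewrite mule1 -EFinM -EFinD; congr EFin; field; rewrite gt_eqF.
by apply: leeD; apply: lee_wpmul2l => //; rewrite lee_fin divr_ge0 ?invr_ge0// ltW.
Qed.

Let ix i : P.-integrable setT (EFin \o (fun w => x w 0 i)). Proof. exact: integrable1. Qed.
Let iv i : P.-integrable setT (EFin \o (fun w => v w 0 i)). Proof. exact: integrable1. Qed.

Let iline t i : P.-integrable setT (EFin \o (fun w => line (x w, v w) t 0 i)).
Proof.
have i1 : P.-integrable setT (EFin \o (fun w => t * v w 0 i)).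
  by have := integrableZl measurableT t (iv i); apply: eq_integrable => // g _; rewrite /= EFinM.
have := integrableD measurableT (ix i) i1; apply: eq_integrable => // w _.
by rewrite /line /= !mxE.
Qed.

Let idrift t i : 0 <= t -> t < T -> P.-integrable setT (EFin \o (fun w => drift t w 0 i)).
Proof.
move=> t0 tT; have := integrableB measurableT (ipos i t0 tT) (iline t i).
by apply: eq_integrable => // w _; rewrite /drift /= !mxE.
Qed.

Let phi t i w := near_line p r t (pos t w) i.

Let iphi t i : 0 <= t -> t < T -> P.-integrable setT (EFin \o (phi t i)).
Proof.
move=> t0 tT; apply: (@integrable_bounded _ _ _ _ _ C2).
  exact: (measurableT_comp (measurable_near_line p r t i) (mpos t0 tT)).
by move=> w; apply: (near_line_bound _ _ bnd) => //; exact: ltW.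
Qed.

(** The guess phi is a function of pos(t), and so is F, the sign of pos(t) - phi. Hence E|pos(t) -
    phi| = E[F (pos(t) - phi)], where orthogonality replaces pos(t) by the free position; this is at
    most E|free - phi|. The triangle inequality through phi gives the factor 2. *)
Lemma drift_le_near_line t i : 0 <= t -> t < T ->
  \int[P]_w `|drift t w 0 i| <= 2 * \int[P]_w `|line (x w, v w) t 0 i - phi t i w|.
Proof.
move=> t0 tT.
pose F (y : borel 'rV[R]_d) : R := if 0 <= y 0 i - near_line p r t y i then 1 else -1.
have mF : measurable_fun setT F.
  apply: measurable_fun_ifT => //; apply: measurable_fun_ler => //.
  by apply: measurable_funB; [exact: measurable_coord|exact: measurable_near_line].
have F1 y : `|F y| <= 1 by rewrite /F; case: ifP => _; rewrite ?normrN normr1.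
have mFp := measurableT_comp mF (mpos t0 tT).
have FE y : F y * (y 0 i - near_line p r t y i) = `|y 0 i - near_line p r t y i|.
  rewrite /F; have [u0|u0] := leP 0 (y 0 i - near_line p r t y i).
    by rewrite mul1r ger0_norm.
  by rewrite mulN1r ltr0_norm.
have iB1 : P.-integrable setT (EFin \o (fun w => pos t w 0 i - phi t i w)).
  by have := integrableB measurableT (ipos i t0 tT) (iphi i t0 tT).
have iB2 : P.-integrable setT (EFin \o (fun w => line (x w, v w) t 0 i - phi t i w)).
  by have := integrableB measurableT (iline t i) (iphi i t0 tT).
have FB w : `|F (pos t w)| <= 1 by exact: F1.
have iF u : P.-integrable setT (EFin \o u) ->
    P.-integrable setT (EFin \o (fun w => F (pos t w) * u w)).
  by move=> iu; exact: (integrable_boundedM mFp FB iu).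
have key : \int[P]_w `|pos t w 0 i - phi t i w| <=
    \int[P]_w `|line (x w, v w) t 0 i - phi t i w|.
  have -> : \int[P]_w `|pos t w 0 i - phi t i w| =
      \int[P]_w (F (pos t w) * (line (x w, v w) t 0 i - phi t i w)).
    transitivity (\int[P]_w (F (pos t w) * (line (x w, v w) t 0 i - phi t i w) +
        F (pos t w) * drift t w 0 i)).
      by apply: eq_Rintegral => w _; rewrite -mulrDr -FE /drift /phi !mxE; congr (_ * _); ring.
    rewrite RintegralD//; [|exact: iF|by apply: iF; exact: idrift].
    have -> : \int[P]_w (F (pos t w) * drift t w 0 i) = 0; last by rewrite addr0.
    rewrite -[RHS](orth i mF F1 t0 tT); apply: eq_Rintegral => w _.
    by rewrite /drift /line !mxE /=; congr (_ * _); ring.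
  apply: le_Rintegral => //; [exact: iF|exact: integrable_normr|move=> w _].
  by rewrite (le_trans (ler_norm _))// normrM ler_piMl.
apply: (@le_trans _ _ (\int[P]_w (`|pos t w 0 i - phi t i w| +
    `|line (x w, v w) t 0 i - phi t i w|))).
  apply: le_Rintegral => //; first by apply: integrable_normr; exact: idrift.
    by have := integrableD measurableT (integrable_normr iB1) (integrable_normr iB2).
  move=> w _; rewrite /drift !mxE -(subrKA (phi t i w)) (distrC (_ + _) (phi t i w)).
  by rewrite (le_trans (ler_normD _ _))// lerD2l distrC.
rewrite RintegralD//; [|exact: integrable_normr|exact: integrable_normr].
by rewrite mulr_natl mulr2n lerD2r.
Qed.

Definition total_drift t : R := \sum_i \int[P]_w `|drift t w 0 i|.

(** One factor d for the coordinates and 2 from [drift_le_near_line]; the three summands come from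
    the earlier drift, from the error e (1 + T) of the data, and from the bad set, where x, T v and
    [C2] cost e, T e and C2 e. It does not involve e. *)
Definition step_factor : R := d%:R * (2 * (C3 * (4 / r) + (1 + T) + (1 + T + C2))).

Lemma total_drift_step s t : 0 <= s -> s <= t -> t < T -> t - s <= h ->
  total_drift t <= step_factor * (total_drift s + e).
Proof.
move=> s0 st tT tsh; have t0 := le_trans s0 st; have sT := le_lt_trans st tT.
have C20 : 0 <= C2 by rewrite mulr_ge0.
have C30 : 0 <= C3 by rewrite !addr_ge0// ltW.
have C3r : 0 <= C3 * (4 / r) by rewrite mulr_ge0// divr_ge0// ltW.
have a0 : 0 <= total_drift s by apply: sumr_ge0 => i _; apply: Rintegral_ge0.
rewrite /step_factor -mulrA -[d in leRHS]card_ord mulr_natl -sumr_const; apply: ler_sum => i _.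
apply: le_trans (drift_le_near_line i t0 tT) _; rewrite -mulrA ler_pM2l//.
have iS : P.-integrable setT (EFin \o (fun w => \sum_j `|drift s w 0 j|)).
  rewrite (_ : _ \o _ = fun w => (\sum_j (`|drift s w 0 j|)%:E)%E); last first.
    by apply/funext => w; rewrite /= sumEFin.
  by apply: integrable_sum => // j _; apply: integrable_normr; exact: idrift.
have [ibx bx] := bad_moment (mx i) (x2 i).
have [ibv bv] := bad_moment (mv i) (v2 i).
have iG : P.-integrable setT (EFin \o (\1_(~` G) : X -> R)).
  exact: (integrable_bounded P mind ind1).
have Ze (c : R) (u : X -> R) : P.-integrable setT (EFin \o u) ->
    P.-integrable setT (EFin \o (fun w => c * u w)).
  by move=> iu; have := integrableZl measurableT c iu; apply: eq_integrable => // w _; rewrite /= EFinM.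
have De (u1 u2 : X -> R) : P.-integrable setT (EFin \o u1) -> P.-integrable setT (EFin \o u2) ->
    P.-integrable setT (EFin \o (fun w => u1 w + u2 w)).
  by move=> i1 i2; have := integrableD measurableT i1 i2.
have icst : P.-integrable setT (EFin \o (fun _ : X => e * (1 + T))).
  by apply: (@integrable_bounded _ _ _ _ _ `|e * (1 + T)|).
pose U w := e * (1 + T) + C3 * (4 / r) * (\sum_j `|drift s w 0 j|) +
  (\1_(~` G) w * `|x w 0 i| + (T * (\1_(~` G) w * `|v w 0 i|) + C2 * \1_(~` G) w)).
have i4 := De _ _ (Ze T _ ibv) (Ze C2 _ iG).
have i3 := De _ _ ibx i4.
have i2 := De _ _ icst (Ze (C3 * (4 / r)) _ iS).
have iU : P.-integrable setT (EFin \o U) by exact: De i2 i3.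
apply: (@le_trans _ _ (\int[P]_w U w)).
  apply: le_Rintegral => //.
    by apply: integrable_normr; have := integrableB measurableT (iline t i) (iphi i t0 tT).
  move=> w _; apply: le_trans (line_near_line w i s0 st tT tsh) _.
  by rewrite /U lerD2l; rewrite le_eqVlt; apply/orP; left; apply/eqP; ring.
have PGe : fine (P (~` G)) <= e ^+ 2.
  by rewrite -lee_fin fineK// fin_num_measure.
rewrite /U RintegralD// RintegralD//; last exact: Ze.
rewrite (RintegralD measurableT ibx i4) (RintegralD measurableT (Ze T _ ibv) (Ze C2 _ iG)).
have -> : \int[P]_w (e * (1 + T)) = e * (1 + T).
  by rewrite (@Rintegral_cst _ _ _ P setT measurableT) [X in fine X]probability_setT mulr1.
rewrite !RintegralZl//.
have -> : \int[P]_w (\1_(~` G) w) = fine (P (~` G)).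
  by rewrite /Rintegral integral_indic// setIT.
have -> : \int[P]_w (\sum_j `|drift s w 0 j|) = total_drift s.
  rewrite /total_drift /Rintegral.
  under eq_integral do rewrite -sumEFin.
  rewrite integral_sum//; last by move=> j *; apply: integrable_normr; exact: idrift.
  rewrite -sum_fine// => j _; apply: (integrable_fin_num measurableT).
  by apply: integrable_normr; exact: idrift.
have hv : T * \int[P]_w (\1_(~` G) w * `|v w 0 i|) <= T * e by rewrite ler_pM2l.
have hG : C2 * fine (P (~` G)) <= C2 * e.
  by rewrite ler_wpM2l// (le_trans PGe)// expr2 ler_piMr// ltW.
have h5 : 0 <= (1 + T + (1 + T + C2)) * total_drift s.
  by rewrite mulr_ge0// !addr_ge0// ltW.
have h6 : 0 <= C3 * (4 / r) * e by rewrite mulr_ge0// ltW.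
have E : (C3 * (4 / r) + (1 + T) + (1 + T + C2)) * (total_drift s + e) =
    e * (1 + T) + C3 * (4 / r) * total_drift s + (e + (T * e + C2 * e)) +
    (C3 * (4 / r) * e + (1 + T + (1 + T + C2)) * total_drift s) by ring.
by rewrite E; apply: ler_wpDr; rewrite ?addr_ge0// !lerD.
Qed.

(** The drift vanishes at time 0. The resulting bound is e times a number fixed by the configuration
    and by n, so e can be chosen afterwards. *)
Lemma total_drift_iter n t : 0 <= t -> t < T -> t <= n%:R * h ->
  total_drift t <= iter n (fun a => step_factor * (a + 1)) 0 * e.
Proof.
have z0 : total_drift 0 = 0.
  rewrite /total_drift big1// => i _.
  rewrite (_ : (fun w => _) = cst 0); first by rewrite Rintegral_cst// mul0r.
  by apply/funext => w; rewrite /drift /line/= pos0 scale0r addr0 subrr mxE normr0.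
have C20 : 0 <= C2 by rewrite mulr_ge0.
have C30 : 0 <= C3 by rewrite !addr_ge0// ltW.
have sf0 : 0 <= step_factor.
  rewrite /step_factor mulr_ge0// mulr_ge0// !addr_ge0//; try exact: ltW.
  by rewrite mulr_ge0// divr_ge0// ltW.
elim: n t => [|n IH] t t0 tT tn.
  have -> : t = 0 by apply/eqP; rewrite eq_le t0 andbT (le_trans tn)// mul0r.
  by rewrite mul0r z0.
(* The previous time; the truncation at 0 allows a step shorter than h. *)
pose s := Num.max 0 (t - h).
have s0 : 0 <= s by rewrite le_max lexx.
have st : s <= t by rewrite ge_max t0 gerBl ltW.
have tsh : t - s <= h by rewrite lerBlDl -lerBlDr le_max lexx orbT.
have sn : s <= n%:R * h.
  rewrite ge_max mulr_ge0 ?(ltW h0)//= lerBlDr.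
  by move: tn; rewrite -natr1 mulrDl mul1r.
have := IH s s0 (le_lt_trans st tT) sn => IHs.
apply: le_trans (total_drift_step s0 st tT tsh) _.
by rewrite iterS -mulrA ler_wpM2l// mulrDl mul1r lerD2r.
Qed.

End stability.


(** * Straight lines as L^2 curves *)

Section line_L2.
Context {R : realType} (a b : R) (d : nat) (ab : a < b).
Local Notation RT := (measurableTypeR R).
Local Notation mu := (@lebesgue_measure R).
Local Notation phase := ('rV[R]_d * 'rV[R]_d)%type.
Implicit Types z : phase.

Lemma lineE z t i : line z t 0 i = z.1 0 i + t * z.2 0 i.
Proof. by rewrite /line !mxE. Qed.

Lemma continuous_line_coord z i : continuous (fun t => line z t 0 i).
Proof.
move=> t; under eq_fun do rewrite lineE.
by apply: cvgD; [exact: cvg_cst|apply: cvgMl; exact: cvg_id].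
Qed.

Lemma measurable_line_coord z i : measurable_fun setT (fun t : RT => line z t 0 i).
Proof. by apply: continuous_measurable_fun; exact: continuous_line_coord. Qed.

Lemma enorm_le_norm (y : 'rV[R]_d) : enorm y <= d%:R * `|y|.
Proof.
apply: le_trans (enorm_le_sum y) _.
have -> : d%:R * `|y| = \sum_(i < d) `|y| by rewrite sumr_const card_ord mulr_natl.
apply: ler_sum => i _.
exact: coord_le_norm.
Qed.

Lemma norm_line z t : a <= t -> t <= b -> `|line z t| <= (1 + `|a| + `|b|) * `|z|.
Proof.
move=> at_ tb; rewrite /line; apply: le_trans (ler_normD _ _) _.
have z1 : `|z.1| <= `|z| by rewrite le_max lexx.
have z2 : `|z.2| <= `|z| by rewrite le_max lexx orbT.
have tab : `|t| <= `|a| + `|b|.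
  rewrite ler_norml; apply/andP; split.
    by have := lerNnormlW (lexx `|a|); have := normr_ge0 b; lra.
  by have := ler_norm b; have := normr_ge0 a; lra.
rewrite normrZ -addrA mulrDl mul1r lerD// ler_pM//.
Qed.

Lemma sqr_enorm_line z t : a <= t -> t <= b ->
  enorm (line z t) ^+ 2 <= (d%:R * (1 + `|a| + `|b|) * `|z|) ^+ 2.
Proof.
move=> at_ tb; rewrite lerXn2r ?nnegrE ?enorm_ge0 ?mulr_ge0 ?addr_ge0//.
by rewrite -mulrA (le_trans (enorm_le_norm _))// ler_wpM2l// norm_line.
Qed.

Lemma measurable_sqr_enorm_line z :
  measurable_fun [set: RT] (fun t : RT => (enorm (line z t) ^+ 2)%:E).
Proof. by apply: measurable_enorm_sqr => i; exact: measurable_line_coord. Qed.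

Lemma mu_itv_oo : mu (`]a, b[%classic : set R) = (b - a)%:E.
Proof. by rewrite lebesgue_measure_itv/= lte_fin ab EFinB. Qed.

Lemma integral_sqr_enorm_line z : (\int[leb_on a b]_t (enorm (line z t) ^+ 2)%:E <=
  ((d%:R * (1 + `|a| + `|b|) * `|z|) ^+ 2 * (b - a))%:E)%E.
Proof.
rewrite ge0_integral_leb_on; [|exact: measurable_sqr_enorm_line|by move=> t; rewrite lee_fin sqr_ge0].
have mI : measurable (`]a, b[%classic : set RT) by exact: measurable_itv.
apply: (@le_trans _ _ (\int[mu]_(t in `]a, b[) ((d%:R * (1 + `|a| + `|b|) * `|z|) ^+ 2)%:E)%E).
  apply: ge0_le_integral => //.
  - by move=> t _; rewrite lee_fin sqr_ge0.
  - by apply: measurable_funTS; exact: measurable_sqr_enorm_line.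
  move=> t; rewrite /= in_itv/= => /andP[at_ tb].
  by rewrite lee_fin sqr_enorm_line// ltW.
rewrite integral_cst// [leRHS]EFinM -[X in (_ <= _ * X)%E]mu_itv_oo; exact: lexx.
Qed.

Lemma line_L2_exists z : exists u : L2 a b d, {ae leb_on a b, forall t : RT, L2_fun u t = line z t}.
Proof.
apply: L2_make; first by move=> i; exact: measurable_line_coord.
by apply: le_lt_trans (integral_sqr_enorm_line z) _; rewrite ltry.
Qed.

Definition line_L2 z : L2 a b d := sval (cid (line_L2_exists z)).

Lemma line_L2E z : {ae leb_on a b, forall t : RT, L2_fun (line_L2 z) t = line z t}.
Proof. exact: (svalP (cid (line_L2_exists z))). Qed.

Lemma lineB z1 z2 t : line z1 t - line z2 t = line (z1 - z2) t.
Proof. by rewrite /line /= scalerBr opprD addrACA. Qed.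

Lemma L2_dist_line z1 z2 :
  L2_dist (line_L2 z1) (line_L2 z2) <= d%:R * (1 + `|a| + `|b|) * (1 + (b - a)) * `|z1 - z2|.
Proof.
have ba : 0 < b - a by rewrite subr_gt0.
rewrite -(@ler_pXn2r _ 2)// ?nnegrE ?L2_dist_ge0//; last first.
  apply: mulr_ge0 => //; apply: mulr_ge0; first by rewrite mulr_ge0// !addr_ge0.
  by rewrite addr_ge0// ltW.
rewrite -lee_fin sqr_L2_dist.
have -> : (\int[leb_on a b]_t (enorm (L2_fun (line_L2 z1) t - L2_fun (line_L2 z2) t) ^+ 2)%:E =
   \int[leb_on a b]_t (enorm (line (z1 - z2) t) ^+ 2)%:E)%E.
  apply: ae_eq_integral => //.
  - exact: measurable_sqr_L2_sub.
  - exact: measurable_sqr_enorm_line.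
  - by apply: filterS2 (line_L2E z1) (line_L2E z2) => t -> -> _; rewrite lineB.
apply: le_trans (integral_sqr_enorm_line _) _; rewrite lee_fin.
(* The factor 1 + (b - a) stands for the square root of b - a: its square dominates b - a. *)
set A := d%:R * _; rewrite [A * (1 + _) * _]mulrAC [leRHS]exprMn ler_wpM2l ?sqr_ge0//.
have := sqr_ge0 (b - a); lra.
Qed.

Lemma continuous_line_L2 : continuous line_L2.
Proof.
move=> z A /nbhs_ballP[e /= e0 eA]; apply/nbhs_ballP.
set C := d%:R * (1 + `|a| + `|b|) * (1 + (b - a)).
have C0 : 0 <= C by apply: mulr_ge0; [rewrite mulr_ge0// !addr_ge0|rewrite addr_ge0// subr_ge0 ltW].
exists (e / (C + 1)) => /=; first by rewrite divr_gt0// ltr_wpDl.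
move=> y; rewrite -ball_normE/= => zy; apply: eA; rewrite /ball/=.
apply: le_lt_trans (L2_dist_line _ _) _; rewrite -/C.
apply: (@le_lt_trans _ _ ((C + 1) * `|z - y|)); first by rewrite ler_wpM2r// lerDl.
by rewrite mulrC -ltr_pdivlMr// ltr_wpDl.
Qed.

(** The derivative is the constant curve z.2, written as a line of zero slope. The identity is the
    fundamental theorem of calculus for line times phi, which vanishes at a and b since phi has
    compact support in the open interval. *)
Lemma weak_derivative_line z : weak_derivative (line_L2 z) (line_L2 (z.2, 0)).
Proof.
move=> phi tphi i.
have [B [B0 mp mdp pB dpB]] := test_function_bounded tphi.
have [sphi [K [_ Kab pK]]] := tphi.
have c0 : continuous phi.
  by move=> t; apply: differentiable_continuous; apply/derivable1_diffP; exact: (sphi 0).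
have c1 : continuous (derive1 phi).
  move=> t; apply: differentiable_continuous; apply/derivable1_diffP.
  exact: (sphi 1%N).
have ml y : measurable_fun [set: RT] (fun t : RT => line y t 0 i) by exact: measurable_line_coord.
pose F t := line z t 0 i * phi t.
pose f t := line z t 0 i * derive1 phi t + z.2 0 i * phi t.
have dF (t : R) : is_derive t 1 F (f t).
  have dp : is_derive t 1 phi (derive1 phi t).
    by rewrite derive1E; apply: DeriveDef => //; exact: (sphi 0).
  have dl : is_derive t 1 (fun t => line z t 0 i) (z.2 0 i).
    rewrite (_ : (fun t => _) = cst (z.1 0 i) + (z.2 0 i) *: id); last first.
      by apply/funext => s; rewrite lineE /= mulrC.
    have h1 := is_deriveD (is_derive_cst (z.1 0 i) t (1 : R)) (is_deriveZ (z.2 0 i) (is_derive_id t (1 : R))).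
    by apply: is_derive_eq h1 _; rewrite add0r [_ *: 1]mulr1.
  have := is_deriveM dl dp; rewrite /F => h; apply: is_derive_eq h _.
  by rewrite /f /= /GRing.scale/= [X in _ + X]mulrC.
have cf : continuous f.
  move=> t; apply: cvgD; apply: cvgM; [exact: continuous_line_coord|exact: c1|exact: cvg_cst|exact: c0].
have F0 t : t = a \/ t = b -> F t = 0.
  move=> tab; rewrite /F pK ?mulr0// => /Kab; rewrite /= in_itv/=.
  by case: tab => ->; rewrite ltxx ?andbF.
have If : \int[mu]_(t in `]a, b[) f t = 0.
  rewrite /Rintegral -(@integral_itv_bndoo R a b _ true false); last first.
    by apply/measurable_EFinP; apply: measurable_funTS; exact: continuous_measurable_fun.
  rewrite (@continuous_FTC2 _ f F)//.
  - by rewrite (F0 a (or_introl erefl)) (F0 b (or_intror erefl)) subee.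
  - exact: continuous_subspaceT.
  - have cF : continuous F.
      by move=> t; apply: differentiable_continuous; apply/derivable1_diffP; apply: ex_derive.
    split=> [t _| |].
    + exact: ex_derive.
    + by apply: cvg_at_right_filter; exact: cF.
    + by apply: cvg_at_left_filter; exact: cF.
  - by move=> t _; rewrite derive1E; apply: derive_val.
have E1 : \int[leb_on a b]_t (L2_fun (line_L2 z) t 0 i * derive1 phi t) =
    \int[mu]_(t in `]a, b[) (line z t 0 i * derive1 phi t).
  have m1 : measurable_fun [set: RT] (fun t : RT => line z t 0 i * derive1 phi t).
    exact: (measurable_funM (ml z) mdp).
  rewrite -(Rintegral_leb_on a b m1).
  congr fine; apply: ae_eq_integral => //.
  - apply/measurable_EFinP; apply: measurable_funM => //; exact: measurable_coord_L2.
  - exact/measurable_EFinP.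
  - by apply: filterS (line_L2E z) => t ->.
have E2 : \int[leb_on a b]_t (L2_fun (line_L2 (z.2, 0)) t 0 i * phi t) =
    \int[mu]_(t in `]a, b[) (z.2 0 i * phi t).
  have m1 : measurable_fun [set: RT] (fun t : RT => z.2 0 i * phi t).
    exact: (measurable_funM (@measurable_cst _ _ RT R setT (z.2 0 i)) mp).
  rewrite -(Rintegral_leb_on a b m1).
  congr fine; apply: ae_eq_integral => //.
  - apply/measurable_EFinP; apply: measurable_funM => //; exact: measurable_coord_L2.
  - exact/measurable_EFinP.
  - by apply: filterS (line_L2E (z.2, 0)) => t -> _; rewrite lineE !mxE mulr0 addr0.
rewrite E1 E2; apply/eqP; rewrite -addr_eq0; apply/eqP.
have mI : measurable (`]a, b[%classic : set RT) by exact: measurable_itv.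
have int (u : R -> R) : continuous u -> mu.-integrable (`]a, b[%classic : set RT) (EFin \o u).
  move=> cu; apply: (@integrableS _ _ _ mu (`[a, b]%classic : set RT)) => //.
  - exact: subset_itv_oo_cc.
  - apply: continuous_compact_integrable; first exact: segment_compact.
    exact: continuous_subspaceT.
rewrite -RintegralD//; apply: int => t.
- by apply: cvgM; [exact: continuous_line_coord|exact: c1].
- by apply: cvgM; [exact: cvg_cst|exact: c0].
Qed.

Lemma line_L2_W12 z : W12 (line_L2 z).
Proof. by exists (line_L2 (z.2, 0)); exact: weak_derivative_line. Qed.

Lemma continuous_line z (A : set R) : {within A, continuous (line z)}.
Proof.
apply: continuous_row => i; apply: continuous_subspaceT; exact: continuous_line_coord.
Qed.

Lemma crep_line z t : t \in `[a, b] -> crep (line_L2 z) t = line z t.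
Proof.
apply: (crep_unique ab (line_L2_W12 z)); first exact: continuous_line.
by apply: filterS (line_L2E z) => s ->.
Qed.

Lemma energy_line z : energy (line_L2 z) = ((b - a) * enorm z.2 ^+ 2)%:E.
Proof.
rewrite (energyE ab (weak_derivative_line z)) sqnE.
transitivity (\int[leb_on a b]_t (enorm z.2 ^+ 2)%:E)%E.
  apply: ae_eq_integral => //; first exact: measurable_sqr_L2.
  by apply: filterS (line_L2E (z.2, 0)) => t -> _; rewrite /line/= scaler0 addr0.
rewrite integral_cst// mulrC [RHS]EFinM -[X in (_ = _ * X)%E]mu_itv_oo; congr (_ * _)%E.
by rewrite /leb_on/= /mrestr setTI.
Qed.

(** Continuity extends the agreement from rational times. Being a line is thus a countable set of
    conditions, which is what makes it measurable. *)
Lemma rational_line (f : L2 a b d) z a' : W12 f -> a <= a' ->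
  (forall q : rat, a' <= ratr q -> ratr q < b -> forall i, trace f (ratr q) i = line z (ratr q) 0 i) ->
  forall t, a' < t -> t < b -> crep f t = line z t.
Proof.
move=> Wf aa h t a't tb; have [kf _] := crepP ab Wf.
have at_ : a < t by exact: le_lt_trans a't.
have tab : t \in `[a, b] by rewrite in_itv/= !ltW.
have kl := @continuous_line z `[a, b].
apply: contrapT => /eqP ne.
move/subspace_continuousP in kf; move/subspace_continuousP in kl.
have kB : (crep f s - line z s) @[s --> within `[a, b] (nbhs t)] --> crep f t - line z t.
  by apply: cvgB; [exact: kf|exact: kl].
have e0 : 0 < `|crep f t - line z t| by rewrite normr_gt0 subr_eq0.
move/cvgrPdist_lt : kB => /(_ _ e0); rewrite near_withinE => -[e /= e1 he].
have [|q] := @rat_in_itvoo R (Num.max a' (t - e)) t; first by rewrite gt_max a't gtrBl.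
rewrite in_itv/= gt_max => /andP[/andP[aq tq] qt].
have qb : ratr q < b by exact: lt_trans tb.
have := he (ratr q); rewrite /= in_itv/= (le_trans aa (ltW aq)) (ltW qb).
have -> : crep f (ratr q) - line z (ratr q) = 0.
  apply/eqP; rewrite subr_eq0; apply/eqP/rowP => i; rewrite (crep_trace ab)//.
    by apply: h => //; exact: ltW.
  by rewrite (le_trans aa)// ltW.
rewrite subr0 ltxx => hh; suff /hh/(_ isT) : `|t - ratr q| < e by [].
by rewrite gtr0_norm ?subr_gt0// ltrBlDl -ltrBlDr.
Qed.

End line_L2.


(** * Images of probabilities *)

Section push.
Context d1 d2 (X : measurableType d1) (Y : measurableType d2) (R : realType).
Variables (P : probability X R) (f : X -> Y) (mf : measurable_fun setT f).

Definition push : probability Y R :=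
  distribution P (HB.pack f (isMeasurableFun.Build _ _ _ _ f mf) : {mfun X >-> Y}).

Lemma pushE A : push A = P (f @^-1` A). Proof. by []. Qed.

Lemma ge0_integral_push (h : Y -> \bar R) : measurable_fun setT h -> (forall y, 0 <= h y)%E ->
  (\int[push]_y h y = \int[P]_x h (f x))%E.
Proof.
move=> mh h0; transitivity (\int[pushforward P f]_y h y)%E; last first.
  by rewrite (ge0_integral_pushforward mf).
exact: eq_measure_integral.
Qed.

Lemma ae_push (S : set Y) : measurable S -> {ae P, forall x, S (f x)} -> {ae push, forall y, S y}.
Proof.
move=> mS h; apply/(negligibleP _ (measurableC mS)).
apply/(negligibleP P); last exact: h.
by rewrite -[X in measurable X]setTI; apply: mf => //; exact: measurableC.
Qed.

End push.

Lemma countType_bigcap_measurable dX (X : measurableType dX) (I : countType) (F : I -> set X) :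
  (forall i, measurable (F i)) -> measurable (\bigcap_(i in [set: I]) F i).
Proof.
move=> mF; rewrite -[X in measurable X]setCK setC_bigcap; apply: measurableC.
by apply: countable_bigcupT_measurable => [|i]; [exact: countableP|exact: measurableC].
Qed.

(** * Straight lines in the space of curves *)

Section line_Gamma.
Context {R : realType} (d : nat) (T : R) (T0 : 0 < T).
Local Notation Gam := (Gamma d T).
Local Notation RT := (measurableTypeR R).
Local Notation mu := (@lebesgue_measure R).
Local Notation phase := ('rV[R]_d * 'rV[R]_d)%type.
Implicit Types z : phase.

Let N1T : -1 < T. Proof. by rewrite (lt_trans _ T0). Qed.

Lemma line_Gamma_affine z : exists x v : 'rV[R]_d,
  {ae leb_on (-1) T, forall t : RT, t < 0 -> L2_fun (line_L2 N1T z) t = x + t *: v}.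
Proof. by exists z.1, z.2; apply: filterS (line_L2E N1T z) => t -> _. Qed.

Definition line_Gamma z : Gam := exist _ (line_L2 N1T z) (mem_set (line_Gamma_affine z)).

Lemma continuous_line_Gamma : continuous line_Gamma.
Proof. by apply: continuous_comp_initial; exact: continuous_line_L2. Qed.

Lemma measurable_line_Gamma : measurable_fun setT (line_Gamma : borel phase -> borel Gam).
Proof. apply: measurable_continuous_borel2; exact: continuous_line_Gamma. Qed.

Lemma line_Gamma_W12 z : Gamma_W12 (line_Gamma z).
Proof. exact: line_L2_W12. Qed.

Lemma position_line_Gamma z t : -1 <= t -> t <= T -> position (line_Gamma z) t = line z t.
Proof. by move=> t1 tT; apply: (crep_line N1T); rewrite in_itv/= t1. Qed.

Lemma e0_line_Gamma z : e0 (line_Gamma z) = z.1.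
Proof. by rewrite /e0 position_line_Gamma ?lerN10 ?ltW// /line scale0r addr0. Qed.

Lemma W0_line_Gamma z : W0 (line_Gamma z) = z.2.
Proof.
rewrite /W0 !position_line_Gamma ?lerN10 ?lexx ?(ltW T0) ?(ltW N1T)//.
by rewrite /line; apply/rowP => i; rewrite !mxE; ring.
Qed.

Lemma is_derive_line_Gamma z t : 0 <= t -> t < T ->
  is_derive (t : R) 1 (position (line_Gamma z)) z.2.
Proof.
move=> t0 tT.
have c : (fun h : R => h^-1 *: (((position (line_Gamma z)) \o shift t) (h *: (1 : R)) -
    position (line_Gamma z) t)) @ (0 : R)^' --> z.2.
  apply: cvg_near_cst; near=> h.
  have hn : h != 0 by near: h; exact: nbhs_dnbhs_neq.
  (* The position is known to follow the line on [-1, T] only; these bounds keep t + h inside, also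
     when t = 0. *)
  have [h1 h2] : - 1 < h /\ h < T - t.
    near: h; apply: cvg_within => /=.
    exists (Num.min 1 (T - t)) => /=; first by rewrite lt_min ltr01 subr_gt0.
    move=> h /=; rewrite sub0r normrN lt_min !ltr_norml => /andP[/andP[a1 a2] /andP[a3 a4]] //.
  rewrite /= [h *: (1 : R)]mulr1 !position_line_Gamma; [|lra..].
  apply/rowP => i; rewrite !mxE.
  by field.
by apply: DeriveDef; [apply: cvgP c|apply: cvg_lim c].
Unshelve. all: by end_near. Qed.

Lemma energy_line_Gamma z : energy (set_val (line_Gamma z)) = ((T + 1) * enorm z.2 ^+ 2)%:E.
Proof. by rewrite [LHS](energy_line N1T) opprK. Qed.

Lemma Trestr_line_Gamma z t (tT : t < T) : -1 <= t -> Trestr t (line_Gamma z) = line_L2 tT z.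
Proof.
move=> t1; apply: L2_eq.
have h1 := restrE (line_L2 N1T z) t1 (lexx T).
have h2 := line_L2E tT z.
have h3 := line_L2E N1T z.
have h4 : {ae leb_on t T, forall s : RT, L2_fun (line_L2 N1T z) s = line z s}.
  move/leb_on_negligible in h3; apply/leb_on_negligible.
  apply: negligibleS h3 => s /= [ns]; rewrite !in_itv/= => /andP[ts sT]; split => //.
  by rewrite (le_lt_trans t1 ts).
by apply: filterS2 (filterI h1 h2) h4 => s [-> ->] ->.
Qed.

(* Curves which are straight lines, described by countably many measurable
   conditions. *)
Definition straight : set (borel Gam) := @Gamma_W12 R d T `&`
  \bigcap_(q in [set: rat]) \bigcap_(i in [set: 'I_d]) [set g : borel Gam | 0 <= (ratr q : R) < T ->
    position g (ratr q) 0 i = e0 g 0 i + ratr q * W0 g 0 i].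

Lemma measurable_straight : measurable straight.
Proof.
apply: measurableI; first exact: measurable_Gamma_W12.
apply: countType_bigcap_measurable => q; apply: countType_bigcap_measurable => i.
have [q0T|nq] := pselect (0 <= (ratr q : R) < T); last first.
  rewrite (_ : [set g | _] = setT); first exact: measurableT.
  by apply/seteqP; split => // g _ /nq.
have /andP[q0 qT] := q0T.
rewrite (_ : [set g | _] = [set g : borel Gam | position g (ratr q) 0 i -
    (e0 g 0 i + ratr q * W0 g 0 i) = 0]); last first.
  apply/seteqP; split => g /= h; first by rewrite h// subrr.
  by move=> _; apply/eqP; rewrite -subr_eq0 h.
have m : measurable_fun setT (fun g : borel Gam => position g (ratr q) 0 i -
    (e0 g 0 i + ratr q * W0 g 0 i)).
  apply: measurable_funB; first by apply: measurable_position => //; rewrite (le_trans _ q0)// lerN10.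
  apply: measurable_funD; first exact: measurable_e0.
  exact: (measurable_funM (@measurable_cst _ _ (borel Gam) R setT (ratr q)) (measurable_W0 T0 i)).
have := m measurableT [set 0] (measurable_set1 0); rewrite setTI; exact.
Qed.

(** After time 0 the conditions at rational times suffice. Before time 0 the curve is affine by
    membership in [Gamma], and its affine part is the same line because [e0] and [W0] are read off
    that part. *)
Lemma straightP (g : Gam) : straight g -> g = line_Gamma (e0 g, W0 g).
Proof.
move=> [Wg hg]; pose z := (e0 g, W0 g).
have pos1 t : 0 < t -> t < T -> position g t = line z t.
  apply: (rational_line N1T Wg (lerN10 R)) => q q0 qT i.
  rewrite -(crep_trace N1T) ?(le_trans (lerN10 R))// lineE.
  by apply: (hg q I i I); rewrite /= q0.
have [x [v xv]] := set_valP g.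
have pos2 t : -1 <= t -> t <= 0 -> position g t = line (x, v) t.
  move=> t1 t0; apply: (@within_continuous_ae_eq R (-1) 0 d (ltrN10 R)).
  - have [kf _] := crepP N1T Wg; apply: continuous_subspaceW kf.
    by apply: subset_itvl; rewrite bnd_simp ltW.
  - exact: continuous_line.
  - have [_ cf] := crepP N1T Wg.
    have h : {ae leb_on (-1) T, forall s : RT, s < 0 -> position g s = line (x, v) s}.
      by apply: filterS2 xv cf => s h1 h2 s0; rewrite /position h2 h1.
    move/leb_on_negligible in h; apply/leb_on_negligible; apply: negligibleS h => s /=.
    rewrite !in_itv/= => -[ns /andP[s1 s0]]; split; first by move=> h; apply: ns; exact: h.
    by rewrite s1 (lt_trans s0).
  - by rewrite in_itv/= t1.
(* Times 0 and -1 both lie in the range of [pos2], by continuity up to the endpoints. *)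
have zE : z = (x, v).
  rewrite /z /W0 /e0 !pos2 ?lexx ?lerN10//.
  by congr pair; rewrite /line/=; apply/rowP => i; rewrite !mxE; ring.
apply: val_inj; apply: L2_eq.
have [_ cf] := crepP N1T Wg.
have h := line_L2E N1T z.
have n0 : {ae leb_on (-1) T, forall s : RT, s <> 0}.
  apply/leb_on_negligible; apply: (@negligibleS _ _ _ _ ([set 0] : set RT)).
    by move=> s /= [/contrapT].
  by exists [set 0]; split => //; exact: (lebesgue_measure_set1 (0 : R)).
have hI : {ae leb_on (-1) T, forall s : RT, s \in `]-1, T[}.
  by apply: (ae_leb_onP (P := fun s => s \in `]-1, T[)).
apply: filterS2 (filterI cf hI) (filterI h n0) => s [<-]; rewrite in_itv/= => /andP[s1 sT] [-> s0].
have [s0'|s0'] := ltP 0 s; first by rewrite -pos1.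
by rewrite zE -pos2// ltW.
Qed.

Lemma straight_line_Gamma z : straight (line_Gamma z).
Proof.
split; first exact: line_Gamma_W12.
move=> q _ i _ /= /andP[q0 qT].
rewrite e0_line_Gamma W0_line_Gamma position_line_Gamma ?lineE ?(ltW qT)//.
exact: le_trans (lerN10 R) q0.
Qed.

End line_Gamma.

(** * Recovering a line from its restriction to the future *)

Section line_extraction.
Context {R : realType} (d : nat) (T : R) (T0 : 0 < T) (t : R) (t0 : 0 <= t) (tT : t < T).
Local Notation Gam := (Gamma d T).
Local Notation RT := (measurableTypeR R).
Local Notation mu := (@lebesgue_measure R).
Local Notation phase := ('rV[R]_d * 'rV[R]_d)%type.
Local Notation Lt := (borel (L2 t T d)).

Let m := (t + T) / 2.
Let tm : t < m. Proof. exact: (midf_lt tT).1. Qed.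
Let mT : m < T. Proof. exact: (midf_lt tT).2. Qed.

(** The slope between t and the midpoint m of ]t, T[. Both times precede T, where right averages
    would leave the interval. *)
Definition extract_velocity (y : L2 t T d) i : R := (trace y m i - trace y t i) / (m - t).

Definition extract (y : L2 t T d) : phase :=
  (\row_i (trace y t i - t * extract_velocity y i), \row_i extract_velocity y i).

Lemma measurable_extract_velocity i : measurable_fun setT (fun y : Lt => extract_velocity y i).
Proof.
have h : measurable_fun setT (fun y : Lt => trace y m i - trace y t i).
  exact: (measurable_funB (measurable_trace m i) (measurable_trace t i)).
exact: (measurable_funM h (@measurable_cst _ _ Lt R setT (m - t)^-1)).
Qed.

Lemma measurable_extract_position i :
  measurable_fun setT (fun y : Lt => trace y t i - t * extract_velocity y i).
Proof.
apply: (measurable_funB (measurable_trace t i)).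
exact: (measurable_funM (@measurable_cst _ _ Lt R setT t) (measurable_extract_velocity i)).
Qed.

Lemma measurable_extract : measurable_fun setT (extract : Lt -> borel phase).
Proof.
apply: measurable_row_pair => i.
  by under eq_fun do rewrite mxE; exact: measurable_extract_position.
by under eq_fun do rewrite mxE; exact: measurable_extract_velocity.
Qed.

Lemma extract_line z : extract (line_L2 tT z) = z.
Proof.
have tr s i : t <= s -> s < T -> trace (line_L2 tT z) s i = z.1 0 i + s * z.2 0 i.
  move=> ts sT; rewrite -(crep_trace tT)//; last exact: line_L2_W12.
  by rewrite (crep_line tT) ?lineE// in_itv/= ts ltW.
have mt : m - t != 0 by rewrite subr_eq0 gt_eqF.
have v i : extract_velocity (line_L2 tT z) i = z.2 0 i.
  by rewrite /extract_velocity !tr// ?(ltW tm)//; field.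
case: z tr v => x w /= tr v; congr pair; apply/rowP => i; rewrite mxE v//.
by rewrite tr// addrK.
Qed.

(** The lines in L^2(t, T), again by countably many measurable conditions: the law of [Trestr t]
    under the straight flow needs a measurable set of full mass. *)
Definition straight_L2 : set Lt := [set y | (energy y < +oo)%E] `&`
  \bigcap_(q in [set: rat]) \bigcap_(i in [set: 'I_d]) [set y : Lt | t <= (ratr q : R) < T ->
    trace y (ratr q) i = line (extract y) (ratr q) 0 i].

Lemma measurable_straight_L2 : measurable straight_L2.
Proof.
apply: measurableI.
  rewrite -[X in measurable X]setTI; apply: emeasurable_fun_infty_o => //.
  exact: (measurable_energy tT).
apply: countType_bigcap_measurable => q; apply: countType_bigcap_measurable => i.
have [q0T|nq] := pselect (t <= (ratr q : R) < T); last first.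
  rewrite (_ : [set y | _] = setT); first exact: measurableT.
  by apply/seteqP; split => // g _ /nq.
rewrite (_ : [set y | _] = [set y : Lt | trace y (ratr q) i -
    (trace y t i - t * extract_velocity y i + ratr q * extract_velocity y i) = 0]); last first.
  apply/seteqP; split => g /= h; first by rewrite h// lineE !mxE subrr.
  by move=> _; apply/eqP; rewrite -subr_eq0 lineE !mxE h.
have h1 : measurable_fun setT (fun y : Lt => ratr q * extract_velocity y i).
  exact: (measurable_funM (@measurable_cst _ _ Lt R setT (ratr q)) (measurable_extract_velocity i)).
have h2 := measurable_funD (measurable_extract_position i) h1.
have h3 := measurable_funB (measurable_trace (ratr q : R) i) h2.
have := h3 measurableT [set 0] (measurable_set1 0); rewrite setTI; exact.
Qed.

Lemma straight_L2_line z : straight_L2 (line_L2 tT z).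
Proof.
split; first by rewrite /= (energy_line tT) ltry.
move=> q _ i _ /= /andP[tq qT]; rewrite extract_line -(crep_trace tT)//; last exact: line_L2_W12.
by rewrite (crep_line tT)// in_itv/= tq ltW.
Qed.

Lemma straight_L2P y : straight_L2 y -> line_L2 tT (extract y) = y.
Proof.
move=> [ey hy].
have Wy : W12 y by move: ey; rewrite /= /energy; case: asboolP.
have pos := rational_line tT Wy (lexx t) (fun q q1 q2 i => hy q I i I (introT andP (conj q1 q2))).
have [_ cy] := crepP tT Wy.
have hI : {ae leb_on t T, forall s : RT, s \in `]t, T[}.
  by apply: (ae_leb_onP (P := fun s => s \in `]t, T[)).
apply: L2_eq; apply: filterS2 (filterI cy hI) (line_L2E tT (extract y)) => s [<- +] ->.
by rewrite in_itv/= => /andP[ts sT]; rewrite pos.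
Qed.

Lemma extract_Trestr z : extract (Trestr t (line_Gamma T0 z)) = z.
Proof. by rewrite (Trestr_line_Gamma T0 z tT) ?extract_line// (le_trans (lerN10 R)). Qed.

End line_extraction.

(** * The straight flow is a dissipative solution *)

Section existence.
Context {R : realType} (d : nat) (T : R) (T0 : 0 < T).
Local Notation Gam := (Gamma d T).
Local Notation RT := (measurableTypeR R).
Local Notation phase := ('rV[R]_d * 'rV[R]_d)%type.
Variable nu : probability (borel phase) R.
Hypothesis nu21 : P21 (nu : Prob R phase).

Definition straight_flow : probability (borel Gam) R := push nu (@measurable_line_Gamma R d T T0).

Lemma straight_flow_initial_data :
  initial_data (straight_flow : Prob R Gam) (nu : Prob R phase).
Proof.
move=> A mA; rewrite /pushforward pushE; congr (nu _).
by apply/seteqP; split => z /=; rewrite e0_line_Gamma W0_line_Gamma; case: z.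
Qed.

Lemma ae_straight_flow : {ae straight_flow, forall g, (@straight R d T) g}.
Proof.
apply: (ae_push (@measurable_line_Gamma R d T T0)); first exact: measurable_straight.
by apply: aeW => z; exact: straight_line_Gamma.
Qed.

Lemma straight_flow_MGamma : MGamma (straight_flow : Prob R Gam).
Proof.
have m2 : measurable_fun setT (fun z : borel phase => (enorm z.2 ^+ 2)%:E).
  by apply: measurable_enorm_borel; exact: measurable_snd_coord.
split.
  have m : measurable_fun setT (fun g : borel Gam => (enorm (e0 g) ^+ 2)%:E).
    apply/measurable_EFinP.
    rewrite (_ : (fun _ => _) = fun g : borel Gam => \sum_(i < d) e0 g 0 i ^+ 2).
      by apply: measurable_sum => i; apply: measurable_funX; exact: measurable_e0.
    by apply/funext => g; rewrite enorm_sqr.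
  rewrite /moment2 [leLHS](ge0_integral_push nu (@measurable_line_Gamma R d T T0) m); last first.
    by move=> g; rewrite lee_fin sqr_ge0.
  by apply: le_trans nu21.1; under eq_integral do rewrite e0_line_Gamma.
rewrite [leLHS](ge0_integral_push nu (@measurable_line_Gamma R d T T0) (measurable_Gamma_energy T0)); last first.
  by move=> g; exact: energy_ge0.
under eq_integral do rewrite energy_line_Gamma EFinM.
have T1 : 0 <= T + 1 by rewrite addr_ge0// ltW.
rewrite ge0_integralZl//; last by move=> z _; rewrite lee_fin sqr_ge0.
by rewrite -[leRHS]mule1; apply: lee_wpmul2l; [rewrite lee_fin|exact: nu21.2].
Qed.

(** For t < T the future of a line, living on an interval of positive length, determines the line
    even if others cross it at t. So the conditional law given the future is the Dirac mass at the
    extracted line. *)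
Definition straight_kernel t : kernel_at d T t :=
  kdirac (measurableT_comp (@measurable_line_Gamma R d T T0) (@measurable_extract R d T t)).

Lemma straight_disintegration t : t \in `[0, T[ ->
  disintegration (straight_flow : Prob R Gam) (straight_kernel t).
Proof.
rewrite in_itv/= => /andP[t0 tT].
have t1 : -1 <= t := le_trans (lerN10 R) t0.
have mTr := @measurable_Trestr R d T t t1.
split.
  move=> A mA.
  rewrite (ge0_integral_pushforward mTr)//; last exact: measurable_kernel.
  rewrite preimage_setT [RHS](ge0_integral_push nu (@measurable_line_Gamma R d T T0)); last 2 first.
  - exact: (measurableT_comp (measurable_kernel (straight_kernel t) A mA) mTr).
  - by move=> g.
  have mLA : measurable ((line_Gamma T0 : borel phase -> borel Gam) @^-1` A).
    by rewrite -[X in measurable X]setTI; exact: measurable_line_Gamma.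
  rewrite pushE.
  transitivity (\int[nu]_z (\1_((line_Gamma T0 : borel phase -> borel Gam) @^-1` A) z)%:E)%E.
    by rewrite integral_indic// setIT.
  apply: eq_integral => z _.
  by rewrite /= /kdirac/= diracE extract_Trestr// indicE; congr ((_ : bool)%:R%:E); apply/idP/idP;
    rewrite !inE.
(* On restricted lines the Dirac mass sits in the correct fibre, because the extracted line
   restricts to y; other y form a null set. *)
exists (~` @straight_L2 R d T t); split.
- by apply: measurableC; exact: measurable_straight_L2.
- rewrite /pushforward pushE (_ : _ @^-1` _ = set0) ?measure0//.
  apply/seteqP; split => // z /=; apply; rewrite (Trestr_line_Gamma T0 z tT)//.
  exact: straight_L2_line.
move=> g; apply: contra_not => /= /contrapT Sg.
rewrite /kdirac/= diracE memNset// => /=; apply.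
rewrite (Trestr_line_Gamma T0 _ tT t1); apply: straight_L2P; exact: Sg.
Qed.

Lemma straight_flow_dissipative : dissipative (straight_flow : Prob R Gam).
Proof.
split; first exact: straight_flow_MGamma.
exists straight_kernel; split; first exact: straight_disintegration.
have mS : measurable (@straight R d T) by exact: measurable_straight.
exists (setT `*` ~` @straight R d T); split.
- by apply: measurableX => //; exact: measurableC.
- rewrite product_measure1E//; last exact: measurableC.
  rewrite [X in (_ * X)%E](_ : _ = 0%E) ?mule0//.
  by apply/(negligibleP _ (measurableC mS)); exact: ae_straight_flow.
move=> [s g] /=; apply: contra_notP => /not_andP[//|/contrapT Sg].
rewrite in_itv/= => /andP[s0 sT].
have [z ->] : exists z, g = line_Gamma T0 z by eexists; exact: straightP Sg.
have -> : velocity (straight_kernel s) (line_Gamma T0 z) = z.2.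
  apply/rowP => i; rewrite mxE /Rintegral /= /kdirac/=.
  rewrite integral_dirac//; last by apply/measurable_EFinP; exact: measurable_W0.
  by rewrite diracT mul1e /= extract_Trestr// W0_line_Gamma.
exact: is_derive_line_Gamma.
Qed.

End existence.


(** * Uniform estimates near finitely many free lines *)

Section stable_lines.
Context {R : realType} (d : nat) (T : R) (T0 : 0 < T).
Local Notation Gam := (Gamma d T).
Local Notation phase := ('rV[R]_d * 'rV[R]_d)%type.

Definition free_lines K (p : 'I_K -> phase) := forall k k' t, k != k' -> 0 <= t -> t <= T ->
  line (p k) t != line (p k') t.

Lemma continuous_norm_line (z : phase) : continuous (fun t : R => `|line z t|).
Proof.
move=> t A /nbhs_ballP[e /= e0 eA]; apply/nbhs_ballP.
exists (e / (`|z.2| + 1)) => /=; first by rewrite divr_gt0// ltr_wpDl.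
move=> s; rewrite -ball_normE/= => ts; apply: eA; rewrite -ball_normE/=.
apply: le_lt_trans (ler_dist_dist _ _) _.
have -> : line z t - line z s = (t - s) *: z.2.
  by rewrite /line; apply/rowP => i; rewrite !mxE; ring.
rewrite normrZ; apply: (@le_lt_trans _ _ (`|t - s| * (`|z.2| + 1))).
  by rewrite ler_wpM2l// lerDl.
by rewrite -ltr_pdivlMr// ltr_wpDl.
Qed.

(** For each pair the distance attains its positive minimum on [0, T]; every small r > 0 works for
    that pair, and a finite intersection in the filter of right neighbourhoods of 0 settles all
    pairs at once. *)
Lemma free_separation K (p : 'I_K -> phase) : free_lines p -> exists2 r, 0 < r &
  forall k k' t, k != k' -> 0 <= t -> t <= T -> 2 * r <= `|line (p k) t - line (p k') t|.
Proof.
move=> fp.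
have : \forall r \near (0 : R)^'+, forall kk : 'I_K * 'I_K, kk.1 != kk.2 ->
    forall t, 0 <= t -> t <= T -> 2 * r <= `|line (p kk.1) t - line (p kk.2) t|.
  apply: filter_forall => -[k k'] /=.
  have [kk|kk'] := boolP (k == k'); first by apply: nearW => r.
  have [|c cT hc] := @EVT_min R (fun t => `|line (p k - p k') t|) 0 T (ltW T0).
    apply: continuous_subspaceT; exact: continuous_norm_line.
  have c0 : 0 < `|line (p k - p k') c|.
    rewrite -lineB normr_gt0 subr_eq0.
    by move: cT; rewrite in_itv/= => /andP[c0 cT]; exact: fp.
  near=> r; move=> _ t t0 tT; rewrite lineB.
  apply: le_trans (hc t _); last by rewrite in_itv/= t0.
  rewrite mulrC -ler_pdivlMr//; apply: ltW; near: r; apply: nbhs_right_lt.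
  by rewrite divr_gt0.
move=> h.
have h0 : \forall r \near (0 : R)^'+, 0 < r by exact: nbhs_right_gt.
have [r [h1 r0]] := @filter_ex R _ (at_right_proper_filter (0 : R)) _ (filterI h h0).
by exists r => // k k' t kk'; exact: (h1 (k, k') kk').
Unshelve. all: by end_near. Qed.

Definition close_to K (p : 'I_K -> phase) (e : R) : set (borel phase) :=
  [set z | exists k, `|z - p k| <= e].

Lemma measurable_close_to K (p : 'I_K -> phase) e : measurable (close_to p e).
Proof.
have -> : close_to p e = \bigcup_(k in [set: 'I_K]) [set z : borel phase |
    (forall i, `|z.1 0 i - (p k).1 0 i| <= e) /\ (forall i, `|z.2 0 i - (p k).2 0 i| <= e) /\ 0 <= e].
  apply/seteqP; split => [z [k zk]|z [k _ [z1 [z2 e0]]]]; exists k => //.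
    have e0 : 0 <= e by exact: le_trans zk.
    move: zk; rewrite ge_max => /andP[zk1 zk2]; split => [i|].
      by apply: le_trans zk1; have := coord_le_norm (z.1 - (p k).1) i; rewrite !mxE.
    split => // i.
    by apply: le_trans zk2; have := coord_le_norm (z.2 - (p k).2) i; rewrite !mxE.
  rewrite ge_max; apply/andP; split; apply: norm_le_coord => // i; rewrite !mxE.
    exact: z1.
  exact: z2.
apply: countable_bigcupT_measurable => [|k]; first exact: countableP.
have -> : [set z : borel phase | (forall i, `|z.1 0 i - (p k).1 0 i| <= e) /\
    (forall i, `|z.2 0 i - (p k).2 0 i| <= e) /\ 0 <= e] =
    \bigcap_(i in [set: 'I_d]) [set z : borel phase | `|z.1 0 i - (p k).1 0 i| <= e] `&`
    (\bigcap_(i in [set: 'I_d]) [set z : borel phase | `|z.2 0 i - (p k).2 0 i| <= e] `&`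
    [set z | 0 <= e]).
  apply/seteqP; split => z /= [h1 [h2 h3]]; split=> //; try by move=> i _; exact: h1.
  - by split=> // i _; exact: h2.
  - by move=> i; exact: (h1 i I).
  - by split=> // i; exact: (h2 i I).
have le_set (f : borel phase -> R) : measurable_fun setT f -> measurable [set z | `|f z| <= e].
  move=> mf; have mn : measurable_fun setT (fun z => `|f z|) by exact: measurableT_comp.
  have := mn measurableT _ (measurable_itv `]-oo, e]); rewrite setTI.
  by congr (measurable _); apply/seteqP; split => z /=; rewrite in_itv.
apply: measurableI.
  apply: countType_bigcap_measurable => i; apply: le_set.
  exact: (measurable_funB (measurable_fst_coord i) (measurable_cst _)).
apply: measurableI.
  apply: countType_bigcap_measurable => i; apply: le_set.
  exact: (measurable_funB (measurable_snd_coord i) (measurable_cst _)).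
have [e0|e0] := boolP (0 <= e).
  by rewrite (_ : [set _ | _] = setT)//; apply/seteqP; split.
by rewrite (_ : [set _ | _] = set0)//; apply/seteqP; split => z //=; rewrite (negbTE e0).
Qed.

(** The constants are fixed in the order r, C0, M, h, n, A, e, b, each depending on the preceding
    ones and never on the data or on the solution; this gives the uniformity over a
    neighbourhood. *)
Lemma small_drift K (p : 'I_K -> phase) (kappa e1 : R) : free_lines p -> 0 < kappa -> 0 < e1 ->
  exists e, [/\ 0 < e, e <= e1 & forall nu : probability (borel phase) R,
    P21 (nu : Prob R phase) -> (nu (~` close_to p e) <= e%:E)%E ->
    forall eta : probability (borel Gam) R, dissipative (eta : Prob R Gam) ->
      initial_data (eta : Prob R Gam) (nu : Prob R phase) ->
    forall t i, 0 <= t -> t < T ->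
      \int[eta]_g `|position g t 0 i - (e0 g 0 i + t * W0 g 0 i)| <= kappa].
Proof.
move=> fp k0 e10; have [r r0 sep] := free_separation fp.
pose C := \sum_k `|p k|.
have C_ge0 : 0 <= C by exact: sumr_ge0.
have pC k : `|p k| <= C by rewrite /C (bigD1 k)//= lerDl sumr_ge0.
pose C0 : R := (1 + `|0 : R| + `|T|) * C.
have C00 : 0 <= C0 by rewrite mulr_ge0 ?addr_ge0.
have bnd k t i : 0 <= t -> t <= T -> `|line (p k) t 0 i| <= C0.
  move=> t0 tT; apply: le_trans (coord_le_norm _ _) _.
  by apply: le_trans (norm_line (p k) t0 tT) _; rewrite ler_wpM2l// !addr_ge0.
pose M := C + 1; have M0 : 0 <= M by rewrite addr_ge0.
have vbnd k : `|(p k).2| <= M.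
  by rewrite (@le_trans _ _ `|p k|) ?le_max ?lexx ?orbT// (le_trans (pC k))// lerDl.
have MM : 0 < M + M + 1 by rewrite ltr_wpDl ?addr_ge0.
pose h := r / 8 / (M + M + 1).
have h0 : 0 < h by rewrite !divr_gt0.
have hM : (M + M + 1) * h <= r / 8 by rewrite mulrC /h divfK// gt_eqF.
pose n := (Num.truncn (T / h)).+1.
have Tn : T <= n%:R * h by rewrite -ler_pdivrMr// ltW// truncnS_gt.
pose A := iter n (fun a => step_factor d K T r C0 * (a + 1)) 0.
(* The three bounds are [e <= 1] and e (1 + T) <= r/2, both needed by the propagation, and A e <=
   kappa for the conclusion. *)
pose e := Num.min 1 (Num.min (r / 2 / (1 + T)) (kappa / (`|A| + 1))).
have T1 : 0 < 1 + T by rewrite addr_gt0.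
have A1 : 0 < `|A| + 1 by rewrite ltr_wpDl.
have e0 : 0 < e by rewrite !lt_min ltr01 !divr_gt0.
have ele1 : e <= 1 by rewrite ge_min lexx.
have er : e * (1 + T) <= r / 2 by rewrite -ler_pdivlMr// !ge_min lexx orbT.
have eA : A * e <= kappa.
  have : e <= kappa / (`|A| + 1) by rewrite !ge_min lexx !orbT.
  rewrite ler_pdivlMr// mulrDr mulr1 => heA.
  apply: le_trans heA; rewrite mulrC; apply: le_trans (_ : e * `|A| <= _).
    by rewrite ler_wpM2l ?ler_norm// ltW.
  by rewrite lerDl ltW.
(* The mass of the bad set is at most b^2 + (8/r) d T b <= b q: far data on one side, Markov at
   level r/8 for the excess speed on the other. Then b is taken with b q <= e^2. *)
pose q := 1 + 8 / r * (d%:R * T).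
have q0 : 0 < q.
  by rewrite ltr_pwDl// mulr_ge0 ?mulr_ge0 ?divr_ge0 ?invr_ge0// ltW.
have q1 : 1 <= q by rewrite lerDl mulr_ge0 ?mulr_ge0 ?divr_ge0 ?invr_ge0// ltW.
pose b := Num.min (Num.min 1 e1) (e ^+ 2 / q).
have b0 : 0 < b by rewrite !lt_min ltr01 e10 divr_gt0// exprn_gt0.
have b1 : b <= 1 by rewrite !ge_min lexx.
have be1 : b <= e1 by rewrite !ge_min lexx !orbT.
have bq : b * q <= e ^+ 2 by rewrite -ler_pdivlMr// ge_min lexx orbT.
have b2 : b ^+ 2 <= b by rewrite expr2 ler_piMr// ltW.
have be : b <= e.
  apply: le_trans (_ : b * q <= _); first by rewrite ler_peMr// ltW.
  by rewrite (le_trans bq)// expr2 ler_piMr// ltW.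
exists (b ^+ 2); split; [by rewrite exprn_gt0|exact: le_trans be1|].
move=> nu nu21 nub eta deta ieta t i t0 tT.
pose N := close_to p (b ^+ 2).
have mN : measurable N by exact: measurable_close_to.
have r8 : 0 < r / 8 by rewrite divr_gt0.
have [B [mB etaB incB]] := increment_bound T0 deta ieta nu21 M0 r8.
(* Near a configuration point the velocity is at most C + 1 = M, so only far data contribute. Their
   mass is at most b^2, which by [bad_moment] costs b in the first moment; hence the radius b^2
   announced above. *)
have exW j : (\int[eta]_g (excess M (W0 g 0 j))%:E <= b%:E)%E.
  have mex : measurable_fun setT (fun z : borel phase => (excess M (z.2 0 j))%:E).
    apply/measurable_EFinP.
    exact: (measurableT_comp (measurable_excess M) (measurable_snd_coord j)).
  rewrite [leLHS](integral_initial T0 ieta mex); last by move=> z; rewrite lee_fin excess_ge0.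
  have v2 : (\int[nu]_z (z.2 0 j ^+ 2)%:E <= 1)%E.
    apply: le_trans nu21.2; apply: ge0_le_integral => //.
    - by move=> z _; rewrite lee_fin sqr_ge0.
    - by apply/measurable_EFinP; apply: measurable_funX; exact: measurable_snd_coord.
    - by apply: measurable_enorm_borel; exact: measurable_snd_coord.
    - by move=> z _; rewrite lee_fin sqr_coord_le.
  have [ib bb] := bad_moment b0 mN nub (measurable_snd_coord j) v2.
  rewrite -lee_fin in bb; apply: le_trans bb.
  rewrite /Rintegral fineK; last exact: (integrable_fin_num measurableT ib).
  apply: ge0_le_integral => //.
  - by move=> z _; rewrite lee_fin excess_ge0.
  - exact: (measurable_int _ ib).
  move=> z _; rewrite lee_fin indicE.
  have [Nz|nNz] := pselect (N z); last first.
    by rewrite mem_set// mul1r /excess ge_max normr_ge0 gerBl.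
  rewrite memNset; last by move=> /(_ Nz).
  have [k] := Nz; rewrite ge_max => /andP[_ zk].
  rewrite mul0r /excess ge_max lexx subr_le0.
  have := coord_le_norm (z.2) j => /le_trans; apply.
  rewrite -[z.2](subrK (p k).2) (le_trans (ler_normD _ _))// /M addrC lerD//.
    by rewrite (@le_trans _ _ `|p k|) ?le_max ?lexx ?orbT.
  by rewrite (le_trans zk)// (le_trans b2).
pose p0 (g : Gam) : phase := (Defs.e0 g, W0 g).
have mp0 : measurable_fun setT (p0 : borel Gam -> borel phase).
  by apply: measurable_row_pair => j; [exact: measurable_e0|exact: measurable_W0].
have mN' : measurable (p0 @^-1` N : set (borel Gam)).
  by rewrite -[X in measurable X]setTI; exact: mp0.
pose G : set (borel Gam) := (p0 @^-1` N) `&` B.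
have mG : measurable G by exact: measurableI.
have PG : (eta (~` G) <= (e ^+ 2)%:E)%E.
  rewrite /G setCI; apply: le_trans (measureU2 eta (measurableC mN') (measurableC mB)) _.
  apply: (@le_trans _ _ ((b ^+ 2)%:E + (8 / r * (d%:R * T) * b)%:E)%E); last first.
    rewrite -EFinD lee_fin (le_trans _ bq)// /q mulrDr mulr1 lerD//.
    by rewrite mulrC.
  apply: leeD.
    have := ieta _ (measurableC mN); rewrite /pushforward preimage_setC => E.
    by rewrite [leLHS]E.
  have r80 : (r / 8)%:E != 0%E by rewrite eqe gt_eqF.
  rewrite -(@lee_pmul2l _ (r / 8)%:E) ?lte_fin//; apply: le_trans etaB _.
  rewrite -EFinM.
  have -> : r / 8 * (8 / r * (d%:R * T) * b) = \sum_(j < d) T * b.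
    by rewrite sumr_const card_ord -mulr_natl; field; rewrite gt_eqF.
  rewrite -sumEFin; apply: lee_sum => j _; rewrite EFinM.
  by apply: lee_wpmul2l; rewrite ?lee_fin// ltW.
have nearG g : G g -> exists k, `|Defs.e0 g - (p k).1| <= e /\ `|W0 g - (p k).2| <= e.
  move=> [[k]]; rewrite ge_max => /andP[h1 h2] _; exists k.
  by split; [apply: le_trans h1 _|apply: le_trans h2 _]; rewrite (le_trans b2).
have incG g : G g -> forall i s t, 0 <= s -> s <= t -> t < T ->
    `|position g t 0 i - position g s 0 i| <= M * (t - s) + r / 8 by move=> [_ /incB].
have := @total_drift_iter _ (borel Gam) R eta d K p T r C0 M h e T0 r0 C00 M0 h0 e0 ele1 er
  sep bnd vbnd hM (@Defs.e0 R d T) (@W0 R d T) (fun t g => position g t)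
  (measurable_e0 T0) (measurable_W0 T0) (measurable_position_row T0)
  (fun t j => integrable_position T0 deta ieta nu21 j)
  (e0_moment T0 ieta nu21) (W0_moment T0 ieta nu21) (fun g => erefl)
  (fun F t j => orthogonality T0 deta ieta nu21 j (F := F))
  G mG PG nearG incG n t t0 tT (le_trans (ltW tT) Tn).
move=> /le_trans/(_ eA); apply: le_trans.
rewrite /total_drift (bigD1 i)//=.
rewrite -[leLHS]addr0; apply: lerD; last by apply: sumr_ge0 => j _; exact: Rintegral_ge0.
rewrite le_eqVlt; apply/orP; left; apply/eqP; apply: eq_Rintegral => g _.
by rewrite /drift /line !mxE.
Qed.

(** Two points near the same [p k] are at distance at most 2c/3 < c. Points near different ones have
    lines within r/2 of lines that are 2r apart. *)
Lemma close_lines_free K (p : 'I_K -> phase) (c : R) : free_lines p -> 0 < c ->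
  exists2 e1, 0 < e1 & forall e, e <= e1 -> forall z z', close_to p e z -> close_to p e z' ->
    c <= `|z - z'| -> forall t, 0 <= t -> t <= T -> line z t != line z' t.
Proof.
move=> fp c0; have [r r0 sep] := free_separation fp.
pose L := 1 + `|0 : R| + `|T|.
have L0 : 0 < L by rewrite /L normr0 addr0 ltr_pwDl.
exists (Num.min (c / 3) (r / 2 / L)); first by rewrite lt_min !divr_gt0.
move=> e; rewrite le_min => /andP[ec er] z z' [k zk] [k' zk'] cz t t0 tT.
have [kk'|kk'] := eqVneq k k'.
  subst k'; have := ler_distD (p k) z z'; rewrite (distrC (p k)).
  by move: c0 ec zk zk' cz; lra.
apply/eqP => E.
have eL : e * L <= r / 2 by rewrite -ler_pdivlMr.
have b1 : `|line (z - p k) t| <= e * L.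
  by apply: le_trans (norm_line _ t0 tT) _; rewrite mulrC ler_wpM2r// ltW.
have b2 : `|line (z' - p k') t| <= e * L.
  by apply: le_trans (norm_line _ t0 tT) _; rewrite mulrC ler_wpM2r// ltW.
have := sep k k' t kk' t0 tT.
have -> : line (p k) t - line (p k') t = line (z' - p k') t - line (z - p k) t.
  by rewrite -!lineB E; apply/rowP => i; rewrite !mxE; ring.
have := ler_normB (line (z' - p k') t) (line (z - p k) t).
by move: b1 b2 eL r0; lra.
Qed.

End stable_lines.


(** * Small shifts avoiding finitely many polynomial conditions *)

Section avoid_roots.
Context {R : realFieldType}.

(** The candidates c/(k+2) with k < [size P] are distinct and lie in ]0, c[, and they are more than
    the roots that P can have. *)
Lemma poly_nonroot_small (P : {poly R}) (c : R) : P != 0 -> 0 < c ->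
  exists2 x, 0 < x < c & ~~ root P x.
Proof.
move=> P0 c0; apply: contrapT => h.
pose rs := [seq c / k.+2%:R | k <- iota 0 (size P)].
have /(_ rs) := max_poly_roots P0; rewrite size_map size_iota ltnn => {}h'.
suff : false by []; apply: h'.
  apply/allP => x /mapP[k _ ->]; apply: contrapT => /negP nr; apply: h.
  exists (c / k.+2%:R) => //; rewrite divr_gt0//= ltr_pdivrMr// ltr_pMr//.
  by rewrite ltr1n.
rewrite map_inj_uniq ?iota_uniq// => k k' /(mulfI (lt0r_neq0 c0)) /invr_inj /eqP.
by rewrite eqr_nat => /eqP [].
Qed.

Lemma common_nonroot_small (I : finType) (Q : pred I) (P : I -> {poly R}) (c : R) :
  (forall i, Q i -> P i != 0) -> 0 < c ->
  exists2 x, 0 < x < c & forall i, Q i -> ~~ root (P i) x.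
Proof.
move=> P0 c0; have [|x xc nx] := @poly_nonroot_small (\prod_(i | Q i) P i) c _ c0.
  by apply/prodf_neq0.
exists x => // i Qi; apply: contra nx => ri.
by rewrite (bigD1 i)//= rootM ri.
Qed.

End avoid_roots.

(** * Shifting finitely many phase points apart *)

Section perturbation.
Context {R : realType} (d : nat) (a b : 'I_d) (ab : a != b).
Local Notation phase := ('rV[R]_d * 'rV[R]_d)%type.
Context (J : finType) (p : J -> phase).

(* Distinct values in [0, 1[ attached to the points. *)
Definition label (j : J) : R := (enum_rank j)%:R / #|J|%:R.

Lemma label_inj : injective label.
Proof.
move=> j j'; have J0 : #|J|%:R != 0 :> R.
  by rewrite pnatr_eq0 -lt0n; apply/card_gt0P; exists j.
move=> /(mulIf (invr_neq0 J0)) /eqP; rewrite eqr_nat => /eqP h.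
by apply: enum_rank_inj; exact: val_inj.
Qed.

Lemma label_ge0 j : 0 <= label j. Proof. by rewrite divr_ge0. Qed.

Lemma label_le1 j : label j <= 1.
Proof.
have J0 : 0 < #|J|%:R :> R by rewrite ltr0n; apply/card_gt0P; exists j.
by rewrite ler_pdivrMr// mul1r ler_nat ltnW.
Qed.

(** A convex combination, rather than a translation, with the point (l e_a, l e_b) where l is the
    label: both of its components have norm at most 1, so the second moments stay at most 1. *)
Definition perturb (x : R) (j : J) : phase :=
  (\row_i ((1 - x) * (p j).1 0 i + x * (label j *+ (i == a))),
   \row_i ((1 - x) * (p j).2 0 i + x * (label j *+ (i == b)))).

(* If the perturbed lines [j] and [j'] meet, eliminating the time between the
   coordinates [a] and [b] makes this polynomial vanish at [x]; its value at 1
   is the square of the difference of the labels. *)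
Definition meet_poly (jj : J * J) : {poly R} :=
  let Dx i := ((p jj.1).1 0 i - (p jj.2).1 0 i)%:P in
  let Dv i := ((p jj.1).2 0 i - (p jj.2).2 0 i)%:P in
  let Dl := (label jj.1 - label jj.2)%:P in
  ((1%:P - 'X) * Dx a + 'X * Dl) * ((1%:P - 'X) * Dv b + 'X * Dl) -
  (1%:P - 'X) * Dv a * ((1%:P - 'X) * Dx b).

Lemma meet_poly_neq0 jj : jj.1 != jj.2 -> meet_poly jj != 0.
Proof.
move=> jj'; apply/eqP => /(congr1 (fun P : {poly R} => P.[1])).
have -> : (meet_poly jj).[1] = (label jj.1 - label jj.2) * (label jj.1 - label jj.2).
  by rewrite /meet_poly !(hornerD, hornerN, hornerM, hornerC, hornerX); ring.
rewrite horner0 => /eqP.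
by rewrite mulf_eq0 orbb subr_eq0 => /eqP/label_inj/eqP; rewrite (negbTE jj').
Qed.

Lemma perturb_free x j j' t : ~~ root (meet_poly (j, j')) x ->
  line (perturb x j) t != line (perturb x j') t.
Proof.
apply: contra => /eqP E; rewrite /root /meet_poly !(hornerD, hornerN, hornerM, hornerC, hornerX) /=.
have ba : (b == a) = false by rewrite eq_sym (negbTE ab).
have := congr1 (fun y : 'rV[R]_d => y 0 a) E; have := congr1 (fun y : 'rV[R]_d => y 0 b) E.
rewrite /line /= !mxE !eqxx (negbTE ab) ba !mulr1n !mulr0n !mulr0 !addr0.
set xa := (p j).1 0 a; set xb := (p j).1 0 b; set va := (p j).2 0 a; set vb := (p j).2 0 b.
set xa' := (p j').1 0 a; set xb' := (p j').1 0 b; set va' := (p j').2 0 a.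
set vb' := (p j').2 0 b; set l := label j; set l' := label j'.
move=> hb ha; apply/eqP.
have ha' : (1 - x) * (xa - xa') + x * (l - l') = - (t * ((1 - x) * (va - va'))).
  by move/eqP: ha; rewrite -subr_eq0 => /eqP ha; apply/eqP; rewrite -subr_eq0 -{}[X in _ == X]ha; apply/eqP; ring.
have hb' : (1 - x) * (xb - xb') = - (t * ((1 - x) * (vb - vb') + x * (l - l'))).
  by move/eqP: hb; rewrite -subr_eq0 => /eqP hb; apply/eqP; rewrite -subr_eq0 -{}[X in _ == X]hb; apply/eqP; ring.
by rewrite ha' hb'; ring.
Qed.

End perturbation.

(** * Rounding to finitely many values *)

Section rounding.
Import HBSimple HBNNSimple.
Context {R : realType}.
Local Notation RT := (measurableTypeR R).

Let pos_part (c : RT) : \bar R := (Num.max 0 (c : R))%:E.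

Let mpos_part : measurable_fun setT pos_part.
Proof.
apply/measurable_EFinP; apply: measurable_maxr; [exact: measurable_cst|exact: measurable_id].
Qed.

Let pos_part_ge0 c : setT c -> (0 <= pos_part c)%E.
Proof. by move=> _; rewrite lee_fin le_max lexx. Qed.

(** The standard increasing approximation by simple functions, applied to the positive part: it has
    finite range and stays below its limit, which is how rounding avoids increasing second
    moments. *)
Definition approx_pos (n : nat) (c : R) : R :=
  (nnsfun_approx (@measurableT _ RT) mpos_part n : {nnsfun RT >-> R}) c.

Lemma measurable_approx_pos n : measurable_fun [set: RT] (approx_pos n).
Proof. exact: measurable_funPT. Qed.

Lemma approx_pos_ge0 n c : 0 <= approx_pos n c.
Proof. exact: fun_ge0. Qed.

Lemma cvg_approx_pos (c : R) : approx_pos n c @[n --> \oo] --> Num.max 0 c.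
Proof.
have h := @cvg_nnsfun_approx _ _ R setT measurableT pos_part mpos_part pos_part_ge0 c I.
exact: (fine_cvg h).
Qed.

Lemma approx_pos_le n c : approx_pos n c <= Num.max 0 c.
Proof.
have nd : nondecreasing_seq (approx_pos ^~ c).
  by move=> k m km; exact: (lefP _ _ (@nd_nnsfun_approx _ _ R setT measurableT pos_part mpos_part _ _ km)).
rewrite -(cvg_lim (@Rhausdorff R) (@cvg_approx_pos c)).
apply: nondecreasing_cvgn_le => //; apply: cvgP; exact: cvg_approx_pos.
Qed.

(* A finite-range approximation of the identity, dominated by the identity. *)
Definition round n (c : R) : R := approx_pos n c - approx_pos n (- c).

Lemma measurable_round n : measurable_fun [set: RT] (round n).
Proof.
apply: measurable_funB; first exact: measurable_approx_pos.
apply: (measurableT_comp (measurable_approx_pos n)).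
exact: (@oppr_measurable R setT).
Qed.

Lemma round_le n c : `|round n c| <= `|c|.
Proof.
rewrite /round; have h1 := approx_pos_ge0 n c; have h2 := approx_pos_ge0 n (- c).
have := approx_pos_le n c; have := approx_pos_le n (- c).
have [c0|c0] := leP 0 c.
  rewrite [in Num.max 0 (- c)]max_l ?oppr_le0// (ger0_norm c0) => h3 h4.
  rewrite ler_norml; apply/andP; split; lra.
rewrite [Num.max 0 (- c)]max_r ?oppr_ge0 ?(ltW c0)// (ltr0_norm c0) => h3 h4.
rewrite ler_norml; apply/andP; split; lra.
Qed.

Lemma cvg_round c : round n c @[n --> \oo] --> c.
Proof.
have E : Num.max 0 c - Num.max 0 (- c) = c.
  have [c0|c0] := leP 0 c; first by rewrite max_l ?subr0// oppr_le0.
  by rewrite max_r ?sub0r ?opprK// oppr_ge0 ltW.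
have h : (fun n => approx_pos n c - approx_pos n (- c)) @ \oo -->
    Num.max 0 c - Num.max 0 (- c).
  by apply: cvgB; exact: cvg_approx_pos.
by rewrite E in h.
Qed.

Lemma finite_round n : exists s : seq R, forall c, round n c \in s.
Proof.
have : finite_set (range (nnsfun_approx (@measurableT _ RT) mpos_part n : {nnsfun RT >-> R})).
  exact: fimfunP.
move=> /finite_seqP[s sE]; exists [seq x - y | x <- s, y <- s] => c.
have h c' : approx_pos n c' \in s.
  have : [set` s] (approx_pos n c') by rewrite -sE; exists c'.
  by [].
by apply: allpairs_f.
Qed.

End rounding.

(** * Discrete data with free lines *)

Section discretization.
Context {R : realType} (d : nat) (a b : 'I_d) (ab : a != b).
Local Notation phase := ('rV[R]_d * 'rV[R]_d)%type.

Section step.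
Variable n : nat.

Let rs : seq R := sval (cid (@finite_round R n)).
Let rsP c : round n c \in rs. Proof. exact: (svalP (cid (@finite_round R n))). Qed.

(** All tuples of rounded coordinates, attained or not: this is a finite type outright, and the
    perturbation separates all of them. *)
Definition cell : finType := ({ffun 'I_d -> seq_sub rs} * {ffun 'I_d -> seq_sub rs})%type.

Definition cell_point (j : cell) : phase := (\row_i ssval (j.1 i), \row_i ssval (j.2 i)).

Definition cell_of (z : phase) : cell :=
  ([ffun i => SeqSub (rsP (z.1 0 i))], [ffun i => SeqSub (rsP (z.2 0 i))]).

Lemma shift_exists : exists x : R, 0 < x < n.+1%:R^-1 /\
  forall jj : cell * cell, jj.1 != jj.2 -> ~~ root (meet_poly a b cell_point jj) x.
Proof.
have [x xc h] := @common_nonroot_small R (cell * cell)%type (fun jj => jj.1 != jj.2)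
  (meet_poly a b cell_point) n.+1%:R^-1 (fun jj => @meet_poly_neq0 R d a b cell cell_point jj)
  (ltac:(by rewrite invr_gt0)).
by exists x.
Qed.

Definition shift_size : R := sval (cid shift_exists).

Lemma shift_size_gt0 : 0 < shift_size.
Proof. by have [/andP[]] := svalP (cid shift_exists). Qed.

Lemma shift_size_lt : shift_size < n.+1%:R^-1.
Proof. by have [/andP[]] := svalP (cid shift_exists). Qed.

Lemma shift_size_le1 : shift_size <= 1.
Proof. by rewrite (le_trans (ltW shift_size_lt))// invf_le1// ler1n. Qed.

Definition cell_perturb : cell -> phase := perturb a b cell_point shift_size.

Lemma cell_perturb_free j j' t : j != j' -> line (cell_perturb j) t != line (cell_perturb j') t.
Proof.
move=> jj'; apply: perturb_free => //.
exact: ((svalP (cid shift_exists)).2 (j, j')).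
Qed.

Definition discretize (z : phase) : phase := cell_perturb (cell_of z).

Lemma discretize1E z i : (discretize z).1 0 i =
  (1 - shift_size) * round n (z.1 0 i) + shift_size * (label (cell_of z) *+ (i == a)).
Proof. by rewrite /discretize /cell_perturb /perturb /= !mxE ffunE. Qed.

Lemma discretize2E z i : (discretize z).2 0 i =
  (1 - shift_size) * round n (z.2 0 i) + shift_size * (label (cell_of z) *+ (i == b)).
Proof. by rewrite /discretize /cell_perturb /perturb /= !mxE ffunE. Qed.

Let round_eq_measurable (f : borel phase -> R) x : measurable_fun setT f ->
  measurable [set z | round n (f z) = x].
Proof.
move=> mf; have m := measurableT_comp (measurable_round n) mf.
by have := m measurableT [set x] (measurable_set1 x); rewrite setTI.
Qed.

Lemma measurable_cell (j : cell) : measurable [set z : borel phase | cell_of z = j].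
Proof.
rewrite (_ : [set z | _] =
  \bigcap_(i in [set: 'I_d]) [set z : borel phase | round n (z.1 0 i) = ssval (j.1 i)] `&`
  \bigcap_(i in [set: 'I_d]) [set z : borel phase | round n (z.2 0 i) = ssval (j.2 i)]).
  apply: measurableI; apply: countType_bigcap_measurable => i; apply: round_eq_measurable.
    exact: measurable_fst_coord.
  exact: measurable_snd_coord.
apply/seteqP; split => [z <-|z [h1 h2]].
  by split=> i _; rewrite /= ffunE.
case: j h1 h2 => j1 j2 /= h1 h2; congr pair; apply/ffunP => i; rewrite ffunE; apply: val_inj => /=.
  exact: h1.
exact: h2.
Qed.

Lemma measurable_label : measurable_fun setT (fun z : borel phase => label (cell_of z) : R).
Proof.
rewrite (_ : (fun z => _) = fun z : borel phase =>
    \sum_(j : cell) label j * \1_[set z : borel phase | cell_of z = j] z).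
  apply: measurable_sum => j; apply: measurable_funM; first exact: measurable_cst.
  by apply: measurable_indic; exact: measurable_cell.
apply/funext => z; rewrite (bigD1 (cell_of z))//= indicE mem_set// mulr1 big1 ?addr0// => j jz.
by rewrite indicE memNset ?mulr0// => /= E; rewrite E eqxx in jz.
Qed.

Lemma measurable_discretize : measurable_fun setT (discretize : borel phase -> borel phase).
Proof.
have ml (c : 'I_d) i : measurable_fun setT
    (fun z : borel phase => shift_size * (label (cell_of z) *+ (i == c))).
  apply: measurable_funM; first exact: measurable_cst.
  by case: (i == c); rewrite ?mulr1n ?mulr0n; [exact: measurable_label|exact: measurable_cst].
have mr (f : borel phase -> R) : measurable_fun setT f ->
    measurable_fun setT (fun z => (1 - shift_size) * round n (f z)).
  move=> mf; apply: measurable_funM; first exact: measurable_cst.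
  exact: (measurableT_comp (measurable_round n) mf).
rewrite (_ : discretize = fun z => ((discretize z).1, (discretize z).2)); last first.
  by apply/funext => z; case: (discretize z).
apply: measurable_row_pair => i.
  under eq_fun do rewrite discretize1E.
  exact: (measurable_funD (mr _ (measurable_fst_coord i)) (ml a i)).
under eq_fun do rewrite discretize2E.
exact: (measurable_funD (mr _ (measurable_snd_coord i)) (ml b i)).
Qed.

(** Convexity of the square in each coordinate, after which rounding only decreases the first term
    and the label vector has norm at most 1. In [moment_convex] the weights 1 - x and x add up to 1,
    so the bound 1 is preserved exactly. *)
Lemma enorm_convex_round (y : 'rV[R]_d) (w : 'rV[R]_d) (c : 'I_d) (l : R) :
  0 <= l -> l <= 1 ->
  (forall i, w 0 i = (1 - shift_size) * round n (y 0 i) + shift_size * (l *+ (i == c))) ->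
  enorm w ^+ 2 <= (1 - shift_size) * enorm y ^+ 2 + shift_size.
Proof.
move=> l0 l1 wE; have x0 := shift_size_gt0; have x1 := shift_size_le1.
rewrite !enorm_sqr mulr_sumr.
have -> : shift_size = \sum_i (shift_size *+ (i == c)).
  by rewrite (bigD1 c)//= eqxx mulr1n big1 ?addr0// => i /negbTE ->.
rewrite -big_split/=; apply: ler_sum => i _; rewrite wE.
have h : round n (y 0 i) ^+ 2 <= y 0 i ^+ 2.
  rewrite -(real_normK (num_real (y 0 i))) -(real_normK (num_real (round _ _))).
  by rewrite lerXn2r ?nnegrE// round_le.
have -> : \sum_i0 shift_size *+ (i0 == c) = shift_size.
  by rewrite (bigD1 c)//= eqxx mulr1n big1 ?addr0// => k /negbTE ->.
set x := shift_size in x0 x1 *; set u := round _ _ in h *; set v := y 0 i in h *.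
set m := l *+ _.
have m2 : x * m ^+ 2 <= x *+ (i == c).
  rewrite /m; case: (i == c); rewrite ?mulr1n ?mulr0n ?expr0n ?mulr0//.
  by rewrite ler_piMr ?(ltW x0)// expr_le1.
have cv : ((1 - x) * u + x * m) ^+ 2 = (1 - x) * u ^+ 2 + x * m ^+ 2 - x * (1 - x) * (u - m) ^+ 2.
  by ring.
have p : 0 <= x * (1 - x) * (u - m) ^+ 2.
  apply: mulr_ge0; last exact: sqr_ge0.
  by apply: mulr_ge0; [exact: ltW|rewrite subr_ge0].
have q : (1 - x) * u ^+ 2 <= (1 - x) * v ^+ 2 by rewrite ler_wpM2l// subr_ge0.
by rewrite cv; move: m2 p q; clear; lra.
Qed.

Lemma moment_convex (nu : probability (borel phase) R) (f g : borel phase -> 'rV[R]_d) :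
  (forall i, measurable_fun setT (fun z => f z 0 i)) ->
  (forall i, measurable_fun setT (fun z => g z 0 i)) ->
  (forall z, enorm (f z) ^+ 2 <= (1 - shift_size) * enorm (g z) ^+ 2 + shift_size) ->
  (\int[nu]_z (enorm (g z) ^+ 2)%:E <= 1)%E -> (\int[nu]_z (enorm (f z) ^+ 2)%:E <= 1)%E.
Proof.
move=> mf mg fg g1; have x0 := shift_size_gt0; have x1 := shift_size_le1.
have mG := measurable_enorm_borel mg.
apply: (@le_trans _ _ (\int[nu]_z ((1 - shift_size)%:E * (enorm (g z) ^+ 2)%:E + shift_size%:E))%E).
  apply: ge0_le_integral => //.
  - by move=> z _; rewrite lee_fin sqr_ge0.
  - exact: measurable_enorm_borel.
  - by apply: emeasurable_funD => //; exact: measurable_funeM.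
  - by move=> z _; rewrite -EFinM -EFinD lee_fin.
rewrite ge0_integralD//; last 3 first.
- by move=> z _; rewrite -EFinM lee_fin mulr_ge0 ?sqr_ge0// subr_ge0.
- exact: measurable_funeM.
- by move=> z _; rewrite lee_fin ltW.
rewrite ge0_integralZl//; last 2 first.
- by move=> z _; rewrite lee_fin sqr_ge0.
- by rewrite lee_fin subr_ge0.
rewrite integral_cst// [X in (_ + _ * X)%E]probability_setT mule1.
apply: (@le_trans _ _ ((1 - shift_size)%:E * 1 + shift_size%:E)%E).
  by rewrite leeD2r// lee_wpmul2l// lee_fin subr_ge0.
by rewrite mule1 -EFinD subrK.
Qed.

Definition discrete_data (nu : probability (borel phase) R) : probability (borel phase) R :=
  push nu measurable_discretize.

Lemma discrete_data_P21 nu : P21 (nu : Prob R phase) -> P21 (discrete_data nu : Prob R phase).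
Proof.
have m1 i : measurable_fun setT (fun z : borel phase => (discretize z).1 0 i).
  exact: (measurableT_comp (measurable_fst_coord i) measurable_discretize).
have m2 i : measurable_fun setT (fun z : borel phase => (discretize z).2 0 i).
  exact: (measurableT_comp (measurable_snd_coord i) measurable_discretize).
move=> [n1 n2]; split; rewrite /moment2.
  rewrite [leLHS](ge0_integral_push nu measurable_discretize (measurable_enorm_borel (@measurable_fst_coord R d))); last first.
    by move=> z; rewrite lee_fin sqr_ge0.
  apply: (moment_convex m1 (@measurable_fst_coord R d)) n1 => z.
  apply: (@enorm_convex_round z.1 (discretize z).1 a (label (cell_of z))).
  - exact: label_ge0.
  - exact: label_le1.
  - exact: discretize1E.
rewrite [leLHS](ge0_integral_push nu measurable_discretize (measurable_enorm_borel (@measurable_snd_coord R d))); last first.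
  by move=> z; rewrite lee_fin sqr_ge0.
apply: (moment_convex m2 (@measurable_snd_coord R d)) n2 => z.
apply: (@enorm_convex_round z.2 (discretize z).2 b (label (cell_of z))).
- exact: label_ge0.
- exact: label_le1.
- exact: discretize2E.
Qed.

End step.

Lemma cvg_discretize_coord (c e : R) (l : nat -> R) : 0 < e -> (forall n, `|l n| <= 1) ->
  \forall n \near \oo, `|c - ((1 - shift_size n) * round n c + shift_size n * l n)| <= e.
Proof.
move=> e0 l1.
have e2 : 0 < e / 2 by rewrite divr_gt0.
have /cvgrPdist_lt/(_ _ e2) h1 := @cvg_round R c.
have c1 : 0 < `|c| + 1 by rewrite ltr_wpDl.
have h2 := near_natSinv_lt (divr_gt0 e2 c1).
near=> n.
have a1 : `|c - round n c| < e / 2 by near: n; exact: h1.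
have : n.+1%:R^-1 < e / 2 / (`|c| + 1) by near: n; exact: h2.
rewrite ltr_pdivlMr// => a2.
have x0 := shift_size_gt0 n; have x1 := shift_size_lt n.
have -> : c - ((1 - shift_size n) * round n c + shift_size n * l n) =
    (c - round n c) + shift_size n * (round n c - l n) by ring.
apply: le_trans (ler_normD _ _) _; rewrite (splitr e) lerD//; first exact: ltW.
apply: le_trans (ltW a2); rewrite normrM gtr0_norm//.
apply: ler_pM => //; [exact: ltW|exact: ltW|].
by rewrite (le_trans (ler_normB _ _))// lerD// round_le.
Unshelve. all: by end_near. Qed.

Lemma cvg_discretize z : discretize n z @[n --> \oo] --> z.
Proof.
move=> A /nbhs_ballP[e /= e0 eA].
have e2 : 0 < e / 2 by rewrite divr_gt0.
have lab n (c i : 'I_d) : `|label (cell_of n z) *+ (i == c) : R| <= 1.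
  case: (i == c); rewrite ?mulr1n ?mulr0n ?normr0// ger0_norm ?label_ge0//.
  exact: label_le1.
have h1 : \forall n \near \oo, forall i, `|z.1 0 i - (discretize n z).1 0 i| <= e / 2.
  apply: filter_forall => i.
  have := @cvg_discretize_coord (z.1 0 i) _ _ e2 (fun n => lab n a i).
  by apply: filterS => n; rewrite discretize1E.
have h2 : \forall n \near \oo, forall i, `|z.2 0 i - (discretize n z).2 0 i| <= e / 2.
  apply: filter_forall => i.
  have := @cvg_discretize_coord (z.2 0 i) _ _ e2 (fun n => lab n b i).
  by apply: filterS => n; rewrite discretize2E.
apply: filterS2 h1 h2 => n k1 k2; apply: eA; rewrite -ball_normE /=.
apply: (@le_lt_trans _ _ (e / 2)); last by rewrite ltr_pdivrMr// ltr_pMr// ltr1n.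
rewrite ge_max; apply/andP; split; apply: norm_le_coord; try exact: ltW.
  move=> i; apply: le_trans (k1 i); rewrite le_eqVlt; apply/orP; left; apply/eqP.
  by congr (`|_|); rewrite /= !mxE.
move=> i; apply: le_trans (k2 i); rewrite le_eqVlt; apply/orP; left; apply/eqP.
by congr (`|_|); rewrite /= !mxE.
Qed.

End discretization.


Lemma ptws_cvgP {U : Type} {V : topologicalType} (F : set_system (U -> V)) (FF : Filter F)
    (f : U -> V) : {ptws, F --> f} <-> forall i, (fun g => g i) @ F --> f i.
Proof.
have surj i : (fun g : U -> V => g i) @` setT = setT.
  by rewrite eqEsubset; split=> v // _; exists (cst v).
rewrite cvg_sup; split=> h i; have := h i; rewrite (cvg_image _ _ (surj i)).
  move=> {}h; apply: cvg_trans h => Q /= [W FW <-].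
  have : F ((fun g => g i) @^-1` ((fun g => g i) @` W)).
    by apply: filterS FW; exact: preimage_image.
  by [].
move=> {}h; apply: cvg_trans h => W /= FW; exists ((fun g : U -> V => g i) @^-1` W) => //.
by rewrite image_preimage.
Qed.

(** * Weakly open conditions on the data *)

Section cutoff.
Context {R : realType} (d : nat).
Local Notation phase := ('rV[R]_d * 'rV[R]_d)%type.

(** Continuous, with values in [0, 1], equal to 1 at the points [p k] and to 0 off [close_to p e].
    So the condition that its integral exceeds 1 - e is weakly open, bounds the mass away from the
    points, and holds for data carried by the points. *)
Definition cutoff K (p : 'I_K -> phase) (e : R) (z : phase) : R :=
  Num.min 1 (\sum_k Num.max 0 (1 - `|z - p k| / e)).

Lemma continuous_dist (c : phase) : continuous (fun z : phase => `|z - c|).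
Proof.
move=> z A /nbhs_ballP[e /= e0 eA]; apply/nbhs_ballP; exists e => // y.
rewrite -ball_normE/= => zy; apply: eA; rewrite -ball_normE/=.
by apply: le_lt_trans (ler_dist_dist _ _) _; rewrite opprB addrA subrK.
Qed.

Lemma continuous_cutoff K (p : 'I_K -> phase) e : continuous (cutoff p e).
Proof.
move=> z; apply: (@continuous_min R phase (cst 1)); first exact: cvg_cst.
have h k : continuous (fun z : phase => Num.max 0 (1 - `|z - p k| / e)).
  move=> y; apply: (@continuous_max R phase (cst 0)); first exact: cvg_cst.
  have c1 : (fun z : phase => `|z - p k| * e^-1) @ y --> `|y - p k| * e^-1.
    by apply: cvgMl; exact: continuous_dist.
  have c2 : (fun _ : phase => 1 : R) @ y --> (1 : R) by exact: cvg_cst.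
  exact: (cvgB c2 c1).
have hs (s : seq 'I_K) : continuous (fun z : phase =>
    \sum_(k <- s) Num.max 0 (1 - `|z - p k| / e)).
  elim: s => [|k s IH].
    rewrite (_ : (fun _ => _) = cst 0); first by move=> y; exact: cvg_cst.
    by apply/funext => y; rewrite big_nil.
  rewrite (_ : (fun _ => _) = fun z : phase => Num.max 0 (1 - `|z - p k| / e) +
      \sum_(j <- s) Num.max 0 (1 - `|z - p j| / e)).
    by move=> y; exact: (cvgD (h k y) (IH y)).
  by apply/funext => y; rewrite big_cons.
exact: hs.
Qed.

Lemma cutoff_ge0 K (p : 'I_K -> phase) e z : 0 <= cutoff p e z.
Proof. by rewrite le_min ler01 sumr_ge0// => k _; rewrite le_max lexx. Qed.

Lemma cutoff_le1 K (p : 'I_K -> phase) e z : cutoff p e z <= 1.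
Proof. by rewrite ge_min lexx. Qed.

Lemma cutoff_out K (p : 'I_K -> phase) e z : 0 < e -> ~ close_to p e z -> cutoff p e z = 0.
Proof.
move=> e0 nz; rewrite /cutoff big1 ?min_r ?ler01// => k _.
rewrite max_l// subr_le0 ler_pdivlMr// mul1r leNgt; apply/negP => /ltW h.
by apply: nz; exists k.
Qed.

Lemma cutoff_center K (p : 'I_K -> phase) e k : cutoff p e (p k) = 1.
Proof.
rewrite /cutoff (bigD1 k)//= subrr normr0 mul0r subr0 max_r// min_l// lerDl.
by apply: sumr_ge0 => j _; rewrite le_max lexx.
Qed.

Lemma cutoff_Cb K (p : 'I_K -> phase) e : continuous (cutoff p e) /\ bounded_fun (cutoff p e).
Proof.
split; first exact: continuous_cutoff.
exists 1; split; rewrite ?num_real// => M /ltW M1 z _ /=.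
by rewrite ger0_norm ?cutoff_ge0// (le_trans (cutoff_le1 _ _ _)).
Qed.

Definition cutoff_fun K (p : 'I_K -> phase) e : @Cb R phase := exist _ _ (cutoff_Cb p e).

Lemma measurable_cutoff K (p : 'I_K -> phase) e : measurable_fun setT (cutoff p e : borel phase -> R).
Proof. exact: (measurable_continuous_borel (@continuous_cutoff K p e)). Qed.

Lemma integrable_cutoff K (p : 'I_K -> phase) e (nu : probability (borel phase) R) :
  nu.-integrable setT (EFin \o cutoff p e).
Proof.
apply: (integrable_bounded nu (B := 1) (measurable_cutoff p e)) => z.
by rewrite ger0_norm ?cutoff_ge0// cutoff_le1.
Qed.

Lemma cutoff_close K (p : 'I_K -> phase) e (nu : probability (borel phase) R) : 0 < e ->
  1 - e < \int[nu]_z cutoff p e z -> (nu (~` close_to p e) <= e%:E)%E.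
Proof.
move=> e0 h.
have mN := measurableC (measurable_close_to p e).
have i1 : nu.-integrable setT (EFin \o (fun _ : borel phase => 1 : R)).
  by apply: (integrable_bounded nu (B := 1)) => // z; rewrite normr1.
have iB : nu.-integrable setT (EFin \o (fun z => 1 - cutoff p e z)).
  by have := integrableB measurableT i1 (integrable_cutoff p e nu).
apply: (@le_trans _ _ (\int[nu]_z (1 - cutoff p e z)%:E)%E).
  rewrite -[X in (nu X <= _)%E]setIT -integral_indic//.
  apply: ge0_le_integral => //.
  - exact/measurable_EFinP/measurable_indic.
  - exact: (measurable_int _ iB).
  move=> z _; rewrite lee_fin indicE.
  have [cz|nz] := pselect (close_to p e z).
    by rewrite memNset ?subr_ge0 ?cutoff_le1// => /(_ cz).
  by rewrite mem_set// cutoff_out// subr0.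
rewrite -[leLHS]fineK; last exact: (integrable_fin_num measurableT iB).
rewrite lee_fin -/(Rintegral _ _ _) RintegralB//; last exact: integrable_cutoff.
rewrite (@Rintegral_cst _ _ _ nu setT measurableT) [X in fine X]probability_setT mulr1.
by move: h; lra.
Qed.

Lemma open_cutoff K (p : 'I_K -> phase) e :
  open [set nu : @P21 R d | 1 - e < \int[(set_val nu : probability (borel phase) R)]_z cutoff p e z].
Proof.
have c : continuous (fun nu : @P21 R d => integrate_Cb (set_val nu) (cutoff_fun p e)).
  move=> nu.
  have c1 : continuous (set_val : @P21 R d -> Prob R phase) by exact: initial_continuous.
  have c2 : continuous (@integrate_Cb R phase : Prob R phase -> {ptws _ -> _}).
    exact: initial_continuous.
  have c3 := (ptws_cvgP _ _).1 (c2 (set_val nu)) (cutoff_fun p e).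
  move=> A hA.
  have hB : nbhs (set_val nu : Prob R phase)
    [set x : Prob R phase | A (integrate_Cb x (cutoff_fun p e))] 
    by first [exact: (c3 (fmap_filter _ (nbhs_filter (set_val nu : Prob R phase))) A hA)
      | apply: (c3 _ A hA); apply: fmap_filter; exact: nbhs_filter
      | apply: (c3 _ A hA); exact: fmap_filter
      | have FF : Filter (nbhs (set_val nu : Prob R phase)) by apply: nbhs_filter;
        have FG := fmap_filter (@integrate_Cb R phase) FF; exact: (c3 FG A hA)].
  by have := c1 nu _ hB.
have /continuousP/(_ _ (@open_gt R (1 - e))) := c.
exact.
Qed.

Lemma cvg_P21 (mu : @P21 R d) (F : nat -> @P21 R d) :
  (forall f : @Cb R phase, integrate_Cb (set_val (F n)) f @[n --> \oo] --> integrate_Cb (set_val mu) f) ->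
  F @ \oo --> mu.
Proof.
move=> h.
have c2 : (fun n => integrate_Cb (set_val (F n)) : {ptws _ -> _}) @ \oo -->
    (integrate_Cb (set_val mu) : {ptws _ -> _}).
  by first [apply/ptws_cvgP => f; exact: h | apply: (ptws_cvgP _ _).2 => f; exact: h
    | by apply: (@ptws_cvgP _ _ _ (fmap_filter _ eventually_filter) _).2 => f; exact: h].
have c1 : (fun n => set_val (F n) : Prob R phase) @ \oo --> (set_val mu : Prob R phase).
  move=> U [?/= [[W oW <-]] /= Wsfz /filterS]; apply; apply: c2.
  exact: open_nbhs_nbhs.
move=> U [?/= [[W oW <-]] /= Wsfz /filterS]; apply; apply: c1.
exact: open_nbhs_nbhs.
Qed.

End cutoff.


(** * Generic data: openness, uniqueness, free flow, density *)

Section generic_data.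
Context {R : realType} (d : nat) (T : R) (T0 : 0 < T).
Local Notation Gam := (Gamma d T).
Local Notation RT := (measurableTypeR R).
Local Notation phase := ('rV[R]_d * 'rV[R]_d)%type.

Definition stable_drift n (nu : probability (borel phase) R) :=
  forall eta : probability (borel Gam) R, dissipative (eta : Prob R Gam) ->
  initial_data (eta : Prob R Gam) (nu : Prob R phase) ->
  forall t i, 0 <= t -> t < T ->
    \int[eta]_g `|position g t 0 i - (e0 g 0 i + t * W0 g 0 i)| <= n.+1%:R^-1.

(** The masses 2^-(n+1) are summable, as Borel-Cantelli requires. Only points at distance at least
    1/(n+1) are compared, since two data near the same configuration point may well have meeting
    lines. *)
Definition stable_support n (nu : probability (borel phase) R) :=
  exists E : set (borel phase), [/\ measurable E,
    (nu (~` E) <= (1 / (2 ^ n.+1)%:R)%:E)%E &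
    forall z z', E z -> E z' -> n.+1%:R^-1 <= `|z - z'| ->
      forall t, 0 <= t -> t <= T -> line z t != line z' t].

Definition stable_cutoff n K (p : 'I_K -> phase) (e : R) :=
  0 < e /\ forall nu : probability (borel phase) R, P21 (nu : Prob R phase) ->
    1 - e < \int[nu]_z cutoff p e z -> stable_drift n nu /\ stable_support n nu.

(** The union runs over all finite configurations and radii having the property, so it is open as a
    union of open sets; no choice of a radius is involved. *)
Definition stable n : set (@P21 R d) := \bigcup_(q in
    [set q : {K : nat & (('I_K -> phase) * R)%type} | stable_cutoff n (projT2 q).1 (projT2 q).2])
  [set nu | 1 - (projT2 q).2 <
    \int[(set_val nu : probability (borel phase) R)]_z cutoff (projT2 q).1 (projT2 q).2 z].

Lemma open_stable n : open (stable n).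
Proof. by apply: bigcup_open => q _; exact: open_cutoff. Qed.

Lemma free_stable_cutoff n K (p : 'I_K -> phase) : free_lines T p ->
  exists e, stable_cutoff n p e.
Proof.
move=> fp; have c0 : 0 < n.+1%:R^-1 :> R by rewrite invr_gt0.
have [e1 e10 h1] := close_lines_free T0 fp c0.
have c1 : 0 < 1 / (2 ^ n.+1)%:R :> R by rewrite divr_gt0// ltr0n expn_gt0.
have [|e [he0 ee1 h2]] := small_drift (e1 := Num.min e1 (1 / (2 ^ n.+1)%:R)) T0 fp c0.
  by rewrite lt_min e10.
exists e; split => // nu nu21 /(cutoff_close he0) nue; split.
  by move=> eta deta ieta t i t0 tT; exact: h2 nu21 nue eta deta ieta t i t0 tT.
move: ee1; rewrite le_min => /andP[ee1 ee2].
exists (close_to p e); split; first exact: measurable_close_to.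
  by apply: le_trans nue _; rewrite lee_fin.
by move=> z z' Ez Ez' zz'; exact: (h1 e ee1 z z' Ez Ez' zz').
Qed.

(** A mean drift below every 1/(n+1) is zero, for each rational time and each coordinate; countably
    many null sets are then discarded together with the curves outside W^{1,2}. *)
Lemma generic_unique_straight (nu : probability (borel phase) R) :
  P21 (nu : Prob R phase) -> (forall n, stable_drift n nu) ->
  forall eta : probability (borel Gam) R, dissipative (eta : Prob R Gam) ->
  initial_data (eta : Prob R Gam) (nu : Prob R phase) -> {ae eta, forall g, (@straight R d T) g}.
Proof.
move=> nu21 sd eta deta ieta.
have h (q : rat) (i : 'I_d) : {ae eta, forall g : borel Gam, 0 <= (ratr q : R) < T ->
    position g (ratr q) 0 i = e0 g 0 i + ratr q * W0 g 0 i}.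
  have [q0T|nq] := pselect (0 <= (ratr q : R) < T); last by apply: aeW => g /nq.
  have /andP[q0 qT] := q0T.
  pose f (g : borel Gam) := position g (ratr q) 0 i - (e0 g 0 i + ratr q * W0 g 0 i).
  have iW : eta.-integrable setT (EFin \o (fun g : borel Gam => (ratr q : R) * W0 g 0 i)).
    have := integrableZl measurableT (ratr q : R) (integrable_W0 T0 ieta nu21 i).
    by apply: eq_integrable => // g _; rewrite /= EFinM.
  have i1 := integrableD measurableT (integrable_e0 T0 ieta nu21 i) iW.
  have i2 : eta.-integrable setT (EFin \o f).
    by have := integrableB measurableT (integrable_position T0 deta ieta nu21 i q0 qT) i1.
  have I0 : \int[eta]_g `|f g| = 0.
    apply/eqP; rewrite eq_le Rintegral_ge0// andbT leNgt; apply/negP => pos.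
    have [N _ hN] := near_natSinv_lt pos.
    have := sd N eta deta ieta (ratr q) i q0 qT.
    by rewrite leNgt (hN N (leqnn N)).
  have I0' : (\int[eta]_g `|(EFin \o f) g| = 0)%E.
    have ia := integrable_normr i2.
    by rewrite -[LHS]fineK ?(integrable_fin_num measurableT ia)//; congr EFin; exact: I0.
  have := (ae_eq_integral_abs eta measurableT (measurable_int _ i2)).1 I0'.
  by apply: filterS => g /(_ I) [] /eqP; rewrite subr_eq0 => /eqP.
have hq : {ae eta, forall g : borel Gam, forall n : nat, if unpickle n is Some q then
    forall i : 'I_d, 0 <= (ratr q : R) < T ->
    position g (ratr q) 0 i = e0 g 0 i + ratr q * W0 g 0 i else True}.
  apply: ae_foralln => n; case: (unpickle n) => [q|]; last exact: aeW.
  by apply: filter_forall => i; exact: h.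
have W : {ae eta, forall g : borel Gam, Gamma_W12 g} by exact: (ae_Gamma_W12 T0 deta.1).
apply: filterS2 hq W => g gq Wg; split => // q _ i _ /=.
by have := gq (pickle q); rewrite pickleK; exact.
Qed.

(** A straight curve is a function of its initial data, so A and the preimage B of A under g |->
    [line_Gamma] (e0 g, W0 g) coincide almost surely, and the mass of B is fixed by nu. *)
Lemma straight_prob_eq (nu : probability (borel phase) R) (eta : probability (borel Gam) R) :
  initial_data (eta : Prob R Gam) (nu : Prob R phase) ->
  {ae eta, forall g, (@straight R d T) g} ->
  prob_eq (eta : Prob R Gam) (straight_flow T0 nu : Prob R Gam).
Proof.
move=> ieta sg A mA.
have mLA : measurable ((line_Gamma T0 : borel phase -> borel Gam) @^-1` A).
  by rewrite -[X in measurable X]setTI; exact: measurable_line_Gamma.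
pose B : set (borel Gam) :=
  (fun g : borel Gam => (e0 g, W0 g) : borel phase) @^-1` ((line_Gamma T0 : borel phase -> borel Gam) @^-1` A).
have mB : measurable B.
  have mp0 : measurable_fun setT ((fun g => (e0 g, W0 g)) : borel Gam -> borel phase).
    by apply: measurable_row_pair => i; [exact: measurable_e0|exact: measurable_W0].
  by rewrite -[X in measurable X]setTI; exact: mp0.
have -> : straight_flow T0 nu A = eta B by rewrite pushE -(ieta _ mLA).
have I (C : set (borel Gam)) : measurable C -> eta C = (\int[eta]_g (\1_C g)%:E)%E.
  by move=> mC; rewrite integral_indic// setIT.
rewrite (I A mA) (I B mB); apply: ae_eq_integral => //.
- exact/measurable_EFinP/measurable_indic.
- exact/measurable_EFinP/measurable_indic.
apply: filterS sg => g /straightP sg _; congr EFin; rewrite !indicE; congr (_ : bool)%:R.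
by apply/idP/idP; rewrite !inE /B /= -(sg T0).
Qed.

(** By Borel-Cantelli almost every point lies in [E n] for all large n. Two distinct such points are
    eventually in the same [E n] and farther apart than 1/(n+1), so their lines never meet. *)
Lemma generic_free_flow (nu : probability (borel phase) R) : P21 (nu : Prob R phase) ->
  (forall n, stable_support n nu) -> free_flow (straight_flow T0 nu : Prob R Gam).
Proof.
move=> nu21 /(_ _)/cid - /all_sig[E /all_and3[mE nuE sepE]].
pose B := lim_sup_set (fun n => ~` E n).
have mEc n : measurable (~` E n) by exact: measurableC.
have nuB : nu B = 0.
  apply: lim_sup_set_cvg0 => //.
  apply: (@le_lt_trans _ _ (\sum_(n <oo) (1 / (2 ^ n.+1)%:R)%:E)%E).
    by apply: lee_nneseries => [n _ _|n _]; [exact: measure_ge0|exact: nuE].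
  by apply: le_lt_trans (epsilon_trick0 predT ler01) _; rewrite ltry.
have mB : measurable B.
  by apply: bigcapT_measurable => n; apply: bigcup_measurable.
have mp0 : measurable_fun setT ((fun g => (e0 g, W0 g)) : borel Gam -> borel phase).
  by apply: measurable_row_pair => i; [exact: measurable_e0|exact: measurable_W0].
pose S : set (borel Gam) := @straight R d T `&`
  (fun g : borel Gam => (e0 g, W0 g) : borel phase) @^-1` (~` B).
exists S; split.
- apply: (ae_push (@measurable_line_Gamma R d T T0)).
    apply: measurableI; first exact: measurable_straight.
    by rewrite -[X in measurable X]setTI; apply: mp0 => //; exact: measurableC.
  exists B; split => // z nS; apply: contrapT => nB; apply: nS.
  split; first exact: straight_line_Gamma.
  by rewrite /= e0_line_Gamma W0_line_Gamma; case: z nB.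
- move=> g [/(straightP T0) -> _].
  exists (e0 g), (W0 g).
  exact: (line_L2E _ (e0 g, W0 g)).
move=> g1 g2 [/(straightP T0) E1 B1] [/(straightP T0) E2 B2] ne t.
rewrite in_itv/= => /andP[t0 tT].
set z1 : phase := (e0 g1, W0 g1) in E1 B1; set z2 : phase := (e0 g2, W0 g2) in E2 B2.
have t1 : -1 <= t := le_trans (lerN10 R) t0.
rewrite E1 E2 !position_line_Gamma//.
have z12 : 0 < `|z1 - z2|.
  by rewrite normr_gt0 subr_eq0; apply/eqP => z12; apply: ne; rewrite E1 E2 z12.
have ev z : ~ B z -> exists N, forall n, (N <= n)%N -> E n z.
  move=> /existsNP[N /not_implyP[_ nN]]; exists N => n Nn.
  by apply: contrapT => nE; apply: nN; exists n.
have [N1 h1] := ev _ B1; have [N2 h2] := ev _ B2.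
have [N3 _ h3] := near_natSinv_lt z12.
pose n := maxn N1 (maxn N2 N3).
apply/eqP; apply: (sepE n) => //.
- by apply: h1; rewrite leq_maxl.
- by apply: h2; rewrite leq_max leq_maxl orbT.
- by apply: ltW; apply: h3; rewrite /= /n !leq_max leqnn !orbT.
Qed.

Lemma bounded_Cb (f : @Cb R phase) : exists2 B, 0 <= B & forall z, `|sval f z| <= B.
Proof.
have [_ [M [_ hM]]] := svalP f.
have hM1 : M < `|M| + 1 by rewrite (le_lt_trans (ler_norm _))// ltrDl.
by exists (`|M| + 1) => // z; exact: (hM _ hM1 z I).
Qed.

(** No Baire argument: each discretised datum lies in every [stable n], because its lines are free
    and its [cutoff] integral is 1. These data converge weakly to the original ones by dominated
    convergence. *)
Lemma dense_stable (a b : 'I_d) : a != b -> dense (\bigcap_n stable n).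
Proof.
move=> ab O [mu Omu] oO.
have mu21 := set_valP mu; pose m : probability (borel phase) R := set_val mu.
pose F n : @P21 R d := exist _ (discrete_data a b n m : Prob R phase)
  (mem_set (@discrete_data_P21 R d a b n m mu21)).
have mD n := @measurable_discretize R d a b n.
have Fmu : F @ \oo --> mu.
  apply: cvg_P21 => f; have [B B0 fB] := bounded_Cb f.
  have mf : measurable_fun setT (sval f : borel phase -> R).
    by apply: measurable_continuous_borel; have [] := svalP f.
  have FE n : integrate_Cb (set_val (F n)) f = \int[m]_z (sval f (discretize a b n z)).
    have i1 := integrable_bounded (discrete_data a b n m) mf fB.
    rewrite /integrate_Cb /Rintegral; congr fine.
    transitivity (\int[pushforward m (discretize a b n : borel phase -> borel phase)]_z (sval f z)%:E)%E.
      exact: eq_measure_integral.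
    rewrite (integral_pushforward (mD n))//.
    - exact/measurable_EFinP.
    - apply: (integrable_bounded m (B := B)) => [|z]; last exact: fB.
      exact: (measurableT_comp mf (mD n)).
  under eq_fun do rewrite FE.
  have mfn n : measurable_fun setT (fun z : borel phase => (sval f (discretize a b n z))%:E).
    by apply/measurable_EFinP; exact: (measurableT_comp mf (mD n)).
  have im := integrable_bounded m mf fB.
  have pw : {ae m, forall z : borel phase, setT z ->
      (fun n => (sval f (discretize a b n z))%:E) @ \oo --> (sval f z)%:E}.
    apply: aeW => z _; apply: cvg_EFin; first exact: nearW.
    exact: (cvg_comp _ _ (@cvg_discretize R d a b z) ((svalP f).1 z)).
  have ig : m.-integrable setT (EFin \o (fun _ : borel phase => B)).
    by apply: (integrable_bounded m (B := B)) => // z; rewrite ger0_norm.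
  have bd : {ae m, forall (z : borel phase) n, setT z ->
      (`|(sval f (discretize a b n z))%:E| <= (EFin \o (fun _ : borel phase => B)) z)%E}.
    by apply: aeW => z n _; rewrite /= lee_fin.
  have [_ _ cv] := dominated_convergence measurableT mfn (measurable_int _ im) pw ig bd.
  have cv' : (fun n => (\int[m]_z (sval f (discretize a b n z))%:E)%E) @ \oo -->
      (integrate_Cb (set_val mu) f)%:E.
    rewrite /integrate_Cb /Rintegral fineK; first exact: cv.
    exact: (integrable_fin_num measurableT im).
  exact: (fine_cvg cv').
(* N depends on the open set O alone; the index n of [stable n] comes afterwards, and only the
   radius e depends on it. *)
have [N _ hN] : \forall n \near \oo, O (F n) by apply: Fmu; exact: open_nbhs_nbhs.
exists (F N); split; first exact: (hN N (leqnn N)).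
move=> n _.
pose p (k : 'I_#|@cell R d N|) : phase := cell_perturb a b (enum_val k).
have fp : free_lines T p.
  move=> k k' t kk' _ _; apply: cell_perturb_free => //.
  by apply: contra kk' => /eqP/enum_val_inj/eqP.
have [e se] := free_stable_cutoff n fp.
have I1 : \int[discrete_data a b N m]_z cutoff p e z = 1.
  have mc : measurable_fun setT (fun z : borel phase => (cutoff p e z)%:E).
    by apply/measurable_EFinP; exact: measurable_cutoff.
  rewrite /Rintegral (ge0_integral_push m (mD N) mc); last first.
    by move=> z; rewrite lee_fin cutoff_ge0.
  have -> : (\int[m]_z (cutoff p e (discretize a b N z))%:E =
      \int[m]_(z in [set: borel phase]) (cst 1%:E) z)%E.
    apply: eq_integral => z _.
    have -> : discretize a b N z = p (enum_rank (cell_of N z)).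
      by rewrite /p enum_rankK.
    by rewrite cutoff_center.
  by rewrite integral_cst// mul1e [X in fine X]probability_setT.
have lt1 : 1 - e < \int[discrete_data a b N m]_z cutoff p e z.
  by rewrite I1 gtrBl; exact: se.1.
exists (existT (fun K => (('I_K -> phase) * R)%type) #|@cell R d N| (p, e)); first exact: se.
exact: lt1.
Qed.

End generic_data.

Theorem theorem1p1 (R : realType) (d : nat) (T : R) (hd : (2 <= d)%N)
    (hT : 0 < T) :
  exists D0 : set (@P21 R d),
    (forall nu0 : @P21 R d, D0 nu0 ->
      exists eta : Prob R (Gamma d T),
        [/\ dissipative eta, initial_data eta (set_val nu0), free_flow eta &
          forall eta' : Prob R (Gamma d T),
            dissipative eta' -> initial_data eta' (set_val nu0) ->
            prob_eq eta' eta]) /\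
    dense D0 /\ Gdelta D0.

(* The two shift directions below are the basis vectors of indices 0 and 1, available since d >=
   2. *)
Proof.
have ab : Ordinal (ltnW hd) != Ordinal hd by [].
exists (\bigcap_n @stable R d T n); split; last first.
  split; first exact: (dense_stable hT ab).
  by exists (@stable R d T) => // n; exact: open_stable.
move=> nu0 hnu; pose nu : probability (borel ('rV[R]_d * 'rV[R]_d)%type) R := set_val nu0.
have nu21 : P21 (nu : Prob R ('rV[R]_d * 'rV[R]_d)%type) := set_valP nu0.
have st n : @stable_drift R d T n nu /\ @stable_support R d T n nu.
  by have [q [_ hq] hn] := hnu n I; exact: hq.
exists (straight_flow hT nu : Prob R (Gamma d T)); split.
- exact: straight_flow_dissipative.
- exact: straight_flow_initial_data.
- by apply: generic_free_flow => // n; exact: (st n).2.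
move=> eta' deta ieta; apply: straight_prob_eq => //.
by apply: (generic_unique_straight hT nu21 _ deta ieta) => n; exact: (st n).1.
Qed.
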